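(* Let $\lambda>0$, let $Q$ be a probability measure on $\mathbb{R}_+$ and $(H_\Delta)_{\Delta\in\mathcal{S}_{bp}}$ a family of Hamiltonians (as in the context), with non-empty set of Gibbs states $\mathbf{G}(\lambda)$. Assume that there is a disagreement coupling family at level $(\overline{\alpha},\overline{Q})$ for this Gibbs specification, where $\overline{Q}$ has bounded support and $\overline{\alpha}<\alpha_c(d,\overline{Q})$. Let $\kappa>0$ be a constant such that, for some $K>0$ and all Borel sets $\Lambda_1,\Lambda_2\subseteq\mathbb{R}^d$ with $\Lambda_1$ contained in a $d$-dimensional unit cube, $$P^{poi}_{\overline{\alpha},\overline{Q}}\big(\Lambda_1\text{ and }\Lambda_2\text{ are connected by }\xi\big)\le K\exp(-\kappa\,\theta(\Lambda_1,\Lambda_2)).$$ Then there is a unique Gibbs state $P$ in $\mathbf{G}(\lambda)$, and there exists $K'>0$ such that: (i) for all bounded Borel sets $\Lambda_1\subseteq\Lambda_2\subseteq\mathbb{R}^d$ with $\Lambda_1$ contained in a $d$-dimensional unit cube, all $\gamma\in\Omega_{\Lambda_2^c}$ and all $E\in\mathcal{F}_{\Lambda_1}$, $$\big|P^{gb(\lambda)}_{\Lambda_2,\gamma}(\xi_{\Lambda_1}\in E)-P(\xi_{\Lambda_1}\in E)\big|\le K'\exp(-\kappa\,\theta(\Lambda_1,\Lambda_2^c));$$ (ii) for all bounded Borel sets $\Lambda_1,\Lambda_2\subseteq\mathbb{R}^d$ with $\Lambda_1$ contained in a $d$-dimensional unit cube, all $E\in\mathcal{F}_{\Lambda_1}$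 and $F\in\mathcal{F}_{\Lambda_2}$, $$|P(E\cap F)-P(E)P(F)|\le K'\exp(-\kappa\,\theta(\Lambda_1,\Lambda_2));$$ (iii) for all $x,y\in\mathbb{R}^d$ the (reduced) pair correlation function $\rho$ of $P$ satisfies $$\rho(x,y)\le K'\exp(-\kappa\,\theta(x,y)).$$
   Context: Space. $S:=\mathbb{R}^d\times\mathbb{R}_+$ with Borel sets $\mathcal{S}$; $\mathcal{S}_{bp}$ is the collection of Borel sets of $S$ whose projection onto $\mathbb{R}^d$ is a bounded Borel set. $\Omega$ is the set of configurations $\omega\subseteq S$ with $|\omega\cap(\Lambda\times\mathbb{R}_+)|<\infty$ for every bounded $\Lambda\subseteq\mathbb{R}^d$; $\mathcal{F}$ is the $\sigma$-algebra on $\Omega$ generated by the counting variables. For $\Delta\in\mathcal{S}$, $\Omega_\Delta$ is the set of configurations contained in $\Delta$, $\omega_\Delta:=\omega\cap\Delta$, and $\mathcal{F}_\Delta$ is the $\sigma$-algebra generated by the events $\{\omega:\omega_\Delta\in E\}$, $E\in\mathcal{F}$. For Borel $\Lambda\subseteq\mathbb{R}^d$, a subscript $\Lambda$ abbreviates the subscript $\Lambda\times\mathbb{R}_+$ (so $\Omega_{\Lambda^c}$ is the set of configurations with all centres in $\Lambda^c$). A point process is identified with its law, a probability measure on $\Omega$ with canonical variable $\xi$. $\theta$ is the Euclidean distance between points, and between sets the infimum of pairwise distances. Connectivity. $B(x,r)$ is the closed Euclidean ball of radius $r$ around $x$, and $B(X):=B(x,r)$ for $X=(x,r)\in S$. The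 Gilbert graph $\mathcal{G}(\omega)$ has vertex set $\omega$ and an edge between $X,Y\in\omega$ whenever $B(X)\cap B(Y)\ne\emptyset$. $X,Y\in S$ are connected by $\omega$ if there is a path from $X$ to $Y$ in $\mathcal{G}(\omega\cup\{X,Y\})$; $X$ is connected by $\omega$ to a configuration $\omega'$ if it is connected by $\omega$ to some $Y\in\omega'$; Borel sets $\Lambda_1,\Lambda_2\subseteq\mathbb{R}^d$ are connected by $\omega$ if $(x,0)$ and $(y,0)$ are connected by $\omega$ for some $x\in\Lambda_1,y\in\Lambda_2$. Poisson process and percolation. For $\alpha>0$ and a probability measure $Q$ on $\mathbb{R}_+$, $P^{poi}_{\alpha,Q}$ is the law of the Poisson point process on $S$ with intensity measure $\alpha\,\mathcal{L}\otimes Q$ ($\mathcal{L}$ is Lebesgue measure on $\mathbb{R}^d$), and $P^{poi}_{\Delta,\alpha,Q}$ its restriction to $\Delta$. A configuration percolates if its Gilbert graph contains an infinite connected component. $\alpha_c(d,Q)\in[0,\infty]$ is the threshold intensity such that $P^{poi}_{\alpha,Q}$-almost no configuration percolates for $\alpha<\alpha_c(d,Q)$ and $P^{poi}_{\alpha,Q}$-almost every configuration percolates for $\alpha>\alpha_c(d,Q)$. Bounded support of $\overline{Q}$ means $\overline{Q}([0,r_0])=1$ for some $r_0<\infty$. (It is a known result that a constant $\kappa$ as in the claim exists for sub-critical intensity and bounded radii.) Hamiltonians. For every $\Delta\in\mathcal{S}_{bp}$, $H_\Delta:\Omega_\Delta\times\Omega_{\Delta^c}\to\,]-\infty,\infty]$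 is jointly measurable, $H_\Delta(\emptyset\mid\gamma)=0$, and for disjoint $\Delta_1,\Delta_2\in\mathcal{S}_{bp}$, $\omega^1\in\Omega_{\Delta_1}$, $\omega^2\in\Omega_{\Delta_2}$, $\gamma\in\Omega_{(\Delta_1\cup\Delta_2)^c}$, $$H_{\Delta_1\cup\Delta_2}(\omega^1\cup\omega^2\mid\gamma)=H_{\Delta_1}(\omega^1\mid\gamma\cup\omega^2)+H_{\Delta_2}(\omega^2\mid\gamma).$$ Gibbs specification and Gibbs states. For $\Delta\in\mathcal{S}_{bp}$ and $\gamma\in\Omega_{\Delta^c}$, $P^{gb(\lambda)}_{\Delta,\gamma}$ is the probability measure on $(\Omega_\Delta,\mathcal{F}_\Delta)$ $$P^{gb(\lambda)}_{\Delta,\gamma}(d\omega)=\frac{e^{-H_\Delta(\omega\mid\gamma)}}{Z(\lambda,\Delta,\gamma)}P^{poi}_{\Delta,\lambda,Q}(d\omega),\qquad Z(\lambda,\Delta,\gamma)=\int e^{-H_\Delta(\omega\mid\gamma)}P^{poi}_{\Delta,\lambda,Q}(d\omega).$$ A point process $P$ is a Gibbs state if for every $\Delta\in\mathcal{S}_{bp}$ and for $P$-a.e. value $\gamma$ of $\xi_{\Delta^c}$, $P(\xi_\Delta\in d\omega\mid\xi_{\Delta^c}=\gamma)=P^{gb(\lambda)}_{\Delta,\gamma}(d\omega)$ (DLR equations). $\mathbf{G}(\lambda)$ is the set of Gibbs states. Disagreement coupling family at level $(\overline{\alpha},\overline{Q})$: a family of probability measures $(P_{\Delta,\gamma^1,\gamma^2})$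 on $(\Omega_\Delta^3,\mathcal{F}_\Delta^{\otimes 3})$, indexed by $\Delta\in\mathcal{S}_{bp}$ and $\gamma^1,\gamma^2\in\Omega_{\Delta^c}$, measurable in the boundary conditions $(\gamma^1,\gamma^2)$, such that, with canonical variables $(\xi^1,\xi^2,\xi^3)$: (a) for $i=1,2$, $\xi^i$ has law $P^{gb(\lambda)}_{\Delta,\gamma^i}$; (b) $\xi^3$ has law $P^{poi}_{\Delta,\overline{\alpha},\overline{Q}}$; (c) $\xi^1\cup\xi^2\subseteq\xi^3$ almost surely; (d) almost surely every $X\in\xi^1\bigtriangleup\xi^2$ (symmetric difference) is connected by $\xi^3$ to $\gamma^1\cup\gamma^2$. Pair correlation. $\rho$ is the reduced (truncated) pair correlation function of $P$: the density with respect to $\mathcal{L}^2$, characterised by $$\mathbb{E}_P[|\xi_{\Lambda_1}||\xi_{\Lambda_2}|]-\mathbb{E}_P[|\xi_{\Lambda_1}|]\,\mathbb{E}_P[|\xi_{\Lambda_2}|]=\int_{\Lambda_1}\int_{\Lambda_2}\rho(x,y)\,dy\,dx$$ for all disjoint bounded Borel sets $\Lambda_1,\Lambda_2\subseteq\mathbb{R}^d$.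
   Formalization: In (i) the boundary conditions γ are restricted to radii at most r_0, where r_0 is any real with Q̄([0,r_0])=1, and K' may depend on r_0; for γ with arbitrarily large radii (i) is false, since one distant ball covering Λ_1 can influence it. *)

(* Defs.v *)
From HB Require Import structures.
From mathcomp Require Import all_boot all_order all_algebra.
From mathcomp Require Import all_classical all_reals all_analysis.
From mathcomp Require Import measurable_realfun.

Set Implicit Arguments.
Unset Strict Implicit.
Unset Printing Implicit Defensive.

Import Order.TTheory GRing.Theory Num.Theory.
Import numFieldNormedType.Exports.

Local Open Scope classical_set_scope.
Local Open Scope ring_scope.

(* R^d is [d.-tuple R]: the library's product sigma-algebra on tuples is the
   Borel sigma-algebra. *)
Section euclidean.
Context {R : realType} {d : nat}.
Implicit Types (x y : d.-tuple R) (A B : set (d.-tuple R)).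

Definition eucl x y : R := Num.sqrt (\sum_(i < d) (tnth x i - tnth y i) ^+ 2).

(* [+oo] when one of the sets is empty *)
Definition dist_sets A B : \bar R :=
  ereal_inf [set (eucl p.1 p.2)%:E | p in A `*` B].

Definition bounded_pts A := exists M : R, forall x y, A x -> A y -> eucl x y <= M.

Definition bounded_borel A := measurable A /\ bounded_pts A.

Definition in_unit_cube A :=
  exists a : d.-tuple R,
    A `<=` [set x | forall i, tnth a i <= tnth x i <= tnth a i + 1].

End euclidean.

Section lebesgue_tuple.
Context (R : realType).

Definition tuple_cons n (p : R * n.-tuple R) : n.+1.-tuple R :=
  [tuple of p.1 :: p.2].

Lemma measurable_tuple_cons n :
  measurable_fun [set: measurableTypeR R * n.-tuple R] (@tuple_cons n).
Proof.
exact: (@measurable_cons _ _ (measurableTypeR R * n.-tuple R)%type R fst n snd).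
Qed.

Section lebesgue_cons.
Variables (n : nat) (mu : {sigma_finite_measure set (n.-tuple R) -> \bar R}).

Definition lebesgue_cons : set (n.+1.-tuple R) -> \bar R :=
  pushforward (@lebesgue_measure R \x mu)%E (@tuple_cons n).

Let lebesgue_cons0 : lebesgue_cons set0 = 0%E.
Proof. by rewrite /lebesgue_cons /pushforward preimage_set0 measure0. Qed.

Let lebesgue_cons_ge0 A : (0 <= lebesgue_cons A)%E.
Proof. exact: integral_ge0. Qed.

Let lebesgue_cons_sigma_additive : semi_sigma_additive lebesgue_cons.
Proof.
exact: (@measure_semi_sigma_additive _ _ _
  (measure_function_pushforward__canonical__measure_function_Measure
     (@lebesgue_measure R \x mu)%E (@measurable_tuple_cons n))).
Qed.

HB.instance Definition _ := isMeasure.Build _ _ _ lebesgue_cons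
  lebesgue_cons0 lebesgue_cons_ge0 lebesgue_cons_sigma_additive.

Let lebesgue_cons_sigma_finite : sigma_finite setT lebesgue_cons.
Proof.
have /sigma_finiteP[F [TF ndF Foo]] := sigma_finiteT (@lebesgue_measure R).
have /sigma_finiteP[G [TG ndG Goo]] := sigma_finiteT mu.
pose u (t : n.+1.-tuple R) : (measurableTypeR R * n.-tuple R)%type :=
  (thead t, [tuple of behead t]).
have mu_ : measurable_fun setT u.
  apply/measurable_fun_pairP; split; last exact: measurable_behead.
  exact: (@measurable_tnth _ (measurableTypeR R) n.+1 ord0).
have uK p : u (tuple_cons p) = p.
  by case: p => x t; congr pair; apply/val_inj.
exists (fun i => u @^-1` (F i `*` G i)).
  apply/seteqP; split => // t _.
  have [i _ Fi] : (\bigcup_i F i) (thead t) by rewrite -TF.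
  have [j _ Gj] : (\bigcup_i G i) [tuple of behead t] by rewrite -TG.
  exists (maxn i j) => //; split => /=.
    by move: Fi; exact/subsetPset/ndF/leq_maxl.
  by move: Gj; exact/subsetPset/ndG/leq_maxr.
move=> i; have [mF Fi] := Foo i; have [mG Gi] := Goo i; split.
  by rewrite -[X in measurable X]setTI; apply: mu_ => //; exact: measurableX.
rewrite /lebesgue_cons /pushforward.
set A := (X in (_ \x mu)%E X).
have -> : A = F i `*` G i by apply/funext => p; rewrite -[p in RHS]uK.
by rewrite product_measure1E// lte_mul_pinfty// ge0_fin_numE.
Qed.

HB.instance Definition _ := Measure_isSigmaFinite.Build _ _ _ lebesgue_cons
  lebesgue_cons_sigma_finite.

End lebesgue_cons.

Fixpoint lebesgue_tuple n : {sigma_finite_measure set (n.-tuple R) -> \bar R} :=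
  match n with
  | 0 => \d_([tuple])
  | m.+1 => lebesgue_cons (lebesgue_tuple m)
  end.

End lebesgue_tuple.
Arguments lebesgue_tuple {R} n.

(* R_+ with its Borel sets, i.e. the traces of the Borel sets of R *)
Definition mark (R : realType) : Type := {nonneg R}.

Section mark.
Context (R : realType).

Definition mark_val (r : mark R) : R := (r : {nonneg R})%:num.

Definition mark0 : mark R := (0%:nng : {nonneg R}).

HB.instance Definition _ := Choice.copy (mark R) {nonneg R}.
HB.instance Definition _ := isPointed.Build (mark R) mark0.
HB.instance Definition _ :=
  Measurable.copy (mark R) (g_sigma_algebra_preimageType mark_val).

End mark.

Notation marked R d := (d.-tuple R * mark R)%type.

Section configurations.
Context (R : realType) (d : nat).
Implicit Types (D : set (marked R d)) (L : set (d.-tuple R)).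

Definition cyl L : set (marked R d) := L `*` setT.

Definition Sbp D := measurable D /\ bounded_borel (fst @` D).

Definition locally_finite (w : set (marked R d)) :=
  forall L, bounded_pts L -> finite_set (w `&` cyl L).

Record config := Config {
  pts : set (marked R d) ;
  pts_locally_finite : locally_finite pts }.

HB.instance Definition _ := gen_eqMixin config.
HB.instance Definition _ := gen_choiceMixin config.

Let locally_finite0 : locally_finite set0.
Proof. by move=> L _; rewrite set0I. Qed.

Definition config0 := Config locally_finite0.

HB.instance Definition _ := isPointed.Build config config0.

Let locally_finite_restr D w : locally_finite (pts w `&` D).
Proof.
move=> L bL; apply: (@sub_finite_set _ _ (pts w `&` cyl L)); last first.
  exact: pts_locally_finite.
by move=> X [[wX _] LX].
Qed.

Definition restr D w := Config (@locally_finite_restr D w).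

Let locally_finite_union w1 w2 : locally_finite (pts w1 `|` pts w2).
Proof.
by move=> L bL; rewrite setIUl finite_setU; split; exact: pts_locally_finite.
Qed.

Definition cunion w1 w2 := Config (@locally_finite_union w1 w2).

Definition npts D (w : config) : \bar R := counting (pts w `&` D).

Definition counting_events : set (set config) :=
  \bigcup_(D in measurable) preimage_set_system setT (npts D)
    measurable.

Definition config_display : measure_display. Proof. by constructor. Qed.

HB.instance Definition _ := @isMeasurable.Build config_display config
  <<s counting_events >> (@sigma_algebra0 _ _ _) (@sigma_algebraC _ _)
  (@sigma_algebra_bigcup _ _ _).

Definition Omega D : set config := [set w | pts w `<=` D].

(* F_D as a sigma-algebra on the set of all configurations *)
Definition F_ D : set (set config) :=
  <<s [set restr D @^-1` E | E in measurable] >>.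

End configurations.

Section connectivity.
Context {R : realType} {d : nat}.
Implicit Types (w : set (marked R d)) (X Y : marked R d) (A B : set (d.-tuple R)).

Definition mball X : set (d.-tuple R) := [set y | eucl X.1 y <= mark_val X.2].

Definition gilbert_edge w X Y :=
  [/\ w X, w Y & mball X `&` mball Y !=set0].

Definition gilbert_connected w X Y :=
  exists2 p : seq (marked R d),
    path (fun U V => `[< gilbert_edge w U V >]) X p & last X p = Y.

Definition connected_by w X Y := gilbert_connected (w `|` [set X; Y]) X Y.

Definition connected_to w X w' := exists2 Y, w' Y & connected_by w X Y.

Definition sets_connected_by w A B :=
  exists x y, [/\ A x, B y & connected_by w (x, mark0 R) (y, mark0 R)].

Definition percolates w :=
  exists2 X, w X & infinite_set [set Y | w Y /\ gilbert_connected w X Y].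

End connectivity.

Section poisson.
Context {R : realType} {d : nat}.

Definition intensity (alpha : R) (Q : probability (mark R) R) :
    set (marked R d) -> \bar R :=
  fun A => (alpha%:E * (lebesgue_tuple d \x Q) A)%E.

(* Counts of disjoint sets of finite measure are independent Poisson
   variables, which determines [P]. The library's [poisson_pmf] is not the Poisson mass function for
   rate 0, hence the explicit formula. *)
Definition is_poisson (mu : set (marked R d) -> \bar R)
    (P : probability (config R d) R) :=
  forall (n : nat) (A : 'I_n -> set (marked R d)) (k : 'I_n -> nat),
    (forall i, measurable (A i)) -> (forall i, (mu (A i) < +oo)%E) ->
    trivIset setT A ->
    P (\bigcap_i [set w | npts (A i) w = (k i)%:R%:E]) =
    (\prod_(i < n)
      (expR (- fine (mu (A i))) * fine (mu (A i)) ^+ k i / (k i)`!%:R))%:E.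

Definition poisson_restr (P : probability (config R d) R) (D : set (marked R d))
  : set (config R d) -> \bar R := pushforward P (restr D).

(* The probability that [A] and [B] are connected. For general Borel sets the
   event is a projection of a Borel set, hence universally measurable but not
   always in the sigma-algebra: its completed probability is the outer measure. *)
Definition prob_connected (P : probability (config R d) R)
    (A B : set (d.-tuple R)) : \bar R :=
  (P^*)%mu [set w | sets_connected_by (pts w) A B].

(* [Pa alpha] stands for the law of the process with intensity [alpha] *)
Definition percolation_threshold (Pa : R -> probability (config R d) R)
    (ac : \bar R) :=
  [/\ (0 <= ac)%E,
      forall alpha, 0 < alpha -> (alpha%:E < ac)%E ->
        {ae Pa alpha, forall w, ~ percolates (pts w)} &
      forall alpha, 0 < alpha -> (ac < alpha%:E)%E ->
        {ae Pa alpha, forall w, percolates (pts w)}].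

End poisson.

Section gibbs.
Context {R : realType} {d : nat}.
Implicit Types (D : set (marked R d)) (g w : config R d)
  (H : set (marked R d) -> config R d -> config R d -> \bar R)
  (Ppoi P : probability (config R d) R).

(* [H D] is only constrained, and only used, on [Omega D `*` Omega (~` D)] *)
Record is_hamiltonian H : Prop := {
  ham_measurable : forall D, Sbp D ->
    measurable_fun (Omega D `*` Omega (~` D)) (fun p => H D p.1 p.2) ;
  ham_gtNy : forall D w g, Sbp D -> Omega D w -> Omega (~` D) g ->
    (-oo < H D w g)%E ;
  ham_config0 : forall D g, Sbp D -> Omega (~` D) g ->
    H D (config0 R d) g = 0%E ;
  ham_union : forall D1 D2 w1 w2 g, Sbp D1 -> Sbp D2 -> D1 `&` D2 = set0 ->
    Omega D1 w1 -> Omega D2 w2 -> Omega (~` (D1 `|` D2)) g ->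
    H (D1 `|` D2) (cunion w1 w2) g =
    (H D1 w1 (cunion g w2) + H D2 w2 g)%E }.

Definition partition_function H Ppoi D g : \bar R :=
  (\int[poisson_restr Ppoi D]_(w in Omega D) expeR (- H D w g))%E.

(* The measure on [Omega D] is extended by 0 to [config R d]. It is a
   probability as soon as the partition function is finite; [+oo^-1 = 0]. *)
Definition gibbs H Ppoi D g (E : set (config R d)) : \bar R :=
  ((partition_function H Ppoi D g)^-1 *
   \int[poisson_restr Ppoi D]_(w in Omega D `&` E) expeR (- H D w g))%E.

(* [k y] is, for almost every value [y] of [Y], the conditional law of [X]
   given [Y = y]. *)
Definition conditional_law d0 d1 d2 (T : measurableType d0)
    (T1 : measurableType d1) (T2 : measurableType d2) (P : probability T R)
    (X : T -> T1) (Y : T -> T2) (k : T2 -> set T1 -> \bar R) :=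
  forall A B, measurable A -> measurable B ->
    P (X @^-1` A `&` Y @^-1` B) = (\int[P]_(t in Y @^-1` B) k (Y t) A)%E.

Definition gibbs_state H Ppoi P :=
  forall D, Sbp D ->
    conditional_law P (restr D) (restr (~` D)) (gibbs H Ppoi D).

End gibbs.

Section disagreement.
Context {R : realType} {d : nat}.
Local Notation Om := (config R d).

Definition symdiff (w1 w2 : Om) : set (marked R d) :=
  (pts w1 `\` pts w2) `|` (pts w2 `\` pts w1).

Record disagreement_coupling
    (H : set (marked R d) -> Om -> Om -> \bar R) (Ppoi Pbar : probability Om R)
    (Pdc : set (marked R d) -> Om -> Om -> probability (Om * Om * Om)%type R)
    : Prop := {
  dc_support : forall D g1 g2, Sbp D -> Omega (~` D) g1 -> Omega (~` D) g2 ->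
    Pdc D g1 g2 (Omega D `*` Omega D `*` Omega D) = 1%E ;
  dc_measurable : forall D E, Sbp D -> measurable E ->
    measurable_fun (Omega (~` D) `*` Omega (~` D))
      (fun g => Pdc D g.1 g.2 E) ;
  dc_gibbs1 : forall D g1 g2, Sbp D -> Omega (~` D) g1 -> Omega (~` D) g2 ->
    forall E, measurable E ->
      Pdc D g1 g2 [set x | E x.1.1] = gibbs H Ppoi D g1 E ;
  dc_gibbs2 : forall D g1 g2, Sbp D -> Omega (~` D) g1 -> Omega (~` D) g2 ->
    forall E, measurable E ->
      Pdc D g1 g2 [set x | E x.1.2] = gibbs H Ppoi D g2 E ;
  dc_poisson : forall D g1 g2, Sbp D -> Omega (~` D) g1 -> Omega (~` D) g2 ->
    forall E, measurable E ->
      Pdc D g1 g2 [set x | E x.2] = poisson_restr Pbar D E ;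
  dc_subset : forall D g1 g2, Sbp D -> Omega (~` D) g1 -> Omega (~` D) g2 ->
    {ae Pdc D g1 g2, forall x, pts x.1.1 `|` pts x.1.2 `<=` pts x.2} ;
  dc_connected : forall D g1 g2, Sbp D -> Omega (~` D) g1 -> Omega (~` D) g2 ->
    {ae Pdc D g1 g2, forall x, forall X, symdiff x.1.1 x.1.2 X ->
      connected_to (pts x.2) X (pts g1 `|` pts g2)} }.

End disagreement.

Section pair_correlation.
Context {R : realType} {d : nat}.
Local Notation point := (d.-tuple R).
Local Notation leb := (lebesgue_tuple d).

(* [rho] is determined by [P] up to a null set only. *)
Definition pair_correlation (P : probability (config R d) R)
    (rho : point * point -> R) :=
  measurable_fun setT rho /\
  forall L1 L2, bounded_borel L1 -> bounded_borel L2 -> L1 `&` L2 = set0 ->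
    (leb \x leb)%E.-integrable (L1 `*` L2) (EFin \o rho) /\
    (\int[P]_w (npts (cyl L1) w * npts (cyl L2) w) -
      \int[P]_w npts (cyl L1) w * \int[P]_w npts (cyl L2) w =
    \int[leb]_(x in L1) \int[leb]_(y in L2) (rho (x, y))%:E)%E.

End pair_correlation.

(* Main.v *)
Require Import Defs.
From HB Require Import structures.
From mathcomp Require Import all_boot all_order all_algebra finmap.
From mathcomp Require Import all_classical all_reals all_analysis.
From mathcomp Require Import measurable_realfun.
From mathcomp Require Import ring lra.

Set Implicit Arguments.
Unset Strict Implicit.
Unset Printing Implicit Defensive.

Import Order.TTheory GRing.Theory Num.Theory.
Import numFieldNormedType.Exports.

Local Open Scope classical_set_scope.
Local Open Scope ring_scope.

(* Two coupled Gibbs configurations can differ on [A] only if the dominating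
   Poisson process connects [A] to the boundary of the region. Cutting such a
   connection at its last exit from [A] shows that it is realised by Poisson points
   with centres outside [A], independently of what happens in [A], so that
   disagreement on an event [J] of [A] costs [Pbar J * C exp (- kappa dist)]. The
   DLR equations transfer this to Gibbs states, which gives (i) and (ii) and, as the
   region grows, uniqueness.

   With [J] the event of more than [n] points in [A], summation over [n] bounds the
   covariance of the numbers of points in [A] and [B] by
   [C exp (- kappa dist) |A| |B|]. Refining dyadic partitions turns this bound on
   pairs of cells into the pointwise bound (iii). The correlation function exists
   because the first two factorial moment measures of a Gibbs state are dominated by
   those of the Poisson process, hence have bounded densities. *)

(** * Configurations and counting variables *)

(** Connection events are projections of Borel sets and need not lie in the sigma-algebra: they
    carry only an outer measure, and independence does not apply to them directly. They are
    therefore covered by measurable events; since connection is monotone in the configuration, the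
    part of the cover outside a region can be frozen without weakening the bound. The decay
    hypothesis speaks of unit cubes and of points with mark zero, while a disagreement is linked to
    the boundary by balls of radius up to [r0]. Both sets are thickened by [r0] and the first is cut
    into boundedly many unit cubes; bounded marks turn this into a constant factor before the
    exponential. In (iii) an inequality between measures known on blocks must reach all measurable
    sets. Proper differences do not preserve inequalities, so approximation by an algebra of dyadic
    sets replaces the pi-lambda argument. Moreover [rho] may be negative: its positive part is
    compared with its negative part plus the exponential, which keeps both sides measures. *)

Section boxes.
Context {R : realType} {d : nat}.
Implicit Types (x y : d.-tuple R).

Definition box n : set (d.-tuple R) := [set x | forall i, `|tnth x i| <= n%:R].

Lemma measurable_coord_itv (i : 'I_d) (J : interval R) :
  measurable [set x : d.-tuple R | tnth x i \in J].
Proof.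
have := @measurable_tnth _ R d i measurableT _ (measurable_itv J).
by rewrite setTI.
Qed.

Lemma measurable_coord_eq (i : 'I_d) (a : R) :
  measurable [set x : d.-tuple R | tnth x i = a].
Proof.
have := @measurable_tnth _ R d i measurableT _ (measurable_set1 a).
by rewrite setTI.
Qed.

Lemma measurable_forall_coord (P : 'I_d -> set (d.-tuple R)) :
  (forall i, measurable (P i)) -> measurable [set x | forall i, P i x].
Proof.
move=> mP; rewrite (_ : [set _ | _] = \bigcap_(i in [set: 'I_d]) P i); last first.
  by apply/seteqP; split => x /=; [move=> Px i _; exact: Px|move=> Px i; exact: Px].
exact: fin_bigcap_measurable.
Qed.

Lemma measurable_tuple1 x : measurable [set x].
Proof.
rewrite (_ : [set x] = [set y | forall i, tnth y i = tnth x i]).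
  by apply: measurable_forall_coord => i; exact: measurable_coord_eq.
by apply/seteqP; split => y /=; [move=> ->|move=> yx; exact: eq_from_tnth].
Qed.

Lemma measurable_cube (a b : 'I_d -> R) :
  measurable [set x : d.-tuple R | forall i, a i <= tnth x i <= b i].
Proof.
apply: measurable_forall_coord => i.
rewrite (_ : (fun x => _) = [set x : d.-tuple R | tnth x i \in `[a i, b i]]).
  exact: measurable_coord_itv.
by apply/seteqP; split => x /=; rewrite in_itv.
Qed.

Lemma measurable_box n : measurable (box n).
Proof.
rewrite (_ : box n = [set x | forall i, - n%:R <= tnth x i <= n%:R]).
  exact: measurable_cube.
by apply/seteqP; split => x /= h i; have := h i; rewrite ler_norml.
Qed.

Lemma eucl_le_coord x y (M : R) : 0 <= M ->
  (forall i, `|tnth x i - tnth y i| <= M) -> eucl x y <= Num.sqrt d%:R * M.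
Proof.
move=> M0 xyM; rewrite /eucl.
have -> : Num.sqrt d%:R * M = Num.sqrt (d%:R * M ^+ 2) :> R.
  by rewrite sqrtrM// sqrtr_sqr ger0_norm.
rewrite ler_wsqrtr//.
have -> : d%:R * M ^+ 2 = \sum_(i < d) M ^+ 2.
  by rewrite sumr_const card_ord mulr_natl.
by apply: ler_sum => i _; rewrite -[leLHS]ger0_norm ?sqr_ge0// normrX ler_pXn2r// ?nnegrE.
Qed.

Lemma coord_le_eucl x y i : `|tnth x i - tnth y i| <= eucl x y.
Proof.
rewrite -sqrtr_sqr ler_wsqrtr// (bigD1 i)//= lerDl sumr_ge0// => j _.
exact: sqr_ge0.
Qed.

Lemma bounded_pts_sub (A B : set (d.-tuple R)) :
  A `<=` B -> bounded_pts B -> bounded_pts A.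
Proof. by move=> AB [M BM]; exists M => x y /AB ? /AB ?; exact: BM. Qed.

Lemma bounded_pts_cube (a b : 'I_d -> R) :
  bounded_pts [set x : d.-tuple R | forall i, a i <= tnth x i <= b i].
Proof.
pose M := \sum_i `|b i - a i|.
have M0 : 0 <= M by apply: sumr_ge0.
exists (Num.sqrt d%:R * M) => x y xab yab; apply: eucl_le_coord => // i.
rewrite /M (bigD1 i)//=; apply: (@le_trans _ _ `|b i - a i|); last first.
  by rewrite lerDl sumr_ge0.
have /andP[ax xb] := xab i; have /andP[ay yb] := yab i.
rewrite (ger0_norm (_ : 0 <= b i - a i)) ?subr_ge0; last exact: le_trans xb.
rewrite ler_norml; apply/andP; split; lra.
Qed.

Lemma bounded_box n : bounded_pts (box n).
Proof.
apply: (bounded_pts_sub _ (bounded_pts_cube (fun=> - n%:R) (fun=> n%:R))).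
by move=> x h i; have := h i; rewrite ler_norml.
Qed.

Lemma box_nd m n : (m <= n)%N -> box m `<=` box n.
Proof. by move=> mn x xm i; rewrite (le_trans (xm i))// ler_nat. Qed.

Lemma box_cover x : exists n, box n x.
Proof.
pose M := \sum_i `|tnth x i|.
exists (Num.truncn M).+1 => i.
rewrite (@le_trans _ _ M)//; last exact/ltW/truncnS_gt.
by rewrite /M (bigD1 i)//= lerDl sumr_ge0.
Qed.

Lemma bounded_sub_box (A : set (d.-tuple R)) :
  bounded_pts A -> exists n, A `<=` box n.
Proof.
move=> [M AM]; have [->|/set0P[x Ax]] := eqVneq A set0; first by exists 0.
have [m xm] := box_cover x.
have M0 : 0 <= M by apply: le_trans (AM _ _ Ax Ax); exact: sqrtr_ge0.
exists (m + (Num.truncn M).+1)%N => y Ay i.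
rewrite -(subrK (tnth x i) (tnth y i)) (le_trans (ler_normD _ _))// natrD addrC.
rewrite lerD ?xm// (le_trans (coord_le_eucl _ _ _))// (le_trans (AM _ _ Ay Ax))//.
exact/ltW/truncnS_gt.
Qed.

End boxes.

Section config_basics.
Context {R : realType} {d : nat}.
Local Notation S := (marked R d).
Local Notation Om := (config R d).
Implicit Types (D A : set S) (w : Om).

Lemma config_ext w w' : pts w = pts w' -> w = w'.
Proof.
by case: w w' => [p lp] [q lq] /= pq; subst q; congr Config; exact: Prop_irrelevance.
Qed.

Lemma restr_restr D D' w : restr D (restr D' w) = restr (D `&` D') w.
Proof. by apply: config_ext => /=; rewrite -setIA (setIC D'). Qed.

Lemma restr_sub D D' w : D `<=` D' -> restr D (restr D' w) = restr D w.
Proof. by move=> DD'; rewrite restr_restr setIidl. Qed.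

Lemma Omega_restr D w : Omega D (restr D w).
Proof. by move=> X []. Qed.

Lemma npts_restr A D w : npts A (restr D w) = npts (D `&` A) w.
Proof. by rewrite /npts /= setIA. Qed.

Lemma measurable_cyl (L : set (d.-tuple R)) : measurable L -> measurable (cyl L).
Proof. by move=> mL; exact: measurableX. Qed.

Lemma measurable_npts D : measurable D -> measurable_fun [set: Om] (npts D).
Proof.
move=> mD _ Y mY; apply: sub_sigma_algebra; exists D => //; exists Y => //.
Qed.

Lemma measurable_config_fun d' (T : measurableType d') (f : T -> Om) :
  (forall A, measurable A -> measurable_fun setT (npts A \o f)) ->
  measurable_fun setT f.
Proof.
move=> mf; apply: (@measurability _ _ _ _ _ _ (@counting_events R d)) => //.
move=> _ [_ [A mA [Y mY <-]] <-]; rewrite !setTI.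
by have := mf A mA measurableT Y mY; rewrite setTI.
Qed.

Lemma measurable_restr D : measurable D -> measurable_fun [set: Om] (restr D).
Proof.
move=> mD; apply: measurable_config_fun => A mA.
rewrite (_ : _ \o _ = npts (D `&` A)); last by apply/funext => w; rewrite /= npts_restr.
by apply: measurable_npts; exact: measurableI.
Qed.

Lemma npts_ge0 D w : (0 <= npts D w)%E.
Proof. by rewrite /npts /counting; case: ifP => _; rewrite ?lee_fin ?leey. Qed.

Lemma npts_eq0 D w : npts D w = 0%E <-> pts w `&` D = set0.
Proof.
rewrite /npts /counting; split=> [|->]; last by rewrite asboolT// fset_set0.
case: asboolP => // fin /eqP.
by rewrite eqe pnatr_eq0 cardfs_eq0 => /eqP/(fset_set_set0 fin).
Qed.

Lemma measurable_Omega D : measurable D -> measurable (Omega D).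
Proof.
move=> mD; rewrite (_ : Omega D = npts (~` D) @^-1` [set 0%E]).
  by rewrite -[X in measurable X]setTI; apply: measurable_npts => //; exact: measurableC.
apply/seteqP; split => w /=.
  by move=> wD; apply/npts_eq0; rewrite -subset0 => X [/wD].
by move=> /npts_eq0 w0 X wX; apply: contrapT => DX; rewrite -[False]/(set0 X) -w0.
Qed.

(** Unlike [Sbp], this asks nothing about measurability of the projection, so it passes to all
    subsets. Marks stay unrestricted. *)
Definition locally_bounded D := exists n, D `<=` cyl (box n).

Lemma finite_pts D w : locally_bounded D -> finite_set (pts w `&` D).
Proof.
move=> [n Dn]; apply: (sub_finite_set _ (pts_locally_finite w (bounded_box n))).
exact: setIS.
Qed.

(** Meant for locally bounded [D], where it is the value of [npts D]. Counts in [nat] allow events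
    to be indexed by countable data. *)
Definition card_pts D w : nat := #|` fset_set (pts w `&` D)|.

Lemma nptsE D w : locally_bounded D -> npts D w = (card_pts D w)%:R%:E.
Proof. by move=> bD; rewrite /npts /counting asboolT//; exact: finite_pts. Qed.

Lemma card_ptsU D D' w : locally_bounded D -> locally_bounded D' ->
  D `&` D' = set0 -> card_pts (D `|` D') w = (card_pts D w + card_pts D' w)%N.
Proof.
move=> bD bD' DD'; rewrite /card_pts setIUr fset_setU; [|exact: finite_pts|exact: finite_pts].
apply/eqP; rewrite [_ == _](leq_card_fsetU _ _).2; apply/fdisjointP => X.
rewrite in_fset_set ?inE; last exact: finite_pts.
move=> [wX DX]; rewrite in_fset_set; last exact: finite_pts.
by apply/negP; rewrite inE => -[_ D'X]; rewrite -[False]/(set0 X) -DD'.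
Qed.

Lemma card_pts0 w : card_pts set0 w = 0%N.
Proof. by rewrite /card_pts setI0 fset_set0. Qed.

Lemma measurable_card_pts D : measurable D -> locally_bounded D ->
  measurable_fun [set: Om] (card_pts D).
Proof.
move=> mD bD _ Y _; rewrite setTI.
rewrite (_ : _ @^-1` _ = npts D @^-1` [set k%:R%:E | k in Y]).
  rewrite -[X in measurable X]setTI; apply: measurable_npts => //.
  apply: countable_measurable; first by move=> t; exact: emeasurable_set1.
  exact: card_le_trans (card_image_le _ _) (countableP _).
apply/seteqP; split => w /=; first by move=> Yw; exists (card_pts D w) => //; rewrite nptsE.
move=> [k Yk]; rewrite nptsE// => /eqP; rewrite eqe eqr_nat => /eqP.
by move=> <-.
Qed.

Lemma measurable_point (X : S) : measurable [set X].
Proof.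
case: X => x r.
have -> : [set (x, r)] = [set x] `*` [set r].
  by apply/seteqP; split => -[y s] /=; [move=> [-> ->]|move=> [-> ->]].
apply: measurableX; first exact: measurable_tuple1.
exists [set mark_val r]; first exact: measurable_set1.
rewrite setTI; apply/seteqP; split => s /=; last by move=> ->.
by rewrite /mark_val => sr; apply: val_inj.
Qed.

Lemma countable_pts w : countable (pts w).
Proof.
rewrite (_ : pts w = \bigcup_n (pts w `&` cyl (box n))).
  apply: bigcup_countable => // n _.
  by apply: finite_set_countable; apply: pts_locally_finite; exact: bounded_box.
rewrite -setI_bigcupr; apply/esym/setIidPl => X wX.
by have [n Xn] := box_cover X.1; exists n.
Qed.

Lemma measurable_pts w : measurable (pts w).
Proof.
by apply: countable_measurable; [exact: measurable_point|exact: countable_pts].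
Qed.

End config_basics.

(** * Poisson processes on disjoint regions *)

Section independence.
Context {R : realType}.
Local Open Scope ereal_scope.

Section step.
Context d0 d1 (T : measurableType d0) (T1 : measurableType d1).
Variables (P : probability T R) (X : T -> T1) (mX : measurable_fun setT X).
Variables (G : set (set T1)) (F : set T) (mF : measurable F).
Hypotheses (genG : @measurable _ T1 = <<s G >>) (setIG : setI_closed G).
Hypothesis GT : G setT.

(** For fixed [F] both sides are finite measures in [A]; agreeing on a generating pi-system that
    contains the whole space, they are equal. *)
Lemma indep_event_generated :
  (forall A, G A -> P (X @^-1` A `&` F) = P (X @^-1` A) * P F) ->
  forall A, measurable A -> P (X @^-1` A `&` F) = P (X @^-1` A) * P F.
Proof.
move=> GE A mA.
have PF0 : (0 <= fine (P F))%R by exact: fine_ge0.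
have PFE : P F = (NngNum PF0)%:num%:E by rewrite /= fineK ?fin_num_measure.
rewrite PFE [RHS]muleC.
pose m1 := measure_function_pushforward__canonical__measure_function_Measure
  (mrestr P mF) mX.
pose m2 : {measure set T1 -> \bar R} := mscale (NngNum PF0)
  (measure_function_pushforward__canonical__measure_function_Measure P mX).
apply: (@measure_unique _ _ _ G (fun=> setT) genG setIG (fun=> GT) _ m1 m2) => //.
- by rewrite bigcup_const.
- by move=> B GB; rewrite /m1 /m2 /= /mscale /= /pushforward /mrestr GE// PFE muleC.
- move=> _; rewrite /m1 /= /pushforward /mrestr.
  by rewrite (le_lt_trans (probability_le1 _ _))// ?ltry// preimage_setT setTI.
Qed.

End step.

Lemma indep_generated d0 d1 d2 (T : measurableType d0) (T1 : measurableType d1)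
    (T2 : measurableType d2) (P : probability T R) (X : T -> T1) (Y : T -> T2)
    (G1 : set (set T1)) (G2 : set (set T2)) :
  measurable_fun setT X -> measurable_fun setT Y ->
  @measurable _ T1 = <<s G1 >> -> setI_closed G1 -> G1 setT ->
  @measurable _ T2 = <<s G2 >> -> setI_closed G2 -> G2 setT ->
  (forall A B, G1 A -> G2 B ->
    P (X @^-1` A `&` Y @^-1` B) = P (X @^-1` A) * P (Y @^-1` B)) ->
  forall A B, measurable A -> measurable B ->
    P (X @^-1` A `&` Y @^-1` B) = P (X @^-1` A) * P (Y @^-1` B).
Proof.
move=> mX mY gG1 IG1 G1T gG2 IG2 G2T GE A B mA mB.
have mXA C : measurable C -> measurable (X @^-1` C).
  by move=> mC; rewrite -[X in measurable X]setTI; exact: mX.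
have mYB C : measurable C -> measurable (Y @^-1` C).
  by move=> mC; rewrite -[X in measurable X]setTI; exact: mY.
apply: (indep_event_generated mX (mYB _ mB) gG1 IG1 G1T) => // A' GA'.
rewrite setIC muleC.
apply: (indep_event_generated mY _ gG2 IG2 G2T) => //.
  by apply: mXA; rewrite gG1; exact: sub_sigma_algebra.
by move=> B' GB'; rewrite setIC muleC GE.
Qed.

Lemma indep_nat d0 (T : measurableType d0) (P : probability T R) (X Y : T -> nat) :
  measurable_fun setT X -> measurable_fun setT Y ->
  (forall i j, P (X @^-1` [set i] `&` Y @^-1` [set j]) =
     P (X @^-1` [set i]) * P (Y @^-1` [set j])) ->
  forall A B : set nat,
    P (X @^-1` A `&` Y @^-1` B) = P (X @^-1` A) * P (Y @^-1` B).
Proof.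
move=> mX mY XY A B.
(* Singletons, completed by [set0] and [setT], form a pi-system generating all subsets of [nat]. *)
pose G : set (set nat) := [set C | C = set0 \/ C = setT \/ exists i, C = [set i]].
have gG : @measurable _ nat = <<s G >>.
  apply/seteqP; split => C _ //.
  rewrite (_ : C = \bigcup_(i in C) [set i]); last first.
    by apply/seteqP; split => [i Ci|_ [i Ci ->]//]; exists i.
  apply: (@bigcup_measurable _ (g_sigma_algebraType G)) => i _.
  by apply: sub_sigma_algebra; right; right; exists i.
have IG : setI_closed G.
  move=> C D [->|[->|[i ->]]]; first by rewrite set0I; left.
    by rewrite setTI.
  move=> [->|[->|[j ->]]]; first by rewrite setI0; left.
    by rewrite setIT; right; right; exists i.
  have [->|/eqP ij] := eqVneq i j; first by rewrite setIid; right; right; exists j.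
  by left; rewrite -subset0 => x [/= ->].
have GT : G setT by right; left.
apply: (indep_generated mX mY gG IG GT gG IG GT) => // C D.
move=> [->|[->|[i ->]]]; first by rewrite preimage_set0 set0I measure0 mul0e.
  by rewrite preimage_setT setTI probability_setT mul1e.
move=> [->|[->|[j ->]]]; first by rewrite preimage_set0 setI0 measure0 mule0.
  by rewrite preimage_setT setIT probability_setT mule1.
exact: XY.
Qed.

End independence.

Section count_cylinders.
Context {R : realType} {d : nat}.
Local Notation S := (marked R d).
Local Notation Om := (config R d).

Definition count_cyl n (A : nat -> set S) (k : nat -> nat) : set Om :=
  [set w | forall i, (i < n)%N -> card_pts (A i) w = k i].

(** The pi-system behind both Poisson independence and uniqueness of the Gibbs state: only finitely
    many finite counts are prescribed, and each such event depends on a bounded region. *)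
Definition count_cylinders : set (set Om) :=
  [set E | exists n A k, [/\ forall i, measurable (A i),
    forall i, locally_bounded (A i) & E = count_cyl n A k]].

Lemma count_cylinders_setT : count_cylinders setT.
Proof.
exists 0%N, (fun=> set0), (fun=> 0%N); split => //.
  by move=> _; exists 0.
by apply/seteqP; split.
Qed.

Lemma count_cylinders_setI : setI_closed count_cylinders.
Proof.
move=> _ _ [n [A [k [mA bA ->]]]] [m [B [l [mB bB ->]]]].
exists (n + m)%N, (fun i => if (i < n)%N then A i else B (i - n)%N),
  (fun i => if (i < n)%N then k i else l (i - n)%N); split.
- by move=> i; case: ifP.
- by move=> i; case: ifP.
apply/seteqP; split => w.
  move=> [/= Aw Bw] i inm; case: ifPn => [|]; first exact: Aw.
  by rewrite -leqNgt => ni; apply: Bw; rewrite ltn_subLR.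
move=> /= ABw; split => i /= im.
  by have := ABw i (ltn_addr _ im); rewrite im.
have := ABw (n + i)%N; rewrite ltn_add2l => /(_ im).
by rewrite ltnNge leq_addr/= addKn.
Qed.

Lemma measurable_count_cyl n A k : (forall i, measurable (A i)) ->
  (forall i, locally_bounded (A i)) -> measurable (count_cyl n A k).
Proof.
move=> mA bA; rewrite (_ : count_cyl n A k =
    \bigcap_(i in `I_n) (card_pts (A i) @^-1` [set k i])); last first.
  by apply/seteqP; split => w /= h i; exact: h.
apply: fin_bigcap_measurable => // i _.
by rewrite -[X in measurable X]setTI; apply: measurable_card_pts.
Qed.

Lemma npts_cvg (D : set S) (w : Om) :
  npts (D `&` cyl (box n)) w @[n --> \oo] --> npts D w.
Proof.
have -> : npts D w = counting (\bigcup_n (pts w `&` (D `&` cyl (box n)))).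
  rewrite -setI_bigcupr -setI_bigcupr (_ : \bigcup_n _ = setT) ?setIT//.
  by rewrite -subTset => X _; have [n Xn] := box_cover X.1; exists n.
have mS (V : set S) : measurable (pts w `&` V).
  apply: countable_measurable; first exact: measurable_point.
  by apply: sub_countable (countable_pts w); apply: subset_card_le; exact: subIsetl.
apply: (@nondecreasing_cvg_mu _ _ _ (counting : {measure set S -> \bar R})) => //.
  by apply: bigcupT_measurable => n; exact: mS.
move=> m n mn; apply/subsetPset; apply: setIS; apply: setIS => X [? ?].
by split => //; exact: (box_nd mn).
Qed.

(** The defining generators count points in arbitrary measurable sets, possibly infinitely many.
    Such a count is the increasing limit of the counts in boxes. *)
Lemma generated_count_cylinders :
  @measurable _ Om = <<s count_cylinders >>.
Proof.
apply/seteqP; split; last first.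
  apply: smallest_sub; first exact: sigma_algebra_measurable.
  by move=> _ [n [A [k [mA bA ->]]]]; exact: measurable_count_cyl.
apply: smallest_sub; first exact: smallest_sigma_algebra.
move=> _ [A mA [Y mY <-]].
pose Om' := g_sigma_algebraType count_cylinders.
suff : measurable_fun [set: Om'] (npts A : Om' -> \bar R) by exact.
apply: (emeasurable_fun_cvg (fun n => npts (A `&` cyl (box n)) : Om' -> \bar R)).
  move=> n.
  have bAn : locally_bounded (A `&` cyl (box n)) by exists n; exact: subIsetr.
  rewrite (_ : npts _ = (fun k : nat => k%:R%:E) \o card_pts (A `&` cyl (box n))); last first.
    by apply/funext => w; rewrite /= nptsE.
  apply: measurableT_comp => // _ Z _; rewrite setTI.
  rewrite (_ : _ @^-1` _ = \bigcup_(k in Z)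
      count_cyl 1 (fun=> A `&` cyl (box n)) (fun=> k)); last first.
    apply/seteqP; split => w /=.
      by move=> Zw; exists (card_pts (A `&` cyl (box n)) w).
    by move=> [k Zk] /(_ 0%N isT) ->.
  apply: bigcup_measurable => k _; apply: sub_sigma_algebra.
  exists 1, (fun=> A `&` cyl (box n)), (fun=> k); split => // _.
  by apply: measurableI => //; apply: measurable_cyl; exact: measurable_box.
by move=> w _; exact: npts_cvg.
Qed.

End count_cylinders.

Section lebesgue_box.
Context {R : realType}.

Lemma lebesgue_tuple_box_lty d n : (@lebesgue_tuple R d (box n) < +oo)%E.
Proof.
elim: d => [|d IH]; first by rewrite /= diracE ltry.
rewrite /= /lebesgue_cons /pushforward.
rewrite (_ : _ @^-1` _ = `[(- n%:R)%R, n%:R%R]%classic `*` box n); last first.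
  apply/seteqP; split => -[x t] /=.
    move=> h; split.
      by have := h ord0; rewrite in_itv/= ler_norml.
    by move=> i; have := h (lift ord0 i); rewrite tnthS.
  move=> [xn tn] i; rewrite in_itv/= in xn.
  case: (unliftP ord0 i) => [j|] ->; first by rewrite tnthS; exact: tn.
  by rewrite /= ler_norml.
rewrite product_measure1E//; last exact: measurable_box.
rewrite lte_mul_pinfty ?measure_ge0//.
suff : (@lebesgue_measure R `[(- n%:R)%R, n%:R%R]%classic < +oo)%E.
  by move=> h; rewrite ge0_fin_numE.
by rewrite lebesgue_measure_itv/=; case: ifP => // _; exact: ltry.
Qed.

End lebesgue_box.

Section poisson.
Context {R : realType} {d : nat}.
Local Notation S := (marked R d).
Local Notation Om := (config R d).
Implicit Types (w : Om) (A D : set S).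

Lemma card_pts_bigsetU (T : choiceType) (r : seq T) (F : T -> set S) w :
  uniq r -> (forall t, locally_bounded (F t)) ->
  (forall s t, s != t -> F s `&` F t = set0) ->
  card_pts (\big[setU/set0]_(t <- r) F t) w = \sum_(t <- r) card_pts (F t) w.
Proof.
move=> + bF dF.
have bU s : locally_bounded (\big[setU/set0]_(t <- s) F t).
  elim: s => [|t s [n sn]]; first by rewrite big_nil; exists 0%N.
  rewrite big_cons; have [m tm] := bF t; exists (maxn m n) => X [FX|FX].
    by have [? ?] := tm _ FX; split => //; exact: (box_nd (leq_maxl m n)).
  by have [? ?] := sn _ FX; split => //; exact: (box_nd (leq_maxr m n)).
elim: r => [_|t r IH /= /andP[tr ur]]; first by rewrite !big_nil card_pts0.
rewrite !big_cons card_ptsU//; first by rewrite IH.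
rewrite -subset0 -bigcup_seq => X [tX [s /= sr sX]].
rewrite -[False]/(set0 X) -(dF s t); first by split.
by apply: contraNneq tr => <-.
Qed.

Variables (alpha : R) (Q : probability (mark R) R) (P : probability Om R).
Hypotheses (alpha0 : 0 < alpha) (PP : is_poisson (intensity alpha Q) P).

Lemma intensity_lty A : measurable A -> locally_bounded A ->
  (intensity alpha Q A < +oo)%E.
Proof.
move=> mA [n An]; rewrite /intensity lte_mul_pinfty//; first by rewrite lee_fin ltW.
apply: (@le_lt_trans _ _ ((lebesgue_tuple d \x Q)%E (cyl (box n)))).
  apply: le_measure => //; rewrite inE//.
  by apply: measurable_cyl; exact: measurable_box.
rewrite product_measure1E//; last exact: measurable_box.
rewrite [X in (_ * X)%E](_ : _ = 1%E); last exact: probability_setT.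
by rewrite mule1 lebesgue_tuple_box_lty.
Qed.

(** The formula of [is_poisson], carried from ['I_n] to an arbitrary finite index type; sets of
    subsets and sum types are the indices used below. *)
Lemma poisson_family (T : finType) (A : T -> set S) (k : T -> nat) :
  (forall t, measurable (A t)) -> (forall t, locally_bounded (A t)) ->
  (forall s t, s != t -> A s `&` A t = set0) ->
  P [set w | forall t, card_pts (A t) w = k t] =
  (\prod_(t : T) (expR (- fine (intensity alpha Q (A t))) *
     fine (intensity alpha Q (A t)) ^+ k t / (k t)`!%:R))%:E.
Proof.
move=> mA bA dA.
have := PP (n := #|T|) (A := fun i => A (enum_val i)) (fun i => k (enum_val i)).
move=> /(_ (fun i => mA _) (fun i => intensity_lty (mA _) (bA _))).
have tA : trivIset setT (fun i : 'I_#|T| => A (enum_val i)).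
  apply/trivIsetP => i j _ _ ij; apply: dA.
  by apply: contra ij => /eqP/enum_val_inj ->.
move=> /(_ tA).
rewrite (_ : \bigcap_i _ = [set w | forall t, card_pts (A t) w = k t]); last first.
  apply/seteqP; split => w /= h.
    move=> t; have := h (enum_rank t) I; rewrite /= enum_rankK nptsE//.
    by move=> /eqP; rewrite eqe eqr_nat => /eqP.
  by move=> i _ /=; rewrite nptsE// h.
move=> ->; congr EFin; rewrite [RHS](reindex (@enum_val T predT)) //=.
by apply: onW_bij; exact: enum_val_bij.
Qed.

Section atoms.
Variables (D : set S) (mD : measurable D) (n : nat) (A : nat -> set S).
Hypotheses (mA : forall i, measurable (A i)) (bA : forall i, locally_bounded (A i)).

(** The pieces of the Venn diagram of the [A i] inside [D], one for each set of indices: overlapping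
    sets have no product formula, their atoms do. The second clause empties the atom of the empty
    index set, which could otherwise be unbounded. *)
Definition atom (I : {set 'I_n}) : set S :=
  [set X | [/\ D X, exists i : 'I_n, A i X & forall i : 'I_n, A i X <-> i \in I]].

Lemma measurable_atom I : measurable (atom I).
Proof.
rewrite (_ : atom I = D `&` (\bigcup_(i in [set: 'I_n]) A i) `&`
  (\bigcap_(i in [set: 'I_n]) (if i \in I then A i else ~` A i))); last first.
  apply/seteqP; split => X.
    move=> [DX [i AX] AIX]; split; first by split => //; exists i.
    move=> j _; case: ifPn => [/AIX//|jI AjX].
    by move/negP: jI; apply; apply/AIX.
  move=> [[DX [i _ AX]] AIX]; split => //; first by exists i.
  move=> j; have := AIX j Logic.I; case: ifPn => // jI nA; split => //.
apply: measurableI; first apply: measurableI => //.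
  by apply: fin_bigcup_measurable.
apply: fin_bigcap_measurable => // i _; case: ifP => // _; exact: measurableC.
Qed.

Lemma locally_bounded_atom I : locally_bounded (atom I).
Proof.
have [f Af] : {f : 'I_n -> nat & forall i : 'I_n, A i `<=` cyl (box (f i))}.
  by apply: (@choice _ _ (fun (i : 'I_n) m => A i `<=` cyl (box m))) => i; exact: bA.
exists (\max_i f i) => X [_ [i /Af[AX _]] _]; split => //.
exact: (box_nd (leq_bigmax i)).
Qed.

Lemma atom_disj I J : I != J -> atom I `&` atom J = set0.
Proof.
move=> IJ; rewrite -subset0 => X [[_ _ IX] [_ _ JX]].
move/negP: IJ; apply; apply/eqP/setP => i; apply/idP/idP.
  by move=> /IX/JX.
by move=> /JX/IX.
Qed.

Lemma card_pts_atoms (i : 'I_n) w :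
  card_pts (D `&` A i) w = \sum_(I : {set 'I_n} | i \in I) card_pts (atom I) w.
Proof.
rewrite -big_filter -card_pts_bigsetU ?filter_uniq ?index_enum_uniq//; last 2 first.
- exact: locally_bounded_atom.
- exact: atom_disj.
congr card_pts; rewrite -bigcup_seq; apply/seteqP; split => X.
  move=> [DX AX]; exists [set j : 'I_n | `[< A j X >]]%SET.
    by rewrite /= mem_filter mem_index_enum andbT inE; apply/asboolP.
  by split => //; [exists i|move=> j; rewrite inE; split => /asboolP].
move=> [I /=]; rewrite mem_filter => /andP[iI _] [DX _ /(_ i) AX].
by split => //; apply/AX.
Qed.

(** The whole vector of counts coded as one natural number, so that [indep_nat] applies to it. *)
Definition atom_counts w : nat := choice.pickle [ffun I => card_pts (atom I) w].

Lemma atom_countsE (f : {ffun {set 'I_n} -> nat}) :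
  atom_counts @^-1` [set choice.pickle f] =
  [set w | forall I, card_pts (atom I) w = f I].
Proof.
apply/seteqP; split => w /=.
  by move=> /(pcan_inj choice.pickleK) <- I; rewrite ffunE.
by move=> wf; congr choice.pickle; apply/ffunP => I; rewrite ffunE.
Qed.

Lemma atom_counts_cases i : (exists f : {ffun {set 'I_n} -> nat}, i = choice.pickle f) \/
  atom_counts @^-1` [set i] = set0.
Proof.
have [[f if_]|nf] := pselect (exists f : {ffun {set 'I_n} -> nat}, i = choice.pickle f).
  by left; exists f.
right; rewrite -subset0 => w /= wi; apply: nf.
by exists [ffun I => card_pts (atom I) w].
Qed.

Lemma measurable_atom_counts : measurable_fun setT atom_counts.
Proof.
move=> _ Y _; rewrite setTI.
rewrite (_ : _ @^-1` _ = \bigcup_(i in Y) (atom_counts @^-1` [set i])); last first.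
  apply/seteqP; split => w /=; first by move=> Yw; exists (atom_counts w).
  by move=> [i Yi /= ->].
apply: bigcup_measurable => i _.
have [[f ->]|->] := atom_counts_cases i; last exact: measurable0.
rewrite atom_countsE (_ : [set w | _] =
    \bigcap_(I in [set: {set 'I_n}]) (card_pts (atom I) @^-1` [set f I])); last first.
  by apply/seteqP; split => w /=; [move=> h I _; exact: h|move=> h I; exact: (h I Logic.I)].
apply: fin_bigcap_measurable => // I _.
rewrite -[X in measurable X]setTI; apply: measurable_card_pts => //.
  exact: measurable_atom.
exact: locally_bounded_atom.
Qed.

(** A count in [D] is a sum of atom counts, so a count cylinder seen through [D] is an event of the
    coded vector. *)
Lemma restr_count_cyl (k : nat -> nat) : exists C : set nat,
  restr D @^-1` count_cyl n A k = atom_counts @^-1` C.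
Proof.
exists [set j | exists2 f : {ffun {set 'I_n} -> nat}, j = choice.pickle f &
  forall i : 'I_n, \sum_(I : {set 'I_n} | i \in I) f I = k i].
have cE w (i : 'I_n) : card_pts (A i) (restr D w) =
    \sum_(I : {set 'I_n} | i \in I) card_pts (atom I) w.
  by rewrite -card_pts_atoms /card_pts /= setIA.
apply/seteqP; split => w /=.
  move=> h; exists [ffun I => card_pts (atom I) w] => // i.
  rewrite -h// cE; apply: eq_bigr => I _; by rewrite ffunE.
move=> [f /(pcan_inj choice.pickleK) <- h] i ni.
have := h (Ordinal ni); rewrite /= => <-.
rewrite (cE w (Ordinal ni)); apply: eq_bigr => I _; by rewrite ffunE.
Qed.

End atoms.

Lemma poisson_indep_restr D : measurable D -> forall A B : set Om, measurable A -> measurable B ->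
  P (restr D @^-1` A `&` restr (~` D) @^-1` B) =
  (P (restr D @^-1` A) * P (restr (~` D) @^-1` B))%E.
Proof.
move=> mD; have mDC := measurableC mD.
apply: (indep_generated (measurable_restr mD) (measurable_restr mDC)
  (@generated_count_cylinders R d) (@count_cylinders_setI R d)
  (@count_cylinders_setT R d)
  (@generated_count_cylinders R d) (@count_cylinders_setI R d)
  (@count_cylinders_setT R d)).
move=> _ _ [n [A [k [mA bA ->]]]] [m [B [l [mB bB ->]]]].
have [C1 ->] := restr_count_cyl D n bA k.
have [C2 ->] := restr_count_cyl (~` D) m bB l.
apply: indep_nat; [exact: measurable_atom_counts|exact: measurable_atom_counts|].
move=> i j.
have [[f ->]|->] := atom_counts_cases D n A i; last by rewrite set0I measure0 mul0e.
have [[g ->]|->] := atom_counts_cases (~` D) m B j; last by rewrite setI0 measure0 mule0.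
rewrite !atom_countsE.
(* The atoms inside [D] and those outside form one disjoint family, indexed by a sum type; its
   product formula splits into the two factors. *)
pose c (t : {set 'I_n} + {set 'I_m}) : set S :=
  match t with inl a => atom D A a | inr b => atom (~` D) B b end.
pose h (t : {set 'I_n} + {set 'I_m}) : nat :=
  match t with inl a => f a | inr b => g b end.
rewrite (_ : _ `&` _ = [set w | forall t, card_pts (c t) w = h t]); last first.
  apply/seteqP; split => w /=; first by move=> [fw gw] [].
  by move=> hw; split => [I|J]; [exact: (hw (inl I))|exact: (hw (inr J))].
have mc t : measurable (c t) by case: t => a; exact: measurable_atom.
have bc t : locally_bounded (c t) by case: t => a; exact: locally_bounded_atom.
have dc s t : s != t -> c s `&` c t = set0.
  case: s t => [I|I] [J|J] //= IJ.
  - exact: atom_disj.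
  - by rewrite -subset0 => X [[DX _ _] []].
  - by rewrite -subset0 => X [[DX _ _] []].
  - exact: atom_disj.
rewrite !poisson_family//; try by move=> *; exact: measurable_atom.
- by rewrite -EFinM; congr EFin; rewrite big_sumType.
- by move=> *; exact: locally_bounded_atom.
- by move=> *; exact: atom_disj.
- by move=> *; exact: locally_bounded_atom.
- by move=> *; exact: atom_disj.
Qed.

End poisson.

Definition mfun_of d d' (T : measurableType d) (U : measurableType d') (f : T -> U)
    (mf : measurable_fun setT f) : {mfun T >-> U} :=
  HB.pack f (isMeasurableFun.Build _ _ _ _ f mf).

Lemma measurable_preimage d d' (T : measurableType d) (U : measurableType d') (f : T -> U)
  (A : set U) : measurable_fun setT f -> measurable A -> measurable (f @^-1` A).
Proof. by move=> mf mA; rewrite -[X in measurable X]setTI; exact: mf. Qed.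

Section section_of_independent.
Context {R : realType}.
Local Open Scope ereal_scope.

(** By independence [P G] is the average over [b] of the probability of the section of [G] at [b].
    If every section had probability at least [c], so would [G]. *)
Lemma indep_section d0 d1 d2 (T : measurableType d0) (T1 : measurableType d1)
    (T2 : measurableType d2) (P : probability T R)
    (X : T -> T1) (Y : T -> T2) (Phi : T1 * T2 -> T) (G : set T) (c : \bar R) :
  measurable_fun setT X -> measurable_fun setT Y -> measurable_fun setT Phi ->
  (forall A B, measurable A -> measurable B ->
    P (X @^-1` A `&` Y @^-1` B) = P (X @^-1` A) * P (Y @^-1` B)) ->
  (forall t, Phi (X t, Y t) = t) -> measurable G -> P G < c ->
  exists b, measurable [set y | G (Phi (b, y))] /\
    P (Y @^-1` [set y | G (Phi (b, y))]) < c.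
Proof.
move=> mX mY mPhi XY PhiK mG PGc.
pose X' := mfun_of mX; pose Y' := mfun_of mY.
have mXY : measurable_fun setT (fun t => (X t, Y t)).
  by apply/measurable_fun_pairP.
pose m := distribution P (mfun_of mXY).
have mPG : measurable (Phi @^-1` G) by exact: measurable_preimage.
have mE : (distribution P X' \x distribution P Y') (Phi @^-1` G) = P G.
  rewrite (@product_measure_unique _ _ _ _ _ (distribution P X') (distribution P Y') m) //.
  rewrite /m /distribution /= /pushforward/=; congr (P _).
  by apply/funext => t /=; rewrite PhiK.
apply: contrapT => /forallNP noB.
have : c <= P G.
  rewrite -mE /product_measure1.
  apply: (@le_trans _ _ (\int[distribution P X']_x cst c x)).
    by rewrite integral_cst//= (@probability_setT _ _ _ (distribution P X')) mule1.
  apply: ge0_le_integral => //.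
  - by move=> x _; apply: ltW; apply: le_lt_trans PGc.
  - exact: measurable_fun_xsection.
  move=> b _; rewrite leNgt; apply/negP => ltc; apply: (noB b); split.
    by have := @measurable_xsection _ _ _ _ _ b mPG; rewrite xsectionE.
  by move: ltc; rewrite /= xsectionE.
by rewrite leNgt PGc.
Qed.

End section_of_independent.

Section poisson_restr.
Context {R : realType} {d : nat}.
Local Notation S := (marked R d).
Local Notation Om := (config R d).
Implicit Types (w : Om) (A D : set S).

Lemma measurable_ptsI w A : measurable (pts w `&` A).
Proof.
apply: countable_measurable; first exact: measurable_point.
by apply: sub_countable (countable_pts w); apply: subset_card_le; exact: subIsetl.
Qed.

Lemma npts_cunion_restr A D w w' :
  npts A (cunion (restr D w) (restr (~` D) w')) =
  (npts (D `&` A) w + npts (~` D `&` A) w')%E.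
Proof.
rewrite /npts /= setIUl -!setIA.
rewrite -[LHS]/((counting : {measure set S -> \bar R}) _) measureU//.
- exact: measurable_ptsI.
- exact: measurable_ptsI.
- by rewrite -subset0 => X [[_ [DX _]] [_ [/(_ DX)]]].
Qed.

Lemma measurable_cunion_restr D : measurable D ->
  measurable_fun setT (fun p : Om * Om => cunion (restr D p.1) (restr (~` D) p.2)).
Proof.
move=> mD; apply: measurable_config_fun => A mA.
rewrite (_ : _ \o _ = (npts (D `&` A) \o fst) \+ (npts (~` D `&` A) \o snd))%E; last first.
  by apply/funext => p; rewrite /= npts_cunion_restr.
apply: emeasurable_funD; apply: measurableT_comp => //; apply: measurable_npts.
  exact: measurableI.
by apply: measurableI => //; exact: measurableC.
Qed.

Variables (alpha : R) (Q : probability (mark R) R) (P : probability Om R).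
Hypotheses (alpha0 : 0 < alpha) (PP : is_poisson (intensity alpha Q) P).

Lemma poisson_indep D1 D2 : measurable D1 -> measurable D2 -> D1 `&` D2 = set0 ->
  forall A B : set Om, measurable A -> measurable B ->
  P (restr D1 @^-1` A `&` restr D2 @^-1` B) =
  (P (restr D1 @^-1` A) * P (restr D2 @^-1` B))%E.
Proof.
move=> mD1 mD2 D12 A B mA mB.
have D2C : D2 `<=` ~` D1 by move=> X D2X D1X; rewrite -[False]/(set0 X) -D12.
have := poisson_indep_restr alpha0 PP mD1 mA (measurable_preimage (measurable_restr mD2) mB).
have -> // : restr (~` D1) @^-1` (restr D2 @^-1` B) = restr D2 @^-1` B.
by apply/funext => w; rewrite /preimage/= restr_sub.
Qed.

(* Fixing the configuration outside [D] to a suitable value turns a measurable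
   superset of [C] into one that only depends on the configuration in [D]. *)
Lemma poisson_increasing_cover D (C G : set Om) (c : \bar R) : measurable D ->
  (forall w w', C w -> pts w `<=` pts w' -> C w') -> measurable G -> C `<=` G ->
  (P G < c)%E ->
  exists G', [/\ measurable G', restr D @^-1` C `<=` restr D @^-1` G' &
    (P (restr D @^-1` G') < c)%E].
Proof.
move=> mD Cup mG CG PGc; have mDC := measurableC mD.
have mPhi := measurable_cunion_restr mDC.
have [||b [mb Pb]] := indep_section (measurable_restr mDC) (measurable_restr mD)
  mPhi _ _ mG PGc.
- by apply: poisson_indep => //; rewrite setICl.
- by move=> w; apply: config_ext; rewrite /= setCK -!setIA !setIid -setIUr setUC setUv setIT.
eexists; split; [exact: mb| |exact: Pb].
move=> w /= Cw; apply: CG; apply: (Cup _ _ Cw) => X [wX DX] /=.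
by right; split => // nDX; exact: nDX.
Qed.

(** Only the intensity has to be finite, so unbounded sets are covered, such as the set of all
    points with too large a mark. *)
Lemma poisson_void A : measurable A -> intensity alpha Q A = 0%E ->
  P [set w | npts A w = 0%E] = 1%E.
Proof.
move=> mA A0.
have := PP (n := 1) (A := fun=> A) (fun=> 0%N) => /(_ (fun=> mA)).
rewrite A0 ltry => /(_ (fun=> isT)).
rewrite big_ord1 fact0 expr0 divr1 mulr1 oppr0 expR0 => <-.
  congr (P _); apply/seteqP; split => w /=; first by move=> h i _.
  by move=> /(_ ord0); exact.
by apply/trivIsetP => i j _ _; rewrite !ord1 eqxx.
Qed.

End poisson_restr.

(** * Moments of the counting variables *)

Section moments.
Context {R : realType} {d : nat}.
Local Notation S := (marked R d).
Local Notation Om := (config R d).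
Implicit Types (w : Om) (A B D : set S).

(** These tail events are increasing in the configuration, hence comparable with the Poisson process
    through the coupling. Summed over [n] they give back the count, so moments become sums of their
    probabilities. *)
Definition count_gt A n : set Om := [set w | (n < card_pts A w)%N].

Lemma measurable_count_gt A n : measurable A -> locally_bounded A ->
  measurable (count_gt A n).
Proof.
move=> mA bA.
exact: (measurable_preimage (A := [set k | (n < k)%N]) (measurable_card_pts mA bA)).
Qed.

Lemma npts_series A w : locally_bounded A ->
  npts A w = (\sum_(n <oo) (\1_(count_gt A n) w)%:E)%E.
Proof.
move=> bA; rewrite nptsE//.
rewrite (nneseries_split_cond _ (card_pts A w)) //.
rewrite big_mkord add0n eseries0 ?adde0; last first.
  move=> i /= Ai _; rewrite indicE memNset//= /count_gt/= => ltA.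
  by move: Ai; rewrite leqNgt ltA.
rewrite (eq_bigr (fun=> 1%E)); last first.
  by move=> i _; rewrite indicE mem_set//; exact: (ltn_ord i).
by rewrite sumEFin sumr_const card_ord.
Qed.

Lemma first_moment (P : probability Om R) A : measurable A -> locally_bounded A ->
  (\int[P]_w npts A w = \sum_(n <oo) P (count_gt A n))%E.
Proof.
move=> mA bA; under eq_integral do rewrite npts_series//.
rewrite integral_nneseries//; last first.
  by move=> n; apply/measurable_EFinP; apply: measurable_indic; exact: measurable_count_gt.
apply: eq_eseriesr => n _; rewrite integral_indic ?setIT//.
exact: measurable_count_gt.
Qed.

Lemma second_moment (P : probability Om R) A B : measurable A -> locally_bounded A ->
  measurable B -> locally_bounded B ->
  (\int[P]_w (npts A w * npts B w) =
   \sum_(n <oo) \sum_(m <oo) P (count_gt A n `&` count_gt B m))%E.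
Proof.
move=> mA bA mB bB.
have mAn n := measurable_count_gt n mA bA.
have mBn n := measurable_count_gt n mB bB.
have E w : (npts A w * npts B w =
    \sum_(n <oo) \sum_(m <oo) (\1_(count_gt A n `&` count_gt B m) w)%:E)%E.
  rewrite muleC nptsE// npts_series// -nneseriesZl//.
  apply: eq_eseriesr => n _; rewrite muleC -nptsE// npts_series// -nneseriesZl//.
  by apply: eq_eseriesr => m _; rewrite -EFinM indicI.
under eq_integral do rewrite E.
have mI n m : measurable_fun [set: Om] (fun w : Om => (\1_(count_gt A n `&` count_gt B m) w : R)%:E).
  apply/measurable_EFinP; apply: measurable_indic; exact: measurableI.
rewrite integral_nneseries//; last 2 first.
- by move=> n; apply: ge0_emeasurable_sum.
- by move=> n w _; exact: nneseries_ge0.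
apply: eq_eseriesr => n _; rewrite integral_nneseries//.
apply: eq_eseriesr => m _; rewrite integral_indic ?setIT//.
exact: measurableI.
Qed.

Section poisson_moments.
Variables (alpha : R) (Q : probability (mark R) R) (P : probability Om R).
Hypotheses (alpha0 : 0 < alpha) (PP : is_poisson (intensity alpha Q) P).

Lemma intensity_ge0 A : (0 <= intensity alpha Q A)%E.
Proof. by rewrite /intensity mule_ge0// lee_fin ltW. Qed.

Lemma intensity_cyl (L : set (d.-tuple R)) : measurable L ->
  intensity alpha Q (cyl L) = (alpha%:E * lebesgue_tuple d L)%E.
Proof.
move=> mL; rewrite /intensity product_measure1E//.
by rewrite [X in (_ * (_ * X))%E](_ : _ = 1%E) ?mule1//; exact: probability_setT.
Qed.

Lemma poisson_first_moment A : measurable A -> locally_bounded A ->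
  (\int[P]_w npts A w = intensity alpha Q A)%E.
Proof.
move=> mA bA.
have muA : intensity alpha Q A \is a fin_num.
  by rewrite ge0_fin_numE ?intensity_ge0// (intensity_lty Q alpha0).
set m := fine (intensity alpha Q A).
have m0 : 0 <= m by rewrite fine_ge0// intensity_ge0.
have PA k : P (card_pts A @^-1` [set k]) = (expR (- m) * m ^+ k / k`!%:R)%:E.
  rewrite (_ : _ @^-1` _ = [set w | forall t : 'I_1, card_pts A w = k]); last first.
    by apply/seteqP; split => w /=; [move=> ? _|move=> /(_ ord0)].
  rewrite (poisson_family alpha0 PP (T := 'I_1) (A := fun=> A) (fun=> k)) ?big_ord1//.
  by move=> s t; rewrite !ord1 eqxx.
have mk k : measurable (card_pts A @^-1` [set k]).
  by apply: measurable_preimage => //; exact: measurable_card_pts.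
have E w : npts A w = (\sum_(k <oo) (k%:R * \1_(card_pts A @^-1` [set k]) w)%:E)%E.
  rewrite nptsE// (@nneseriesD1 _ _ (card_pts A w)) //.
    rewrite indicE mem_set//= mulr1 eseries0 ?adde0// => i _ /= ik.
    by rewrite indicE memNset ?mulr0//= => ki; rewrite ki eqxx in ik.
under eq_integral do rewrite E.
rewrite integral_nneseries//; last first.
  by move=> k; apply/measurable_EFinP; apply: measurable_funM.
rewrite (eq_eseriesr (g := fun k => (k%:R * (expR (- m) * m ^+ k / k`!%:R))%:E)); last first.
  move=> k _; under eq_integral do rewrite EFinM.
  rewrite ge0_integralZl_EFin//; last exact/measurable_EFinP.
  by rewrite integral_indic// setIT EFinM -PA.
(* The term [k = 0] vanishes; after the shift, [k.+1 / (k.+1)! = 1 / k!] leaves [m] times the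
   exponential series. *)
apply/cvg_lim => //; rewrite -(cvg_shiftS _) /=.
rewrite [X in X @ _](_ : _ = (fun n => (m * expR (- m) * series (exp_coeff m) n)%:E)).
  have -> : intensity alpha Q A = (m * expR (- m) * expR m)%:E.
    by rewrite -mulrA expRN mulVf ?mulr1 ?gt_eqF ?expR_gt0// fineK.
  apply/cvg_EFin; first exact: nearW.
  by apply: cvgMr; exact: is_cvg_series_exp_coeff.
apply/funext => n; rewrite big_nat_recl// mul0r add0e sumEFin /series/= mulr_sumr.
congr EFin; apply: eq_bigr => k _; rewrite /exp_coeff/= factS natrM exprS.
have : k.+1%:R != 0 :> R by rewrite pnatr_eq0.
have : k`!%:R != 0 :> R by rewrite pnatr_eq0 -lt0n fact_gt0.
by move: (k`!%:R) (k.+1%:R) => a b a0 b0; field; rewrite a0.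
Qed.

End poisson_moments.
End moments.

(** * Connections in the Gilbert graph *)

Section euclidean.
Context {R : realType} {d : nat}.
Implicit Types (x y z : d.-tuple R) (A B : set (d.-tuple R)).

Lemma eucl_ge0 x y : 0 <= eucl x y.
Proof. exact: sqrtr_ge0. Qed.

Lemma eucl_xx x : eucl x x = 0.
Proof. by rewrite /eucl big1 ?sqrtr0// => i _; rewrite subrr expr0n. Qed.

Lemma eucl_sym x y : eucl x y = eucl y x.
Proof. by congr Num.sqrt; apply: eq_bigr => i _; rewrite -sqrrN opprB. Qed.

(** Lagrange's identity: twice the defect is the sum of the squares
    [(u i * v j - u j * v i) ^+ 2]. *)
Lemma cauchy_schwarz (I : finType) (u v : I -> R) :
  (\sum_i u i * v i) ^+ 2 <= (\sum_i u i ^+ 2) * (\sum_i v i ^+ 2).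
Proof.
have : 0 <= \sum_i \sum_j (u i * v j - u j * v i) ^+ 2.
  by apply: sumr_ge0 => i _; apply: sumr_ge0 => j _; exact: sqr_ge0.
have -> : \sum_i \sum_j (u i * v j - u j * v i) ^+ 2 =
    2 * ((\sum_i u i ^+ 2) * (\sum_i v i ^+ 2) - (\sum_i u i * v i) ^+ 2).
  rewrite (eq_bigr (fun i => u i ^+ 2 * (\sum_j v j ^+ 2) +
    (\sum_j u j ^+ 2) * v i ^+ 2 - 2 * (u i * v i) * (\sum_j u j * v j))); last first.
    move=> i _; rewrite !mulr_sumr mulr_suml -big_split/= -sumrB.
    by apply: eq_bigr => j _; ring.
  rewrite sumrB big_split/= -!mulr_suml -mulr_sumr -mulr_sumr; ring.
by rewrite pmulr_rge0// subr_ge0.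
Qed.

Lemma eucl_triangle x y z : eucl x z <= eucl x y + eucl y z.
Proof.
pose u i := tnth x i - tnth y i; pose v i := tnth y i - tnth z i.
have u0 : 0 <= \sum_i u i ^+ 2 by apply: sumr_ge0 => i _; exact: sqr_ge0.
have v0 : 0 <= \sum_i v i ^+ 2 by apply: sumr_ge0 => i _; exact: sqr_ge0.
have uv : \sum_i u i * v i <= eucl x y * eucl y z.
  rewrite (le_trans (ler_norm _))// -ler_sqr ?nnegrE ?mulr_ge0 ?eucl_ge0//.
  by rewrite real_normK ?num_real// exprMn !sqr_sqrtr//; exact: cauchy_schwarz.
rewrite -ler_sqr ?nnegrE ?addr_ge0 ?eucl_ge0// sqrrD !sqr_sqrtr//; last first.
  by apply: sumr_ge0 => i _; exact: sqr_ge0.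
rewrite (_ : \sum_(i < d) _ = \sum_i u i ^+ 2 + (\sum_i u i * v i) *+ 2 + \sum_i v i ^+ 2).
  by rewrite lerD2r lerD2l lerMn2r uv.
rewrite -sumrMnl -!big_split/=; apply: eq_bigr => i _; rewrite /u /v; ring.
Qed.

Definition thicken (r : R) A := [set z | exists2 y, A y & eucl z y <= r].

(** The witness form covers empty sets without a case distinction: if [A'] or [B'] is empty, the
    right-hand side is infinite. *)
Lemma dist_sets_le_shift A B A' B' (c : R) :
  (forall a' b', A' a' -> B' b' -> exists a b,
    [/\ A a, B b & eucl a b <= eucl a' b' + c]) ->
  (dist_sets A B <= dist_sets A' B' + c%:E)%E.
Proof.
move=> h; rewrite -leeBlDr//; apply: le_ereal_inf_tmp => _ [[a' b'] [Aa Bb] <-]; rewrite /fst /snd in Aa Bb *.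
have [a [b [Aa' Bb' ab]]] := h _ _ Aa Bb.
rewrite leeBlDr// -EFinD; apply: (@le_trans _ _ (eucl a b)%:E); last by rewrite lee_fin.
by apply: ereal_inf_lbound; exists (a, b).
Qed.

Lemma dist_sets_ge0 A B : (0 <= dist_sets A B)%E.
Proof.
by apply: le_ereal_inf_tmp => _ [p _ <-]; rewrite lee_fin eucl_ge0.
Qed.

Lemma dist_sets_le A B x y : A x -> B y -> (dist_sets A B <= (eucl x y)%:E)%E.
Proof. by move=> Ax By; apply: ereal_inf_lbound; exists (x, y). Qed.

(** Moving points by at most [c] costs the factor [expR (kappa * c)]. For infinite [e'] the
    left-hand side is 0. *)
Lemma expeR_dist_le (kappa c : R) (e e' : \bar R) : 0 < kappa -> (0 <= e)%E ->
  (e <= e' + c%:E)%E ->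
  (expeR (- (kappa%:E * e')) <= (expR (kappa * c))%:E * expeR (- (kappa%:E * e)))%E.
Proof.
move=> k0; case: e => [e| |]//; case: e' => [e'| |]//=.
- move=> _; rewrite !lee_fin => ee; rewrite -expRD ler_expR.
  by rewrite -mulrN -mulrN -mulrDr ler_pM2l//; lra.
- by move=> _ _; rewrite mulry gtr0_sg// mul1e/= -EFinM lee_fin mulr_ge0// expR_ge0.
- by move=> _ _; rewrite mulry gtr0_sg// mul1e/= mule0.
Qed.

End euclidean.

(** * Dyadic cells and coverings by unit cubes *)

Section cells.
Context {R : realType} {d : nat}.
Implicit Types (x y z : d.-tuple R) (A B : set (d.-tuple R)).

(** The index of the dyadic cell of side [2 ^- n] containing [x]; the cell itself is a preimage.
    Indices range over a countable type, so any union of cells is measurable. *)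
Definition cell n x : d.-tuple int := [tuple Num.floor (2 ^+ n * tnth x i) | i < d].

Lemma tnth_cell n x i : tnth (cell n x) i = Num.floor (2 ^+ n * tnth x i).
Proof. by rewrite tnth_mktuple. Qed.

Lemma measurable_cell1 n (k : d.-tuple int) : measurable (cell n @^-1` [set k]).
Proof.
rewrite (_ : _ @^-1` _ = [set x | forall i, [set x |
    tnth x i \in `[(tnth k i)%:~R / 2 ^+ n, (tnth k i + 1)%:~R / 2 ^+ n[ ] x]).
  by apply: measurable_forall_coord => i; exact: measurable_coord_itv.
apply/seteqP; split => x /=.
  move=> <- i; rewrite in_itv/= tnth_cell ler_pdivrMr ?exprn_gt0// ltr_pdivlMr ?exprn_gt0//.
  by rewrite mulrC floor_le_tmp floorD1_gt.
move=> h; apply: eq_from_tnth => i; have := h i.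
rewrite in_itv/= tnth_cell ler_pdivrMr ?exprn_gt0// ltr_pdivlMr ?exprn_gt0// mulrC.
by move=> xk; apply/floor_def.
Qed.

Lemma measurable_cell n (S : set (d.-tuple int)) : measurable (cell n @^-1` S).
Proof.
rewrite (_ : _ @^-1` _ = \bigcup_(k in S) (cell n @^-1` [set k])); last first.
  by apply/seteqP; split => x /=; [move=> Sx; exists (cell n x)|move=> [k Sk /= ->]].
rewrite bigcup_mkcond; apply: countable_bigcupT_measurable; first exact: countableP.
by move=> k; case: ifP => // _; exact: measurable_cell1.
Qed.

Lemma cell_eucl n x y : cell n x = cell n y -> eucl x y <= Num.sqrt d%:R.
Proof.
move=> xy; rewrite -[leRHS]mulr1; apply: eucl_le_coord => // i.
have e : Num.floor (2 ^+ n * tnth x i) = Num.floor (2 ^+ n * tnth y i).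
  by rewrite -!tnth_cell xy.
have fx := @floor_itv R (2 ^+ n * tnth x i).
have fy := @floor_itv R (2 ^+ n * tnth y i).
have n1 : 1 <= 2 ^+ n :> R by rewrite exprn_ege1// ler1n.
have : `|2 ^+ n * (tnth x i - tnth y i)| <= 1.
  rewrite mulrBr ler_norml; rewrite -e in fy; move: fx fy.
  rewrite !intrD; set k := (_%:~R : R) => /andP[? ?] /andP[? ?].
  apply/andP; split; lra.
rewrite normrM (ger0_norm (_ : 0 <= 2 ^+ n)) ?exprn_ge0// => h.
by apply: le_trans h; rewrite ler_peMl.
Qed.

(** [k <= 2 ^+ m * t] holds exactly when the integer [2 ^+ (n - m) * k] is at most the floor of
    [2 ^+ n * t], so the finer floor determines the coarser one. *)
Lemma cell_coarser m n x y : (m <= n)%N -> cell n x = cell n y -> cell m x = cell m y.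
Proof.
move=> mn.
suff le a b : cell n a = cell n b -> forall i,
    Num.floor (2 ^+ m * tnth a i) <= Num.floor (2 ^+ m * tnth b i).
  move=> xy; apply: eq_from_tnth => i; rewrite !tnth_cell.
  by apply/eqP; rewrite eq_le !le.
move=> ab i.
have e : Num.floor (2 ^+ n * tnth a i) = Num.floor (2 ^+ n * tnth b i).
  by rewrite -!tnth_cell ab.
set k := Num.floor (2 ^+ m * tnth a i).
have ka : (2 ^+ (n - m) * k)%:~R <= 2 ^+ n * tnth a i.
  rewrite -[in leRHS](subnK mn) exprD -mulrA intrM rmorphXn/= ler_pM2l ?exprn_gt0//.
  exact: floor_le_tmp.
have kb : (2 ^+ (n - m) * k)%:~R <= 2 ^+ n * tnth b i.
  rewrite (le_trans _ (floor_le_tmp _))// -e ler_int.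
  by rewrite floor_ge_int_tmp.
rewrite floor_ge_int_tmp; move: kb.
by rewrite -[in leRHS](subnK mn) exprD -mulrA intrM rmorphXn/= ler_pM2l ?exprn_gt0.
Qed.

Lemma cell_separated x y : x != y -> exists n, cell n x != cell n y.
Proof.
move=> xy; have [i xyi] : exists i, tnth x i != tnth y i.
  apply: contrapT => /forallNP h; move/eqP: xy; apply; apply: eq_from_tnth => i.
  by apply/eqP; have /negP := h i; rewrite negbK.
have e0 : 0 < `|tnth x i - tnth y i| by rewrite normr_gt0 subr_eq0.
(* At level [n.+1] the gap between the two coordinates exceeds the side of a cell, as
   [2 ^+ n.+1 >= n.+1] and [n.+1] is larger than the inverse gap. *)
pose n := Num.truncn (`|tnth x i - tnth y i|^-1).
exists n.+1; apply/eqP => /(congr1 (fun t => tnth t i)); rewrite !tnth_cell => e.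
have fx := @floor_itv R (2 ^+ n.+1 * tnth x i).
have fy := @floor_itv R (2 ^+ n.+1 * tnth y i).
have : `|2 ^+ n.+1 * (tnth x i - tnth y i)| <= 1.
  rewrite mulrBr ler_norml; rewrite -e in fy; move: fx fy.
  rewrite !intrD; set k := (_%:~R : R) => /andP[? ?] /andP[? ?].
  apply/andP; split; lra.
apply/negP; rewrite -ltNge normrM (ger0_norm (_ : 0 <= 2 ^+ _)) ?exprn_ge0//.
rewrite -ltr_pdivrMr// div1r (lt_le_trans (truncnS_gt _))// -/n.
by rewrite -natrX ler_nat ltnW// ltn_expl.
Qed.

(** A measurable hull of an arbitrary set, here of a thickening, at the cost of one cell diameter in
    distances. *)
Definition cells A := cell 0 @^-1` (cell 0 @` A).

Lemma sub_cells A : A `<=` cells A.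
Proof. by move=> x Ax; exists x. Qed.

Lemma measurable_cells A : measurable (cells A).
Proof. exact: measurable_cell. Qed.

Lemma cells_thicken r A z : cells (thicken r A) z ->
  exists2 y, A y & eucl z y <= r + Num.sqrt d%:R.
Proof.
move=> [u [y Ay uy] uz]; exists y => //.
by rewrite (le_trans (eucl_triangle _ u _))// addrC lerD// eucl_sym; exact: cell_eucl uz.
Qed.

Definition cube (s : R) (a : d.-tuple R) := [set x | forall i, tnth a i <= tnth x i <= tnth a i + s].

(** Unit cubes starting at the lower corner of the [r]-thickened cube. With [M] the integer part of
    [s + 2 * r], the values [0, ..., M] of each [tnth j i] reach its far side. *)
Definition grid_cube (r : R) a (M : nat) (j : d.-tuple 'I_M.+1) : set (d.-tuple R) :=
  cube 1 [tuple tnth a i - r + (tnth j i)%:R | i < d].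

Lemma grid_cube_cover r s a A : 0 <= r -> 0 <= s -> A `<=` cube s a ->
  thicken r A `<=` \bigcup_j grid_cube r a (M := Num.truncn (s + 2 * r)) j.
Proof.
move=> r0 s0 As z [y /As ya zy].
set M := Num.truncn _.
have zi i : tnth a i - r <= tnth z i <= tnth a i + s + r.
  have := le_trans (coord_le_eucl z y i) zy; rewrite ler_norml.
  by have /andP[? ?] := ya i; move=> /andP[? ?]; apply/andP; split; lra.
exists [tuple inord (Num.truncn (tnth z i - tnth a i + r)) | i < d] => // i.
rewrite !tnth_mktuple inordK; last first.
  by rewrite ltnS le_truncn//; have := zi i; lra.
have h : 0 <= tnth z i - tnth a i + r by have := zi i; lra.
have := truncn_itv h; rewrite -natr1; lra.
Qed.

Lemma grid_cube_dist r s a M (j : d.-tuple 'I_M.+1) x y : 0 <= r -> 0 <= s ->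
  cube s a x -> grid_cube r a j y ->
  eucl x y <= Num.sqrt d%:R * (s + r + M%:R + 1).
Proof.
move=> r0 s0 xa yj; apply: eucl_le_coord => [|i].
  by rewrite !addr_ge0.
have := yj i; rewrite tnth_mktuple; have := xa i.
have jM : (tnth j i)%:R <= M%:R :> R by rewrite ler_nat -ltnS.
have j0 : 0 <= (tnth j i)%:R :> R by [].
have M0 : 0 <= M%:R :> R by [].
move=> /andP[? ?] /andP[? ?]; rewrite ler_norml; apply/andP; split; lra.
Qed.

Lemma in_unit_cube_grid r a M (j : d.-tuple 'I_M.+1) : in_unit_cube (grid_cube r a j).
Proof. by exists [tuple tnth a i - r + (tnth j i)%:R | i < d]. Qed.

Lemma measurable_grid_cube r a M (j : d.-tuple 'I_M.+1) : measurable (grid_cube r a j).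
Proof. exact: (measurable_cube (fun i => tnth _ i) (fun i => tnth _ i + 1)). Qed.

End cells.

Section connection.
Context {R : realType} {d : nat}.
Local Notation S := (marked R d).
Implicit Types (w g : set S) (X Y : S) (A B : set (d.-tuple R)).

Lemma gilbert_edge_sub w w' X Y : w `<=` w' -> gilbert_edge w X Y -> gilbert_edge w' X Y.
Proof. by move=> ww' [wX wY ?]; split => //; exact: ww'. Qed.

Lemma gilbert_connected_sub w w' X Y : w `<=` w' ->
  gilbert_connected w X Y -> gilbert_connected w' X Y.
Proof.
move=> ww' [p pX lp]; exists p => //; apply: sub_path pX => U V /asboolP UV.
by apply/asboolP; exact: gilbert_edge_sub UV.
Qed.

Lemma gilbert_connected_cons w X Y Z : gilbert_edge w X Y ->
  gilbert_connected w Y Z -> gilbert_connected w X Z.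
Proof.
by move=> XY [p pY lp]; exists (Y :: p) => //=; rewrite pY andbT; exact/asboolP.
Qed.

Lemma gilbert_connected1 w X Y : gilbert_edge w X Y -> gilbert_connected w X Y.
Proof. by move=> XY; apply: (gilbert_connected_cons XY); exists [::]. Qed.

Lemma sets_connected_by_sub w w' A A' B B' : w `<=` w' -> A `<=` A' -> B `<=` B' ->
  sets_connected_by w A B -> sets_connected_by w' A' B'.
Proof.
move=> ww' AA' BB' [x [y [Ax By c]]]; exists x, y; split; [exact: AA'|exact: BB'|].
by apply: gilbert_connected_sub c; exact: setSU.
Qed.

Lemma sets_connected_by_self w A B x : A x -> B x -> sets_connected_by w A B.
Proof. by move=> Ax Bx; exists x, x; split => //; exists [::]. Qed.

Lemma mball_center X : mball X X.1.
Proof. by rewrite /mball/= eucl_xx /mark_val. Qed.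

Lemma mball_mark0 (x : d.-tuple R) : mball (x, mark0 R) x.
Proof. exact: (mball_center (x, mark0 R)). Qed.

(* The path is cut at its last exit from [A], so that the remaining part only
   uses points with centres outside [A]. *)
Lemma connected_to_last_exit (r0 : R) w g A B X :
  (forall Y, w Y -> mark_val Y.2 <= r0) ->
  (forall Y, g Y -> B Y.1 /\ mark_val Y.2 <= r0) ->
  w X -> A X.1 -> connected_to w X g ->
  sets_connected_by (w `&` ~` cyl A) (thicken r0 A) (thicken r0 B).
Proof.
move=> wr gr wX AX [Y gY [p pX lp]].
set w' := w `&` ~` cyl A; set concl := sets_connected_by _ _ _.
have thick C (U : S) z : C U.1 -> mark_val U.2 <= r0 -> mball U z -> thicken r0 C z.
  by move=> CU Ur Uz; exists U.1 => //; rewrite eucl_sym (le_trans Uz).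
have [BY Yr] := gr _ gY.
(* Induction along the path, with an invariant read from its end: either the desired connection has
   been found, or [U] lies outside [A] and reaches a zero-mark point of the thickened [B] through
   points outside [A]. That point is taken in the ball of [Y], which replaces the boundary point
   itself. A path vertex not in [w] can only be [Y], since [X] is in [w]. *)
suff h : forall q U, w U -> path (fun U V => `[< gilbert_edge (w `|` [set X; Y]) U V >]) U q ->
    last U q = Y -> concl \/ (~ A U.1 /\ exists2 z, thicken r0 B z &
      gilbert_connected (w' `|` [set (z, mark0 R)]) U (z, mark0 R)).
  by have [//|[]] := h _ _ wX pX lp.
have reachY U : w U -> forall z, mball U z -> mball Y z ->
    concl \/ (~ A U.1 /\ exists2 z, thicken r0 B z &
      gilbert_connected (w' `|` [set (z, mark0 R)]) U (z, mark0 R)).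
  move=> wU z Uz Yz; have Bz := thick _ _ _ BY Yr Yz.
  have [AU|nAU] := pselect (A U.1).
    by left; apply: (@sets_connected_by_self _ _ _ z) => //; exact: thick (wr _ wU) Uz.
  right; split => //; exists z => //; apply: gilbert_connected1; split.
  - by left; split => // -[].
  - by right.
  - by exists z; split => //; exact: mball_mark0.
elim=> [|V q IH] U wU /=.
  by move=> _ UY; apply: (reachY _ wU U.1); [exact: mball_center|rewrite -UY; exact: mball_center].
move=> /andP[/asboolP[_ wV [z [Uz Vz]]] qV lq].
have [wV'|nwV] := pselect (w V); last first.
  have VY : V = Y by case: wV => [//|[VX|//]]; move: nwV; rewrite VX.
  by apply: (reachY _ wU z) => //; rewrite -VY.
have [|[nAV [y By cV]]] := IH V wV' qV lq; first by left.
have w'V : w' V by split => // -[].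
have [AU|nAU] := pselect (A U.1).
  left; exists z, y; split => //; first exact: thick (wr _ wU) Uz.
  apply: (@gilbert_connected_cons _ _ V).
    split; [by right; left|by left|by exists z; split => //; exact: mball_mark0].
  by apply: gilbert_connected_sub cV => W [?|->]; [left|right; right].
right; split => //; exists y => //.
apply: (@gilbert_connected_cons _ _ V) => //.
by split; [left; split => // -[]|left|exists z].
Qed.

End connection.

Section almost_sure_inclusion.
Context d (T : measurableType d) (R : realType).

Lemma measure_le_ae (mu : {measure set T -> \bar R}) (A B : set T) :
  measurable A -> measurable B -> {ae mu, forall x, A x -> B x} -> (mu A <= mu B)%E.
Proof.
move=> mA mB [N [mN N0 AB]].
apply: (@le_trans _ _ (mu (B `|` N))).
  apply: le_measure; rewrite ?inE//; first exact: measurableU.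
  by move=> x Ax; have [Bx|nBx] := pselect (B x); [left|right; apply: AB => /(_ Ax)].
apply: (le_trans (measureU2 _ mB mN)).
by rewrite -[leRHS]adde0 leeD2l// -N0.
Qed.

Lemma ae_of_probability1 (P : probability T R) (A : set T) :
  measurable A -> P A = 1%E -> {ae P, forall x, A x}.
Proof.
move=> mA PA; exists (~` A); split => //; first exact: measurableC.
by rewrite probability_setC// PA subee.
Qed.

Lemma mu_ext_lt (mu : {measure set T -> \bar R}) (C : set T) (c : \bar R) :
  ((mu^*)%mu C < c)%E -> exists G, [/\ measurable G, C `<=` G & (mu G < c)%E].
Proof.
move=> /ereal_inf_lt[_ [F [mF CF] <-] Fc].
exists (\bigcup_k F k); split => //; first exact: bigcupT_measurable.
apply: le_lt_trans Fc; apply: measure_sigma_subadditive => //.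
exact: bigcupT_measurable.
Qed.

Lemma mu_ext_bigsetU (mu : {measure set T -> \bar R}) (I : Type) (r : seq I)
    (F : I -> set T) :
  ((mu^*)%mu (\big[setU/set0]_(i <- r) F i) <= \sum_(i <- r) (mu^*)%mu (F i))%E.
Proof.
elim: r => [|i r IH]; first by rewrite !big_nil mu_ext0.
rewrite !big_cons (le_trans (outer_measureU2 (mu_ext mu) _ _))//.
by rewrite leeD2l.
Qed.

End almost_sure_inclusion.

(** * Decay of connection probabilities beyond unit cubes *)

Section poisson_connection.
Context {R : realType} {d : nat}.
Local Notation S := (marked R d).
Local Notation Om := (config R d).
Implicit Types (w : Om) (A B L : set (d.-tuple R)) (D : set S).

Variables (alpha : R) (Q : probability (mark R) R) (P : probability Om R).
Hypotheses (alpha0 : 0 < alpha) (PP : is_poisson (intensity alpha Q) P).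
Variables (r0 : R) (Qr0 : Q [set r | mark_val r <= r0] = 1%E).

Definition big_marks : set S := [set X | ~ mark_val X.2 <= r0].

Lemma measurable_big_marks : measurable big_marks.
Proof.
rewrite (_ : big_marks = setT `*` ~` [set r | mark_val r <= r0]); last first.
  by apply/seteqP; split => X //= [].
apply: measurableX => //; apply: measurableC.
exists [set x | x <= r0]; last by rewrite setTI.
rewrite (_ : [set _ | _] = `]-oo, r0]%classic); first exact: measurable_itv.
by apply/seteqP; split => x; rewrite /= in_itv.
Qed.

Lemma poisson_no_big_marks : P [set w | npts big_marks w = 0%E] = 1%E.
Proof.
apply: (poisson_void PP measurable_big_marks).
have mr : measurable [set r : mark R | mark_val r <= r0].
  exists [set x | x <= r0]; last by rewrite setTI.
  rewrite (_ : [set _ | _] = `]-oo, r0]%classic); first exact: measurable_itv.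
  by apply/seteqP; split => x; rewrite /= in_itv.
rewrite /intensity (_ : big_marks = setT `*` ~` [set r | mark_val r <= r0]); last first.
  by apply/seteqP; split => X //= [].
rewrite product_measure1E//; last exact: measurableC.
rewrite [X in (_ * (_ * X))%E](_ : _ = 0%E) ?mule0//.
by rewrite [LHS](probability_setC Q mr) Qr0 subee.
Qed.

Lemma npts_big_marks0 w : npts big_marks w = 0%E <->
  forall X, pts w X -> mark_val X.2 <= r0.
Proof.
split=> [/npts_eq0 w0 X wX|wr]; last first.
  by apply/npts_eq0; rewrite -subset0 => X [/wr].
by apply: contrapT => Xr; rewrite -[False]/(set0 X) -w0.
Qed.

Lemma r0_ge0 : 0 <= r0.
Proof.
rewrite leNgt; apply/negP => r00.
have : Q [set r | mark_val r <= r0] = 0%E.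
  rewrite (_ : [set _ | _] = set0) ?measure0// -subset0 => r /= rr0.
  have : 0 <= mark_val r by rewrite /mark_val.
  by rewrite leNgt (le_lt_trans rr0).
by move/eqP; rewrite Qr0 onee_eq0.
Qed.

Variables (kappa : R) (kappa0 : 0 < kappa) (K : R) (K0 : 0 < K).
Hypothesis decay : forall A B, measurable A -> measurable B -> in_unit_cube A ->
  (prob_connected P A B <= K%:E * expeR (- (kappa%:E * dist_sets A B)))%E.

(** Increasing in the configuration but in general not measurable; it is only handled through
    measurable supersets. *)
Definition far_connected A B : set Om :=
  [set w | sets_connected_by (pts w) (thicken r0 A) (thicken r0 B)].

Lemma far_connected_increasing A B w w' :
  far_connected A B w -> pts w `<=` pts w' -> far_connected A B w'.
Proof. by move=> c ww'; apply: sets_connected_by_sub c. Qed.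

(** The thickened [A] is covered by grid cubes, the thickened [B] by unit cells; the decay
    hypothesis applies to each cube, and outer measure is subadditive. The side [s] is arbitrary
    because uniqueness needs large boxes, not only unit cubes. *)
Lemma poisson_far_connected (s : R) : 0 <= s -> exists2 C0 : R, 0 < C0 &
  forall a A B (c : R), A `<=` cube s a ->
    (C0%:E * expeR (- (kappa%:E * dist_sets A B)) < c%:E)%E ->
    exists G, [/\ measurable G, far_connected A B `<=` G & (P G < c%:E)%E].
Proof.
move=> s0; have r00 := r0_ge0.
pose M := Num.truncn (s + 2 * r0).
pose c0 : R := Num.sqrt d%:R * (s + r0 + M%:R + 1) + (r0 + Num.sqrt d%:R).
pose N := #|{: d.-tuple 'I_M.+1}|.
(* [N] is the number of grid cubes. The first summand of [c0] bounds the distance from [A] to a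
   point of a grid cube, the second that from a cell meeting the thickened [B] to [B]. [N.+1] makes
   the constant visibly positive. *)
exists (N.+1%:R * (K * expR (kappa * c0))); first by rewrite !mulr_gt0// expR_gt0.
move=> a A B c Aa Ec; apply: mu_ext_lt.
have E0 : (0 <= expeR (- (kappa%:E * dist_sets A B)))%E by exact: expeR_ge0.
have [A0|/set0P[x Ax]] := eqVneq A set0.
  rewrite (_ : far_connected A B = set0).
    rewrite mu_ext0//; apply: le_lt_trans Ec; rewrite mule_ge0// lee_fin.
    by rewrite !mulr_ge0// ?ltW// expR_gt0.
  rewrite -subset0 => w [y [z [[u]]]]; by rewrite A0.
apply: le_lt_trans Ec.
pose L j := grid_cube r0 a (M := M) j.
pose B' := cells (thicken r0 B).
apply: (@le_trans _ _ ((P^*)%mu (\big[setU/set0]_(j : d.-tuple 'I_M.+1)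
    [set w | sets_connected_by (pts w) (L j) B']))).
  apply: le_mu_ext => w [y [z [Ay Bz c']]].
  have [j _ Ljy] := grid_cube_cover r00 s0 Aa Ay.
  rewrite -bigcup_seq; exists j; first by rewrite /= mem_index_enum.
  by exists y, z; split => //; exact: sub_cells.
apply: (le_trans (mu_ext_bigsetU _ _ _)).
apply: (@le_trans _ _ (\sum_(j : d.-tuple 'I_M.+1)
    (K * expR (kappa * c0))%:E * expeR (- (kappa%:E * dist_sets A B)))%E).
  apply: lee_sum => j _.
  apply: le_trans (decay (measurable_grid_cube r0 a j) (measurable_cells _)
    (in_unit_cube_grid r0 a j)) _.
  rewrite EFinM -muleA lee_pmul2l//.
  apply: expeR_dist_le => //; first exact: dist_sets_ge0.
  apply: dist_sets_le_shift => p q Lp Bq.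
  have [y By qy] := cells_thicken Bq.
  exists x, y; split => //.
  have xp := grid_cube_dist r00 s0 (Aa _ Ax) Lp.
  rewrite (le_trans (eucl_triangle _ p _))//.
  have := eucl_triangle p q y; rewrite /c0; move: xp qy; lra.
rewrite -ge0_sume_distrl; last by move=> *; rewrite lee_fin mulr_ge0 ?expR_ge0// ltW.
apply: lee_wpmul2r => //.
rewrite sumEFin lee_fin sumr_const -/N mulr_natl.
by rewrite mulrS lerDr mulr_ge0 ?expR_ge0// ltW.
Qed.

End poisson_connection.

(** * The disagreement coupling *)

Section coupling.
Context {R : realType} {d : nat}.
Local Notation S := (marked R d).
Local Notation Om := (config R d).
Implicit Types (w g : Om) (A B L : set (d.-tuple R)) (D : set S) (E J U : set Om).

Variables (Pl : probability Om R) (H : set S -> Om -> Om -> \bar R).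
Variables (alpha : R) (Q : probability (mark R) R) (Pbar : probability Om R).
Hypotheses (alpha0 : 0 < alpha) (PP : is_poisson (intensity alpha Q) Pbar).
Variables (r0 : R) (Qr0 : Q [set r | mark_val r <= r0] = 1%E).
Variables (Pdc : set S -> Om -> Om -> probability (Om * Om * Om)%type R).
Hypothesis hPdc : disagreement_coupling H Pl Pbar Pdc.

Lemma Sbp_cyl L : bounded_borel L -> Sbp (cyl L).
Proof.
move=> [mL bL]; split; first exact: measurable_cyl.
rewrite (_ : fst @` cyl L = L)//; apply/seteqP; split => [_ [X [LX _] <-]//|x Lx].
by exists (x, mark0 R).
Qed.

(** A quotient by the partition function is not a probability by form alone. It is one here as the
    first marginal of the coupling with both boundary conditions equal to [g]. *)
Lemma gibbs_probability D g : Sbp D -> Omega (~` D) g -> exists2 P : probability Om R,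
  forall E, measurable E -> gibbs H Pl D g E = P E & P (Omega D) = 1%E.
Proof.
move=> SD gD.
have m1 : measurable_fun [set: Om * Om * Om] (fun x => x.1.1).
  by apply: measurableT_comp => //.
exists (distribution (Pdc D g g) (mfun_of m1)).
  by move=> E mE; rewrite -(dc_gibbs1 hPdc SD gD gD).
rewrite /distribution/= /pushforward/=; apply/eqP; rewrite eq_le probability_le1//=; last first.
  by apply: measurable_Omega; case: SD.
rewrite -(dc_support hPdc SD gD gD); apply: le_measure; rewrite ?inE.
- by repeat apply: measurableX; apply: measurable_Omega; case: SD.
- by apply: measurable_preimage => //; apply: measurable_Omega; case: SD.
- by move=> x [[]].
Qed.

(** Inherited from the measurability of the coupling family along the diagonal of boundary
    conditions. *)
Lemma measurable_gibbs D E : Sbp D -> measurable E ->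
  measurable_fun [set: Om] (fun w => gibbs H Pl D (restr (~` D) w) E).
Proof.
move=> SD mE; have [mD _] := SD.
rewrite (_ : (fun _ => _) =
    (fun p : Om * Om => Pdc D p.1 p.2 [set x | E x.1.1]) \o
    (fun w => (restr (~` D) w, restr (~` D) w))); last first.
  apply/funext => w; rewrite /= (dc_gibbs1 hPdc SD (@Omega_restr _ _ _ _) (@Omega_restr _ _ _ _))//.
have mDC := measurableC mD.
apply: (@measurable_comp _ _ _ _ _ _ (Omega (~` D) `*` Omega (~` D))).
- by apply: measurableX; exact: measurable_Omega.
- by move=> _ [w _ <-]; split; exact: Omega_restr.
- apply: (dc_measurable hPdc SD).
  by apply: (measurable_preimage (f := fun x : Om * Om * Om => x.1.1)) => //; exact: measurableT_comp.
- by apply/measurable_fun_pairP; split; exact: measurable_restr.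
Qed.

Section fixed_boundary.
Variables (D : set S) (g1 g2 : Om).
Hypotheses (SD : Sbp D) (g1D : Omega (~` D) g1) (g2D : Omega (~` D) g2).
Let mu := Pdc D g1 g2.

Let mD : measurable D. Proof. by case: SD. Qed.

Let m1 : measurable_fun [set: Om * Om * Om] (fun x => x.1.1).
Proof. exact: measurableT_comp. Qed.

Let m2 : measurable_fun [set: Om * Om * Om] (fun x => x.1.2).
Proof. exact: measurableT_comp. Qed.

Let m3 : measurable_fun [set: Om * Om * Om] (fun x => x.2).
Proof. exact: measurable_snd. Qed.

(** Stochastic domination: the first coupled configuration is almost surely contained in the Poisson
    one. *)
Lemma gibbs_le_poisson E U : measurable E -> measurable U ->
  (forall w w', E w -> pts w `<=` pts w' -> U w') ->
  (gibbs H Pl D g1 E <= Pbar (restr D @^-1` U))%E.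
Proof.
move=> mE mU EU; rewrite -(dc_gibbs1 hPdc SD g1D g2D)//.
rewrite -[leRHS](dc_poisson hPdc SD g1D g2D)//.
apply: measure_le_ae.
- exact: (measurable_preimage m1).
- exact: (measurable_preimage m3).
apply: filterS (dc_subset hPdc SD g1D g2D) => x sub Ex; apply: EU Ex _ => X xX.
by apply: sub; left.
Qed.

(* When [E] tells the two coupled configurations apart, they differ on [cyl A], so
   that [A] is connected to the boundary by Poisson points outside [cyl A], which
   are independent of [J]. Total variation bounds take [J = setT]; moment bounds
   take [J = E = count_gt (cyl A) n], which keeps a factor summable in [n]. *)
Lemma gibbs_disagreement A L (G J E : set Om) (c : R) :
  D = cyl L -> measurable A -> A `<=` L ->
  (forall X, pts g1 X -> mark_val X.2 <= r0) ->
  (forall X, pts g2 X -> mark_val X.2 <= r0) ->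
  measurable E -> measurable J -> restr (cyl A) @^-1` J = J ->
  (forall w1 w2 w3, pts w1 `|` pts w2 `<=` pts w3 -> E w1 -> ~ E w2 ->
    J w3 /\ restr (cyl A) w1 <> restr (cyl A) w2) ->
  measurable G -> far_connected r0 A (~` L) `<=` G -> (Pbar G < c%:E)%E ->
  (gibbs H Pl D g1 E <= gibbs H Pl D g2 E + Pbar J * c%:E)%E.
Proof.
move=> DL mA AL g1r g2r mE mJ AJ EJ mG CG PG.
have mcA := measurable_cyl mA.
pose D' := D `\` cyl A.
have mD' : measurable D' by exact: measurableD.
have [G' [mG' CG' PG']] := poisson_increasing_cover alpha0 PP mD'
  (@far_connected_increasing _ _ r0 A (~` L)) mG CG PG.
pose W := J `&` restr D' @^-1` G'.
have mW : measurable W.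
  by apply: measurableI => //; apply: measurable_preimage => //; exact: measurable_restr.
have PW : (Pbar (restr D @^-1` W) <= Pbar J * c%:E)%E.
  rewrite (_ : restr D @^-1` W = restr (cyl A) @^-1` J `&` restr D' @^-1` G').
    rewrite (poisson_indep alpha0 PP)//; last first.
      by rewrite -subset0 => X [AX [_ nAX]].
    by rewrite AJ lee_wpmul2l// ltW.
  rewrite /W preimage_setI; congr (_ `&` _).
    rewrite -[in LHS]AJ; apply/funext => w; rewrite /preimage/= restr_sub//.
    by rewrite DL => X [? _]; split => //; exact: AL.
  by apply/funext => w; rewrite /preimage/= restr_sub// => X [].
have mE1 : measurable [set x : Om * Om * Om | E x.1.1] by exact: (measurable_preimage m1).
have mE2 : measurable [set x : Om * Om * Om | E x.1.2] by exact: (measurable_preimage m2).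
have mW3 : measurable [set x : Om * Om * Om | W x.2] by exact: (measurable_preimage m3).
apply: (@le_trans _ _ (mu ([set x | E x.1.2] `|` [set x | W x.2]))); last first.
  apply: (le_trans (measureU2 _ mE2 mW3)).
  rewrite -(dc_gibbs2 hPdc SD g1D g2D)// leeD2l//.
  by rewrite /mu [leLHS](dc_poisson hPdc SD g1D g2D mW).
rewrite -(dc_gibbs1 hPdc SD g1D g2D)//.
apply: measure_le_ae => //; first exact: measurableU.
have aeD : {ae mu, forall x, (Omega D `*` Omega D `*` Omega D) x}.
  apply: ae_of_probability1; last exact: (dc_support hPdc).
  by repeat apply: measurableX; exact: measurable_Omega.
(* The path argument requires the balls of the dominating process to have radius at most [r0];
   restricting the Poisson process to [D] only removes points. *)
have aer : {ae mu, forall x, npts (big_marks r0) x.2 = 0%E}.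
  have mN : measurable [set w : Om | npts (big_marks r0) w = 0%E].
    exact: (measurable_preimage (A := [set 0%E]) (measurable_npts (measurable_big_marks r0))).
  apply: (ae_of_probability1 (A := [set x | npts (big_marks r0) x.2 = 0%E])).
    exact: (measurable_preimage m3 mN).
  apply/eqP; rewrite eq_le probability_le1//=; last exact: (measurable_preimage m3 mN).
  rewrite (dc_poisson hPdc SD g1D g2D mN) /poisson_restr /pushforward.
  rewrite -(poisson_no_big_marks PP Qr0); apply: le_measure; rewrite ?inE//.
    by apply: measurable_preimage => //; exact: measurable_restr.
  move=> w /npts_eq0 w0; apply/npts_eq0.
  by rewrite /= setIAC w0 set0I.
apply: filterS2 (filterI aeD aer)
  (filterI (dc_subset hPdc SD g1D g2D) (dc_connected hPdc SD g1D g2D)).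
move=> x [[[D1 D2] D3] /npts_big_marks0 xr] [sub conn] E1.
have [E2|nE2] := pselect (E x.1.2); [by left|right].
have [Jx nAx] := EJ _ _ _ sub E1 nE2; split => //.
suff [X [AX dX]] : exists X, cyl A X /\ symdiff x.1.1 x.1.2 X.
  apply: CG'; rewrite /preimage/=.
  have xX : pts x.2 X by apply: sub; case: dX => -[? _]; [left|right].
  have [AX1 _] := AX.
  have := connected_to_last_exit xr _ xX AX1 (conn _ dX).
  move=> /(_ (~` L)) h; have {}h : sets_connected_by (pts x.2 `&` ~` cyl A)
      (thicken r0 A) (thicken r0 (~` L)).
    apply: h => Y [gY|gY]; split; [|exact: g1r| |exact: g2r].
      by move=> LY; apply: (g1D gY); rewrite DL.
    by move=> LY; apply: (g2D gY); rewrite DL.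
  apply: sets_connected_by_sub h => // Y [xY nAY]; split => //.
  by split => //; exact: D3.
apply: contrapT => /forallNP noX; apply: nAx; apply: config_ext => /=.
apply/seteqP; split => X [xX AX]; split => //; apply: contrapT => nX.
  by apply: (noX X); split => //; left.
by apply: (noX X); split => //; right.
Qed.

End fixed_boundary.
End coupling.

Section gibbs_states.
Context {R : realType} {d : nat}.
Local Notation S := (marked R d).
Local Notation Om := (config R d).
Implicit Types (w g : Om) (A B L : set (d.-tuple R)) (D : set S) (E J U F : set Om).

Variables (Pl : probability Om R) (H : set S -> Om -> Om -> \bar R).
Variables (alpha : R) (Q : probability (mark R) R) (Pbar : probability Om R).
Hypotheses (alpha0 : 0 < alpha) (PP : is_poisson (intensity alpha Q) Pbar).
Variables (r0 : R) (Qr0 : Q [set r | mark_val r <= r0] = 1%E).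
Variables (Pdc : set S -> Om -> Om -> probability (Om * Om * Om)%type R).
Hypothesis hPdc : disagreement_coupling H Pl Pbar Pdc.

Lemma gibbs_state_le_poisson P D U : gibbs_state H Pl P -> Sbp D -> measurable U ->
  (forall w w', U w -> pts w `<=` pts w' -> U w') ->
  (P (restr D @^-1` U) <= Pbar (restr D @^-1` U))%E.
Proof.
move=> GP SD mU Uinc; have := GP D SD U setT mU measurableT.
rewrite preimage_setT setIT => ->.
apply: (@le_trans _ _ (\int[P]_(t in setT) cst (Pbar (restr D @^-1` U)) t)%E); last first.
  rewrite integral_cst//= [X in (_ * X)%E](_ : _ = 1%E) ?mule1//.
  exact: probability_setT.
have bound g : Omega (~` D) g -> (gibbs H Pl D g U <= Pbar (restr D @^-1` U))%E.
  by move=> gD; apply: (gibbs_le_poisson hPdc SD gD gD mU mU).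
apply: ge0_le_integral => //.
- move=> t _; have [P' P'E _] := gibbs_probability hPdc SD (@Omega_restr _ _ (~` D) t).
  by rewrite P'E.
- exact: (measurable_gibbs hPdc).
- by move=> t _; apply: bound; exact: Omega_restr.
Qed.

(** Having a mark above [r0] is an increasing event of Poisson probability 0, hence null under [P]
    in each box. Typical boundary conditions thus meet the mark condition of the disagreement
    bound. *)
Lemma gibbs_state_marks P : gibbs_state H Pl P ->
  {ae P, forall w, forall X, pts w X -> mark_val X.2 <= r0}.
Proof.
move=> GP; pose U : set Om := ~` [set w | npts (big_marks r0) w = 0%E].
have mN : measurable [set w : Om | npts (big_marks r0) w = 0%E].
  exact: (measurable_preimage (A := [set 0%E]) (measurable_npts (measurable_big_marks r0))).
have mU : measurable U by exact: measurableC.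
have PU : Pbar U = 0%E.
  by rewrite probability_setC// (poisson_no_big_marks PP Qr0) subee.
have Uinc w w' : U w -> pts w `<=` pts w' -> U w'.
  move=> Uw ww' /npts_big_marks0 w'r; apply: Uw; apply/npts_big_marks0 => X wX.
  by apply: w'r; exact: ww'.
have Sbox n : Sbp (cyl (box n) : set S).
  apply: Sbp_cyl; split; [exact: measurable_box|exact: bounded_box].
have mr n := measurable_preimage (measurable_restr (Sbox n).1) mU.
have : forall n, {ae P, forall w, ~ U (restr (cyl (box n)) w)}.
  move=> n; exists (restr (cyl (box n)) @^-1` U); split => //.
    apply/eqP; rewrite -measure_le0; apply: (le_trans (gibbs_state_le_poisson GP (Sbox n) mU Uinc)).
    rewrite -PU; apply: le_measure; rewrite ?inE//.
    by move=> w /Uinc; apply=> X [].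
  by move=> w /= /contrapT.
move=> /ae_foralln; apply: filterS => w nU X wX.
have [n Xn] := box_cover X.1.
have := nU n; rewrite /U/= => /contrapT/npts_big_marks0; apply.
by split.
Qed.

(** By the DLR equations [P (E & F)] is the integral over [F] of the Gibbs probability of [E] given
    the outside. For almost every outside configuration this differs from its value at [g] by at
    most [c]. *)
Lemma gibbs_state_conditional P L g E F (c : R) : gibbs_state H Pl P ->
  bounded_borel L -> Omega (~` cyl L) g ->
  measurable E -> measurable F ->
  restr (cyl L) @^-1` E = E -> restr (~` cyl L) @^-1` F = F -> 0 <= c ->
  (forall g', Omega (~` cyl L) g' -> (forall X, pts g' X -> mark_val X.2 <= r0) ->
    (gibbs H Pl (cyl L) g' E <= gibbs H Pl (cyl L) g E + c%:E)%E /\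
    (gibbs H Pl (cyl L) g E <= gibbs H Pl (cyl L) g' E + c%:E)%E) ->
  (`|P (E `&` F) - gibbs H Pl (cyl L) g E * P F| <= c%:E * P F)%E.
Proof.
move=> GP bL gL mE mF LE LF c0 gc; have SD := Sbp_cyl bL.
set D := cyl L in SD gL LE LF gc *.
have [Pg PgE _] := gibbs_probability hPdc SD gL.
have := GP D SD E F mE mF; rewrite LE LF => PEF.
rewrite PgE// in gc *.
have gae : {ae P, forall t, F t ->
    (gibbs H Pl D (restr (~` D) t) E <= Pg E + c%:E)%E /\
    (Pg E <= gibbs H Pl D (restr (~` D) t) E + c%:E)%E}.
  apply: filterS (gibbs_state_marks GP) => t tr _; apply: gc; first exact: Omega_restr.
  by move=> X [tX _]; exact: tr.
have mg := measurable_funTS (D := F) (measurable_gibbs hPdc SD mE).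
have g0 t : (0 <= gibbs H Pl D (restr (~` D) t) E)%E.
  have [P' P'E _] := gibbs_probability hPdc SD (@Omega_restr _ _ (~` D) t).
  by rewrite P'E.
have up : (P (E `&` F) <= Pg E * P F + c%:E * P F)%E.
  rewrite PEF -ge0_muleDl// -integral_cst//.
  apply: ae_ge0_le_integral => //; first by move=> t _; rewrite adde_ge0.
  by apply: filterS gae => t h Ft; have [] := h Ft.
have lo : (Pg E * P F <= P (E `&` F) + c%:E * P F)%E.
  rewrite PEF -!integral_cst// -ge0_integralD//.
  apply: ae_ge0_le_integral => //.
  - by move=> t _; rewrite adde_ge0.
  - exact: emeasurable_funD.
  - by apply: filterS gae => t h Ft; have [] := h Ft.
move: up lo.
have : P (E `&` F) \is a fin_num by rewrite fin_num_measure//; exact: measurableI.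
have : P F \is a fin_num by rewrite fin_num_measure.
have : Pg E \is a fin_num by rewrite fin_num_measure.
move: (P (E `&` F)) (P F) (Pg E) => [x| |] [y| |] [z| |]// _ _ _.
rewrite -!EFinM -!EFinD !lee_fin => h1 h2; rewrite ler_norml; apply/andP; split; lra.
Qed.

Variables (kappa : R) (kappa0 : 0 < kappa) (K : R) (K0 : 0 < K).
Hypothesis decay : forall A B, measurable A -> measurable B -> in_unit_cube A ->
  (prob_connected Pbar A B <= K%:E * expeR (- (kappa%:E * dist_sets A B)))%E.

Lemma expeR_dist_fin A B : exists2 e : R,
  expeR (- (kappa%:E * dist_sets A B)) = e%:E & 0 <= e <= 1.
Proof.
case: (dist_sets A B) (dist_sets_ge0 A B) => [x| |]//.
- rewrite lee_fin => x0; exists (expR (- (kappa * x))) => //.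
  by rewrite expR_ge0/= -expR0 ler_expR oppr_le0 mulr_ge0// ltW.
- by move=> _; exists 0; rewrite ?lexx ?ler01// mulry gtr0_sg// mul1e.
Qed.

Lemma gibbs_state_estimates (s : R) : 0 <= s -> exists2 C0 : R, 0 < C0 &
  forall a A L E J, bounded_borel A -> bounded_borel L -> A `<=` cube s a -> A `<=` L ->
    measurable E -> measurable J ->
    restr (cyl L) @^-1` E = E -> restr (cyl A) @^-1` J = J ->
    (forall w1 w2 w3, pts w1 `|` pts w2 `<=` pts w3 -> E w1 -> ~ E w2 ->
      J w3 /\ restr (cyl A) w1 <> restr (cyl A) w2) ->
    let b := (Pbar J * (C0%:E * expeR (- (kappa%:E * dist_sets A (~` L)))))%E in
    forall P, gibbs_state H Pl P ->
    (forall g, Omega (~` cyl L) g -> (forall X, pts g X -> mark_val X.2 <= r0) ->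
      (`|gibbs H Pl (cyl L) g E - P E| <= b)%E) /\
    (forall F, measurable F -> restr (~` cyl L) @^-1` F = F ->
      (`|P (E `&` F) - P E * P F| <= 2%:E * b * P F)%E).
Proof.
move=> s0; have [C0 C00 far] := poisson_far_connected Qr0 kappa0 K0 decay s0.
exists C0 => // a A L E J [mA bA] bL Aa AL mE mJ LE AJ EJ b P GP.
have [e ee /andP[e0 e1]] := expeR_dist_fin A (~` L).
have := fun c => far a A (~` L) c Aa; rewrite /b ee => {}far.
pose pJ := fine (Pbar J).
have PJE : Pbar J = pJ%:E by rewrite fineK// fin_num_measure.
have pJ0 : 0 <= pJ by rewrite -lee_fin -PJE.
have pJ1 : pJ <= 1 by rewrite -lee_fin -PJE probability_le1.
have -> : (Pbar J * (C0%:E * e%:E) = (pJ * (C0 * e))%:E)%E by rewrite PJE.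
have SD := Sbp_cyl bL.
have cmp g1 g2 : Omega (~` cyl L) g1 -> (forall X, pts g1 X -> mark_val X.2 <= r0) ->
    Omega (~` cyl L) g2 -> (forall X, pts g2 X -> mark_val X.2 <= r0) ->
    (gibbs H Pl (cyl L) g1 E <= gibbs H Pl (cyl L) g2 E + (pJ * (C0 * e))%:E)%E.
  (* Measurable covers exist only for bounds strictly above [C0 * e], hence the vanishing [eps]. *)
  move=> g1L g1r g2L g2r; apply/lee_addgt0Pr => eps eps0.
  have [|G [mG CG PG]] := far (C0 * e + eps); first by rewrite -EFinM lte_fin ltrDl.
  have := gibbs_disagreement alpha0 PP Qr0 hPdc SD g1L g2L erefl mA AL g1r g2r mE mJ AJ EJ mG CG PG.
  move=> /le_trans; apply; rewrite -addeA leeD2l// PJE -EFinM -EFinD lee_fin mulrDr lerD2l.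
  by rewrite ler_piMl// ltW.
have b0 : 0 <= pJ * (C0 * e) by rewrite !mulr_ge0// ltW.
have cond g F : Omega (~` cyl L) g -> (forall X, pts g X -> mark_val X.2 <= r0) ->
    measurable F -> restr (~` cyl L) @^-1` F = F ->
    (`|P (E `&` F) - gibbs H Pl (cyl L) g E * P F| <= (pJ * (C0 * e))%:E * P F)%E.
  move=> gL gr mF LF; apply: gibbs_state_conditional => // g' g'L g'r.
  by split; exact: cmp.
have one g : Omega (~` cyl L) g -> (forall X, pts g X -> mark_val X.2 <= r0) ->
    (`|gibbs H Pl (cyl L) g E - P E| <= (pJ * (C0 * e))%:E)%E.
  (* [F = setT] turns the conditional estimate into a comparison of the Gibbs measure with [P]. *)
  move=> gL gr; have := cond g setT gL gr measurableT.
  rewrite preimage_setT setIT probability_setT !mule1 => /(_ erefl).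
  have [Pg -> // _] := gibbs_probability hPdc SD gL.
  by rewrite -[in X in _ -> X]abseN fin_num_oppeB ?fin_num_measure// addeC.
split => // F mF LF.
(* The empty boundary condition serves as intermediary: both [P (E & F)] and [P E * P F] are close
   to its Gibbs probability of [E] times [P F], whence the factor 2. *)
have g0L : Omega (~` cyl L) (config0 R d) by [].
have g0r X : pts (config0 R d) X -> mark_val X.2 <= r0 by [].
have := cond _ _ g0L g0r mF LF; have := one _ g0L g0r.
have [Pg -> // _] := gibbs_probability hPdc SD g0L.
have : P (E `&` F) \is a fin_num by rewrite fin_num_measure//; exact: measurableI.
have : P F \is a fin_num by rewrite fin_num_measure.
have : Pg E \is a fin_num by rewrite fin_num_measure.
have : P E \is a fin_num by rewrite fin_num_measure.
have : (0 <= P F)%E by exact: measure_ge0.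
move: (P (E `&` F)) (P F) (Pg E) (P E) => [x| |] [y| |] [z| |] [u| |]// y0 _ _ _ _.
rewrite lee_fin in y0; rewrite -?EFinM -?EFinD !lee_fin !ler_norml.
move: (pJ * (C0 * e)) => c /andP[h1 h2] /andP[h3 h4].
have := ler_wpM2r y0 h1; have := ler_wpM2r y0 h2.
by move=> ? ?; apply/andP; split; lra.
Qed.

End gibbs_states.

(** * Decay of correlations and uniqueness *)

Section local_events.
Context {R : realType} {d : nat}.
Local Notation S := (marked R d).
Local Notation Om := (config R d).
Implicit Types (w : Om) (A B L : set (d.-tuple R)) (D : set S) (E F : set Om).

Lemma restr_invariant_sub D D' E : D `<=` D' -> restr D @^-1` E = E ->
  restr D' @^-1` E = E.
Proof.
move=> DD' <-; apply/funext => w; by rewrite /preimage/= restr_sub.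
Qed.

Lemma restr_invariantP D E : restr D @^-1` E = E ->
  forall w w', restr D w = restr D w' -> E w -> E w'.
Proof.
by move=> DE w w' ww'; rewrite -DE /preimage/= ww'.
Qed.

(** The events with these two properties form a sigma-algebra containing the generators. Locality is
    used below only through this invariance. *)
Lemma F_restr D E : measurable D -> F_ D E ->
  measurable E /\ restr D @^-1` E = E.
Proof.
move=> mD; suff : F_ D `<=` [set E | measurable E /\ restr D @^-1` E = E] by exact.
apply: smallest_sub; last first.
  move=> _ [E' mE' <-]; split.
    exact: (measurable_preimage (measurable_restr mD)).
  by apply/funext => w; rewrite /preimage/= restr_restr setIid.
split.
- by split => //; exact: measurable0.
- move=> E' [mE' DE']; rewrite setTD; split; first exact: measurableC.
  by rewrite -[in RHS]DE'.
- move=> F mF; split.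
    by apply: bigcupT_measurable => i; have [] := mF i.
  by rewrite preimage_bigcup; apply: eq_bigcupr => i _; have [] := mF i.
Qed.

Lemma restr_cyl_set0 E : restr (cyl set0) @^-1` E = E -> E = set0 \/ E = setT.
Proof.
move=> EE; have h w : E w <-> E (config0 R d).
  rewrite -[in E w]EE /preimage/= (_ : restr _ w = config0 R d)//.
  by apply: config_ext; rewrite /= /cyl set0X setI0.
have [E0|nE0] := pselect (E (config0 R d)).
  by right; apply/seteqP; split => // w _; exact/h.
by left; rewrite -subset0 => w /h.
Qed.

Lemma card_pts_restr D D' w : D' `<=` D -> card_pts D' (restr D w) = card_pts D' w.
Proof. by move=> DD'; rewrite /card_pts /= -setIA (setIidr DD'). Qed.

Lemma coord_le_eucl_norm (p q : d.-tuple R) i : `|tnth q i| <= `|tnth p i| + eucl p q.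
Proof.
rewrite -lerBlDl (le_trans _ (coord_le_eucl p q i))// distrC.
exact: lerB_dist.
Qed.

Lemma dist_sets_box m n : (m <= n)%N ->
  ((n - m)%N%:R%:E <= dist_sets (box m) (~` box n : set (d.-tuple R)))%E.
Proof.
move=> mn; apply: le_ereal_inf_tmp => _ [[p q] [pm qn] <-].
rewrite /fst /snd in pm qn *.
have [i qi] : exists i, n%:R < `|tnth q i|.
  apply: contrapT => /forallNP h; apply: qn => i.
  by rewrite leNgt; apply/negP; exact: h.
rewrite lee_fin natrB// lerBlDl (le_trans (ltW qi))//.
by rewrite (le_trans (coord_le_eucl_norm p q i))// lerD2r.
Qed.

(** An event on [B] becomes part of the boundary condition once [B] lies outside the region. A box
    minus [B] works if the box is so large that its complement is no closer to [A] than [B] is. *)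
Lemma separating_region A B : bounded_borel A -> bounded_borel B -> A `&` B = set0 ->
  B !=set0 -> exists L, [/\ bounded_borel L, A `<=` L, B `<=` ~` L &
    (dist_sets A B <= dist_sets A (~` L))%E].
Proof.
move=> [mA bA] [mB bB] AB [y By].
have [m Am] := bounded_sub_box bA.
(* A margin of [k] suffices: points outside the box are at distance at least [k] from [A], while [y]
   is within [k] of some point of [A]. The conditional form allows [A] to be empty. *)
have [k Ak] : exists k : nat, forall x, A x -> exists2 x', A x' & eucl x' y <= k%:R.
  have [->|/set0P[x Ax]] := eqVneq A set0; first by exists 0%N.
  exists (Num.truncn (eucl x y)).+1 => _ _; exists x => //.
  exact/ltW/truncnS_gt.
exists (box (m + k) `\` B); split.
- split; first by apply: measurableD => //; exact: measurable_box.
  by apply: bounded_pts_sub (bounded_box (m + k)) => x [].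
- move=> x Ax; split; last by move=> Bx; rewrite -[False]/(set0 x) -AB.
  exact: (box_nd (leq_addr _ _)) (Am _ Ax).
- by move=> x Bx [].
rewrite -[leRHS]adde0; apply: dist_sets_le_shift => p q Ap nLq.
have [Bq|nBq] := pselect (B q); first by exists p, q; rewrite addr0.
have nq : ~ box (m + k) q by move=> qb; apply: nLq.
have [x Ax xk] := Ak _ Ap; exists x, y; split => //.
rewrite addr0 (le_trans xk)//.
have := dist_sets_box (leq_addr k m); rewrite addKn.
by move=> /le_trans/(_ (dist_sets_le (Am _ Ap) nq)); rewrite lee_fin.
Qed.

End local_events.

Section decay_of_correlations.
Context {R : realType} {d : nat}.
Local Notation S := (marked R d).
Local Notation Om := (config R d).
Implicit Types (w g : Om) (A B L : set (d.-tuple R)) (D : set S) (E J U F : set Om).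

Variables (Pl : probability Om R) (H : set S -> Om -> Om -> \bar R).
Variables (alpha : R) (Q : probability (mark R) R) (Pbar : probability Om R).
Hypotheses (alpha0 : 0 < alpha) (PP : is_poisson (intensity alpha Q) Pbar).
Variables (r0 : R) (Qr0 : Q [set r | mark_val r <= r0] = 1%E).
Variables (Pdc : set S -> Om -> Om -> probability (Om * Om * Om)%type R).
Hypothesis hPdc : disagreement_coupling H Pl Pbar Pdc.
Variables (kappa : R) (kappa0 : 0 < kappa) (K : R) (K0 : 0 < K).
Hypothesis decay : forall A B, measurable A -> measurable B -> in_unit_cube A ->
  (prob_connected Pbar A B <= K%:E * expeR (- (kappa%:E * dist_sets A B)))%E.

Lemma local_event_estimates (s : R) : 0 <= s -> exists2 C0 : R, 0 < C0 &
  forall a A L E, bounded_borel A -> bounded_borel L -> A `<=` cube s a -> A `<=` L ->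
    measurable E -> restr (cyl A) @^-1` E = E ->
    forall P, gibbs_state H Pl P ->
    (forall g, Omega (~` cyl L) g -> (forall X, pts g X -> mark_val X.2 <= r0) ->
      (`|gibbs H Pl (cyl L) g E - P E| <=
       C0%:E * expeR (- (kappa%:E * dist_sets A (~` L))))%E) /\
    (forall F, measurable F -> restr (~` cyl L) @^-1` F = F ->
      (`|P (E `&` F) - P E * P F| <=
       (2 * C0)%:E * expeR (- (kappa%:E * dist_sets A (~` L))))%E).
Proof.
move=> s0; have [C0 C00 est] :=
  gibbs_state_estimates alpha0 PP Qr0 hPdc kappa0 K0 decay s0.
exists C0 => // a A L E bA bL Aa AL mE AE P GP.
have cAL : cyl A `<=` cyl L by move=> X [? _]; split => //; exact: AL.
have EJ w1 w2 w3 : pts w1 `|` pts w2 `<=` pts w3 -> E w1 -> ~ E w2 ->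
    [set: Om] w3 /\ restr (cyl A) w1 <> restr (cyl A) w2.
  by move=> _ E1 E2; split => // w12; apply: E2; exact: restr_invariantP w12 E1.
have [e1 e2] := est a A L E setT bA bL Aa AL mE measurableT
  (restr_invariant_sub cAL AE) (preimage_setT _) EJ P GP.
have PT : Pbar [set: Om] = 1%E by exact: probability_setT.
rewrite PT !mul1e in e1 e2; split => // F mF LF.
apply: (le_trans (e2 F mF LF)); rewrite EFinM -[in leRHS]muleA -[leRHS]mule1.
apply: lee_wpmul2l; last exact: probability_le1.
by rewrite !mule_ge0 ?expeR_ge0// lee_fin ltW.
Qed.

Lemma gibbs_state_mixing : exists2 C1 : R, 0 < C1 &
  forall P, gibbs_state H Pl P -> forall A B E F,
    bounded_borel A -> bounded_borel B -> in_unit_cube A ->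
    F_ (cyl A) E -> F_ (cyl B) F ->
    (`|P (E `&` F) - P E * P F| <=
      C1%:E * expeR (- (kappa%:E * dist_sets A B)))%E.
Proof.
have [C0 C00 est] := local_event_estimates ler01.
(* The extra 1 is the trivial bound when [A] meets [B], where the distance is 0. *)
exists (2 * C0 + 1) => [|P GP A B E F bA bB [a Aa] FE FF]; first by rewrite addr_gt0// mulr_gt0.
have [mE AE] := F_restr (measurable_cyl bA.1) FE.
have [mF BF] := F_restr (measurable_cyl bB.1) FF.
have C10 : (0 <= (2 * C0 + 1)%:E :> \bar R)%E by rewrite lee_fin addr_ge0// mulr_ge0// ltW.
have r0' : (0 <= (2 * C0 + 1)%:E * expeR (- (kappa%:E * dist_sets A B)))%E.
  by rewrite mule_ge0// expeR_ge0.
have PE : P E \is a fin_num by rewrite fin_num_measure.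
(* For empty [B] the distance is infinite and the bound is 0; events on [B] are then trivial, so the
   covariance vanishes. *)
have [B0|B0] := pselect (B = set0).
  rewrite B0 in BF; have [->|->] := restr_cyl_set0 BF.
    by rewrite setI0 measure0 mule0 sube0 abse0.
  by rewrite setIT probability_setT mule1 subee// abse0.
have {}B0 : B !=set0 by apply/set0P/eqP.
have [AB|AB] := pselect (A `&` B = set0); last first.
  have [x [Ax Bx]] : A `&` B !=set0 by apply/set0P/eqP.
  have d0 : dist_sets A B = 0%E.
    by apply/eqP; rewrite eq_le dist_sets_ge0 andbT (le_trans (dist_sets_le Ax Bx))// eucl_xx.
  rewrite d0 mule0 oppe0/= expR0 mule1.
  apply: (@le_trans _ _ 1%E); last by rewrite lee_fin lerDr mulr_ge0// ltW.
  have : P (E `&` F) \is a fin_num by rewrite fin_num_measure//; exact: measurableI.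
  have : P F \is a fin_num by rewrite fin_num_measure.
  move: PE; have : (0 <= P (E `&` F))%E by exact: measure_ge0.
  have : (0 <= P F)%E by exact: measure_ge0.
  have : (0 <= P E)%E by exact: measure_ge0.
  have : (P (E `&` F) <= 1)%E by apply: probability_le1; exact: measurableI.
  have : (P F <= 1)%E by exact: probability_le1.
  have : (P E <= 1)%E by exact: probability_le1.
  move: (P (E `&` F)) (P F) (P E) => [x'| |] [y| |] [z| |]//.
  rewrite !lee_fin => z1 y1 x1 z0 y0 x0 _ _ _.
  have zy0 := mulr_ge0 z0 y0; have zy1 := mulr_ile1 z0 y0 z1 y1.
  by rewrite ler_norml; apply/andP; split; lra.
have [L [bL AL BL dL]] := separating_region bA bB AB B0.
have cBL : cyl B `<=` ~` cyl L by move=> X [/BL nL _] [].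
have [_ /(_ F mF (restr_invariant_sub cBL BF))] := est a A L E bA bL Aa AL mE AE P GP.
move=> /le_trans; apply; apply: (@le_trans _ _
  ((2 * C0)%:E * expeR (- (kappa%:E * dist_sets A B)))%E).
  apply: lee_wpmul2l; first by rewrite lee_fin mulr_ge0// ltW.
  have := expeR_dist_le kappa0 (dist_sets_ge0 A B) (_ : (_ <= dist_sets A (~` L) + 0%:E)%E).
  by rewrite mulr0 expR0 mul1e adde0; apply.
apply: lee_wpmul2r; first exact: expeR_ge0.
by rewrite lee_fin lerDl.
Qed.

(** On a count cylinder, which depends on a box, both states are compared with the same Gibbs
    measure: the one in a larger box with empty boundary condition. The error vanishes as that box
    grows. *)
Lemma gibbs_state_unique P P' : gibbs_state H Pl P -> gibbs_state H Pl P' ->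
  forall E, measurable E -> P' E = P E.
Proof.
move=> GP GP' E mE.
apply: (@measure_unique _ _ _ (@count_cylinders R d) (fun=> setT)
  (@generated_count_cylinders R d) (@count_cylinders_setI R d)
  (fun=> @count_cylinders_setT R d) _ P' P) => //; last first.
- by move=> _; rewrite (le_lt_trans (probability_le1 _ _))// ltry.
- move=> _ [n [A [k [mA bA ->]]]].
  set C := count_cyl n A k.
  have mC : measurable C by exact: measurable_count_cyl.
  have [N AN] : exists N, forall i, (i < n)%N -> A i `<=` cyl (box N).
    have [f Af] := choice bA.
    exists (\max_(i < n) f i) => i ni X /Af[AX _]; split => //.
    exact: (box_nd (leq_bigmax (Ordinal ni))).
  have NC : restr (cyl (box N)) @^-1` C = C.
    apply/seteqP; split => w h i ni; have := h i ni.
      by rewrite card_pts_restr//; exact: AN.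
    by rewrite card_pts_restr//; exact: AN.
  have bbox m : bounded_borel (box m : set (d.-tuple R)).
    by split; [exact: measurable_box|exact: bounded_box].
  have N0 : 0 <= 2 * N%:R :> R by rewrite mulr_ge0.
  have [C0 C00 est] := local_event_estimates N0.
  have boxN : box N `<=` cube (2 * N%:R) [tuple - N%:R : R | i < d].
    move=> x xN i; have := xN i; rewrite tnth_mktuple ler_norml => /andP[? ?].
    by apply/andP; split; lra.
  have close P'' m : gibbs_state H Pl P'' ->
     (`|gibbs H Pl (cyl (box (N + m))) (config0 R d) C - P'' C| <=
       (C0 * expR (- (kappa * m%:R)))%:E)%E.
    move=> GP''.
    have [/(_ (config0 R d)) h _] := est _ _ _ _ (bbox N) (bbox (N + m)%N) boxN
      (box_nd (leq_addr _ _)) mC NC P'' GP''.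
    apply: (le_trans (h _ _)) => //; rewrite EFinM.
    apply: lee_wpmul2l; first by rewrite lee_fin ltW.
    have md : (m%:R%:E <= dist_sets (box N) (~` box (N + m) : set (d.-tuple R)) + 0%:E)%E.
      by rewrite adde0; have := dist_sets_box (leq_addr m N); rewrite addKn.
    have := expeR_dist_le kappa0 _ md; rewrite mulr0 expR0 mul1e; apply.
    by rewrite lee_fin.
  have PC : P C \is a fin_num by rewrite fin_num_measure.
  have PC' : P' C \is a fin_num by rewrite fin_num_measure.
  rewrite -[LHS](fineK PC') -[RHS](fineK PC); congr EFin; apply/eqP; rewrite -subr_eq0 -normr_eq0.
  apply/eqP/le_anti/andP; split; last exact: normr_ge0.
  apply/ler_addgt0Pr => e e0; rewrite add0r.
  (* By [expR x >= 1 + x] this [m] makes [2 * C0 * expR (- (kappa * m))] at most [e]; the 2 accounts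
     for the two states. *)
  pose m := (Num.truncn (2 * C0 / (kappa * e))).+1.
  have me : 2 * C0 * expR (- (kappa * m%:R)) <= e.
    rewrite expRN ler_pdivrMr ?expR_gt0//.
    have km : 2 * C0 < kappa * e * m%:R.
      by rewrite [ltRHS]mulrC -ltr_pdivrMr ?mulr_gt0//; exact: truncnS_gt.
    have := expR_ge1Dx (kappa * m%:R); nra.
  apply: le_trans me.
  have SD := Sbp_cyl (bbox (N + m)%N).
  have := close P m GP; have := close P' m GP'.
  have g0L : Omega (~` cyl (box (N + m))) (config0 R d) by [].
  have [Pg -> // _] := gibbs_probability hPdc SD g0L.
  have : Pg C \is a fin_num by rewrite fin_num_measure.
  move: PC PC'; move: (P C) (P' C) (Pg C) => [x| |] [y| |] [z| |]// _ _ _.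
  rewrite /= !lee_fin !ler_norml => /andP[? ?] /andP[? ?].
  by apply/andP; split; lra.
- by rewrite bigcup_const.
Qed.

End decay_of_correlations.

(** * Comparison of measures on pairs of points *)

Section algebra_approximation.
Context d (T : measurableType d) (R : realType).
Local Open Scope ereal_scope.
Implicit Types (A B C U : set T).

Let sd A B := (A `\` B) `|` (B `\` A).

Let sdC A B : sd (~` A) (~` B) = sd A B.
Proof. by rewrite /sd !setDE !setCK [~` A `&` _]setIC [~` B `&` _]setIC setUC. Qed.

Let sd_measurable A B : measurable A -> measurable B -> measurable (sd A B).
Proof. by move=> mA mB; apply: measurableU; exact: measurableD. Qed.

Variable G : set (set T).
Hypotheses (genG : @measurable _ T = <<s G >>) (GT : G setT)
  (GC : forall A, G A -> G (~` A)) (GI : setI_closed G).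

Let mG A : G A -> measurable A.
Proof. by move=> GA; rewrite genG; exact: sub_sigma_algebra. Qed.

(** For a finite measure, the sets approximable in symmetric difference by sets of the algebra form
    a sigma-algebra. *)
Lemma algebra_approximation (m : {measure set T -> \bar R}) : m setT < +oo ->
  forall A, measurable A -> forall e : R, (0 < e)%R ->
  exists U, G U /\ m (sd A U) < e%:E.
Proof.
move=> mT.
have fin A : measurable A -> m A \is a fin_num.
  by move=> mA; rewrite ge0_fin_numE// (le_lt_trans _ mT)// le_measure ?inE.
suff : <<s G >> `<=` [set A | measurable A /\ forall e : R, (0 < e)%R ->
    exists U, G U /\ m (sd A U) < e%:E].
  by move=> h A; rewrite genG => /h[].
have G0 : G set0 by rewrite -setCT; exact: GC.
have GU A B : G A -> G B -> G (A `|` B).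
  by move=> GA GB; rewrite -[_ `|` _]setCK setCU; apply: GC; apply: GI; exact: GC.
apply: smallest_sub; last first.
  move=> A GA; split; first exact: mG.
  by move=> e e0; exists A; rewrite /sd setDv setU0 measure0 lte_fin.
split.
- split; first exact: measurable0.
  by move=> e e0; exists set0; rewrite /sd setDv setU0 measure0 lte_fin.
- move=> A [mA hA]; rewrite setTD; split; first exact: measurableC.
  move=> e /hA[U [GAU Ue]]; exists (~` U); split; first exact: GC.
  by rewrite sdC.
move=> F hF; have mF n : measurable (F n) by have [] := hF n.
have mUF : measurable (\bigcup_n F n) by exact: bigcupT_measurable.
split => // e e0.
pose V n := \big[setU/set0]_(i < n) F i.
have mV n : measurable (V n) by exact: bigsetU_measurable.
(* Half of [e] pays for truncating the union to its first [n] sets, by continuity from below. *)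
have [n Vn] : exists n, m (\bigcup_n F n) - (e / 2)%:E < m (V n).
  apply: contrapT => /forallNP noV.
  have cvgV : m \o V @ \oo --> m (\bigcup_n V n).
    apply: nondecreasing_cvg_mu => //; first exact: bigcupT_measurable.
    by move=> p q pq; apply/subsetPset; exact: subset_bigsetU.
  have : m (\bigcup_n F n) <= m (\bigcup_n F n) - (e / 2)%:E.
    rewrite {1}(_ : \bigcup_n F n = \bigcup_n V n); last first.
      apply/seteqP; split => x [i _ Fx].
        by exists i.+1 => //; rewrite /V -bigcup_mkord; exists i => /=.
      by move: Fx; rewrite /V -bigcup_mkord => -[j _ Fjx]; exists j.
    rewrite -(cvg_lim _ cvgV)//; apply: lime_le; first by apply/cvg_ex; eexists; exact: cvgV.
    by apply: nearW => n /=; rewrite leNgt; apply/negP; exact: noV.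
  move: (fin _ mUF); case: (m _) => [x| |]// _.
  by rewrite -EFinB lee_fin; apply/negP; rewrite -ltNge; lra.
(* The other half is shared by the [n] remaining sets. Dividing by [n.+1] avoids a division by zero
   when [n = 0]. *)
have [U hU] := choice (fun i => (hF i).2 (e / 2 / n.+1%:R)%R (divr_gt0 (divr_gt0 e0 (ltr0Sn _ 1)) (ltr0Sn _ _))).
pose W := \big[setU/set0]_(i < n) U i.
have GW k : G (\big[setU/set0]_(i < k) U i).
  elim: k => [|k IH]; first by rewrite big_ord0.
  by rewrite big_ord_recr/=; apply: GU => //; have [] := hU k.
exists W; split; first exact: GW.
have mU i : measurable (U i) by apply: mG; have [] := hU i.
have mW : measurable W by apply: mG; exact: GW.
have sdE : \big[setU/set0]_(i < n) sd (F i) (U i) = \bigcup_(i < n) sd (F i) (U i).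
  by rewrite -(bigcup_mkord n (fun i => sd (F i) (U i))).
have sub : sd (\bigcup_n F n) W `<=` ((\bigcup_n F n) `\` V n) `|`
    \big[setU/set0]_(i < n) sd (F i) (U i).
  move=> x [[Fx nWx]|[Wx nFx]].
    have [Vx|nVx] := pselect (V n x); [right|by left].
    move: Vx; rewrite sdE /V -bigcup_mkord => -[i ni Fix]; exists i => //; left; split => //.
    by move=> Uix; apply: nWx; rewrite /W -bigcup_mkord; exists i.
  right; move: Wx; rewrite sdE /W -bigcup_mkord => -[i ni Uix]; exists i => //; right; split => //.
  by move=> Fix; apply: nFx; exists i.
have mS : measurable (\big[setU/set0]_(i < n) sd (F i) (U i)).
  by apply: bigsetU_measurable => i _; exact: sd_measurable.
have mFV : measurable ((\bigcup_n F n) `\` V n) by exact: measurableD.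
apply: (@le_lt_trans _ _ (m ((\bigcup_n F n) `\` V n) +
    m (\big[setU/set0]_(i < n) sd (F i) (U i)))).
  apply: le_trans (measureU2 _ mFV mS).
  by apply: le_measure; rewrite ?inE//; [exact: sd_measurable|exact: measurableU].
rewrite [e in _ < e%:E](splitr e) EFinD; apply: lte_leD.
- by rewrite ge0_fin_numE// (le_lt_trans _ mT)// le_measure ?inE.
- rewrite measureD//; last by rewrite -ge0_fin_numE// fin.
  rewrite setIidr; last by rewrite /V -bigcup_mkord => x [i _ ?]; exists i.
  by rewrite lteBlDr ?fin// addeC -lteBlDr.
apply: (@le_trans _ _ (\sum_(i < n) m (sd (F i) (U i)))).
  by apply: (@content_subadditive _ _ _ m _ (fun i => sd (F i) (U i)) n) => // i _; exact: sd_measurable.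
apply: (@le_trans _ _ (\sum_(i < n) (e / 2 / n.+1%:R)%:E)).
  by apply: lee_sum => i _; apply: ltW; have [] := hU i.
rewrite sumEFin lee_fin sumr_const card_ord -[leLHS]mulr_natr -[leRHS]mulr1.
rewrite -[leLHS]mulrA ler_wpM2l//; first by rewrite divr_ge0// ltW.
by rewrite mulrC ler_pdivrMr// mul1r ler_nat.
Qed.

(** Sets satisfying an inequality of measures are not closed under complement, so agreement on a
    pi-system has no analogue here. Approximating [A] in [mu + nu] by a set of the algebra controls
    both measures at once. *)
Lemma measure_le_algebra (mu nu : {measure set T -> \bar R}) :
  mu setT < +oo -> nu setT < +oo -> (forall A, G A -> mu A <= nu A) ->
  forall A, measurable A -> mu A <= nu A.
Proof.
move=> muT nuT GE A mA; apply/lee_addgt0Pr => e e0.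
pose m : {measure set T -> \bar R} := measure_add mu nu.
have mE B : m B = mu B + nu B by rewrite /m; exact: measure_addE.
have [||U [GAU]] := @algebra_approximation m _ A mA (e / 2)%R.
- by rewrite mE lte_add_pinfty.
- by rewrite divr_gt0.
have mU := mG GAU; have mAU := sd_measurable mA mU.
rewrite mE => he.
have AU : mu A <= mu U + mu (sd A U).
  apply: le_trans (measureU2 _ mU mAU); apply: le_measure; rewrite ?inE//.
    exact: measurableU.
  by move=> x Ax; have [?|?] := pselect (U x); [left|right; left].
have UA : nu U <= nu A + nu (sd A U).
  apply: le_trans (measureU2 _ mA mAU); apply: le_measure; rewrite ?inE//.
    exact: measurableU.
  by move=> x Ux; have [?|?] := pselect (A x); [left|right; right].
apply: (le_trans AU); apply: (@le_trans _ _ (nu A + nu (sd A U) + mu (sd A U))).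
  by rewrite leeD2r// (le_trans (GE _ GAU)).
rewrite -addeA leeD2l// addeC (le_trans (ltW he))// lee_fin; lra.
Qed.

End algebra_approximation.

Section measure_le_partition.
Context d (T : measurableType d) (R : realType).
Local Open Scope ereal_scope.

Lemma measure_partition (mu : {measure set T -> \bar R}) (I : countType) (g : T -> I) :
  (forall i, measurable (g @^-1` [set i])) -> forall C, measurable C ->
  mu C = \sum_(j <oo) mu (C `&` [set x | choice.pickle (g x) = j]).
Proof.
move=> mg C mC.
have mj j : measurable [set x | choice.pickle (g x) = j].
  have [[i ij]|nj] := pselect (exists i : I, choice.pickle i = j).
    rewrite (_ : [set _ | _] = g @^-1` [set i])//; apply/seteqP; split => x /=.
      by rewrite -ij => /(pcan_inj choice.pickleK).
    by move=> ->.
  rewrite (_ : [set _ | _] = set0); first exact: measurable0.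
  by rewrite -subset0 => x /= xj; apply: nj; exists (g x).
rewrite -measure_semi_bigcup.
- congr (mu _); apply/seteqP; split => x; last by case=> j _ [].
  by move=> Cx; exists (choice.pickle (g x)).
- by move=> j; exact: measurableI.
- by apply/trivIsetP => i j _ _ /eqP ij; rewrite -subset0 => x [[_ /= xi] [_ /= xj]]; apply: ij; rewrite -xi.
- by apply: bigcupT_measurable => j; exact: measurableI.
Qed.

Lemma measure_le_partition (mu nu : {measure set T -> \bar R}) (I : countType) (g : T -> I) :
  (forall i, measurable (g @^-1` [set i])) -> forall C, measurable C ->
  (forall i, mu (C `&` g @^-1` [set i]) <= nu (C `&` g @^-1` [set i])) ->
  mu C <= nu C.
Proof.
move=> mg C mC le; rewrite (measure_partition mu mg mC) (measure_partition nu mg mC).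
apply: lee_nneseries => // j _.
have [[i ij]|nj] := pselect (exists i : I, choice.pickle i = j).
  rewrite (_ : [set _ | _] = g @^-1` [set i])//; apply/seteqP; split => x /=.
    by rewrite -ij => /(pcan_inj choice.pickleK).
  by move=> ->.
rewrite (_ : [set _ | _] = set0) ?setI0 ?measure0//.
by rewrite -subset0 => x /= xj; apply: nj; exists (g x).
Qed.

End measure_le_partition.

Section cell_pairs.
Context {R : realType} {d : nat}.
Local Notation T := (d.-tuple R).
Local Notation I := (d.-tuple int).
Local Open Scope ereal_scope.

Definition cell2 n (p : T * T) : I * I := (cell n p.1, cell n p.2).

Lemma measurable_cell2 n (S : set (I * I)) : measurable (cell2 n @^-1` S).
Proof.
rewrite (_ : _ @^-1` _ = \bigcup_(k in S) ((cell n @^-1` [set k.1]) `*` (cell n @^-1` [set k.2]))).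
  rewrite bigcup_mkcond; apply: countable_bigcupT_measurable; first exact: countableP.
  by move=> k; case: ifP => // _; apply: measurableX; exact: measurable_cell.
apply/seteqP; split => [p Sp|p [[k l] Skl [/= pk pl]]]; first by exists (cell2 n p).
by rewrite /preimage/= /cell2 pk pl.
Qed.

Lemma cell2_coarser m n p q : (m <= n)%N -> cell2 n p = cell2 n q -> cell2 m p = cell2 m q.
Proof.
move=> mn e; have e1 := congr1 fst e; have e2 := congr1 snd e; rewrite /= in e1 e2.
by rewrite /cell2 (cell_coarser mn e1) (cell_coarser mn e2).
Qed.

(** An algebra, because two levels have a common refinement. Levels below [m] are excluded so that
    every cell pair involved lies inside a single pair of level [m]. *)
Definition cell_sets m : set (set (T * T)) :=
  [set U | exists n S, (m <= n)%N /\ U = cell2 n @^-1` S].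

Lemma cell_setsT m : cell_sets m setT.
Proof. by exists m, setT. Qed.

Lemma cell_setsC m U : cell_sets m U -> cell_sets m (~` U).
Proof. by move=> [n [S [mn ->]]]; exists n, (~` S). Qed.

Lemma cell2_refine n n' (S : set (I * I)) : (n <= n')%N ->
  exists S', cell2 n @^-1` S = cell2 n' @^-1` S'.
Proof.
move=> nn'; exists [set k | exists2 p, S (cell2 n p) & cell2 n' p = k].
apply/seteqP; split => p /=; first by exists p.
by move=> [q Sq /(cell2_coarser nn') <-].
Qed.

Lemma cell_setsI m : setI_closed (cell_sets m).
Proof.
move=> _ _ [n [S [mn ->]]] [n' [S' [mn' ->]]].
have [V ->] := cell2_refine S (leq_maxl n n').
have [V' ->] := cell2_refine S' (leq_maxr n n').
by exists (maxn n n'), (V `&` V'); split => //; rewrite leq_max mn.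
Qed.

Lemma floor_cvg (x : R) : ((Num.floor (2 ^+ n * x))%:~R / 2 ^+ n)%R @[n --> \oo] --> x.
Proof.
apply/cvgrPdist_le => e e0; near=> n.
have n0 : (0 < 2 ^+ n :> R)%R by rewrite exprn_gt0.
have /andP[h1 h2] := @floor_itv R (2 ^+ n * x)%R.
rewrite intrD in h2.
have en : (e^-1 <= 2 ^+ n)%R.
  near: n; exists (Num.truncn e^-1).+1 => // n /= en.
  rewrite (le_trans (ltW (truncnS_gt _)))// -natrX ler_nat.
  by rewrite (leq_trans en)// ltnW// ltn_expl.
rewrite -[x in (x - _)%R](mulKf (lt0r_neq0 n0)) [X in (_ - X)%R]mulrC -mulrBr.
rewrite normrM gtr0_norm ?invr_gt0// ger0_norm; last by rewrite subr_ge0.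
apply: (@le_trans _ _ ((2 ^+ n)^-1 * 1)%R); first by rewrite ler_pM2l ?invr_gt0//; lra.
by rewrite mulr1 invf_ple ?posrE.
Unshelve. all: by end_near. Qed.

(** Each coordinate is the limit of its dyadic roundings, which are functions of cell indices. The
    levels are shifted by [m] to remain admissible. *)
Lemma generated_cell_sets m : @measurable _ (T * T)%type = <<s cell_sets m >>.
Proof.
apply/seteqP; split; last first.
  apply: smallest_sub; first exact: sigma_algebra_measurable.
  by move=> _ [n [S [_ ->]]]; exact: measurable_cell2.
pose T2 := g_sigma_algebraType (cell_sets m).
have mcoord (c : I * I -> int) n : (m <= n)%N -> measurable_fun setT
    (fun p : T2 => ((c (cell2 n p))%:~R / 2 ^+ n)%R : R).
  move=> mn _ Y _; rewrite setTI; apply: sub_sigma_algebra.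
  by exists n, [set k | Y ((c k)%:~R / 2 ^+ n)%R].
have mfst : measurable_fun [set: T2] (fst : T2 -> T).
  apply/measurable_fun_tnthP => i.
  apply: (@measurable_fun_cvg _ T2 R setT (fun n p =>
      ((Num.floor (2 ^+ (n + m) * tnth p.1 i))%:~R / 2 ^+ (n + m))%R)).

    move=> n; have := mcoord (fun k => tnth k.1 i) (n + m)%N (leq_addl _ _).
    by rewrite /cell2/=; under eq_fun do rewrite tnth_cell.
  by move=> p _; have := @floor_cvg (tnth p.1 i); rewrite -(cvg_shiftn m).
have msnd : measurable_fun [set: T2] (snd : T2 -> T).
  apply/measurable_fun_tnthP => i.
  apply: (@measurable_fun_cvg _ T2 R setT (fun n p =>
      ((Num.floor (2 ^+ (n + m) * tnth p.2 i))%:~R / 2 ^+ (n + m))%R)).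

    move=> n; have := mcoord (fun k => tnth k.2 i) (n + m)%N (leq_addl _ _).
    by rewrite /cell2/=; under eq_fun do rewrite tnth_cell.
  by move=> p _; have := @floor_cvg (tnth p.2 i); rewrite -(cvg_shiftn m).
have mid : measurable_fun [set: T2] (id : T2 -> T * T).
  by apply/measurable_fun_pairP.
by move=> A mA; have := mid measurableT A mA; rewrite setTI.
Qed.

(* Two measures compared on the pairs of distinct dyadic cells are compared off
   the diagonal, which is exhausted by finer and finer such pairs. *)
Lemma measure_le_offdiag (mu nu : {measure set (T * T) -> \bar R}) :
  (forall n k l, k != l -> mu (cell2 n @^-1` [set (k, l)]) <= nu (cell2 n @^-1` [set (k, l)])) ->
  (forall n k l, k != l -> nu (cell2 n @^-1` [set (k, l)]) < +oo) ->
  forall C, measurable C -> C `<=` [set p | p.1 != p.2] -> mu C <= nu C.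
Proof.
move=> le fin C mC offC.
(* Inside a pair of distinct cells every finer pair is again distinct, so the hypothesis applies to
   all of them; restricting to the block also makes both measures finite. *)
have block m k l : k != l -> forall D, measurable D -> D `<=` cell2 m @^-1` [set (k, l)] ->
    mu D <= nu D.
  move=> kl D mD DB; set B := _ @^-1` _ in DB.
  have mB : measurable B by exact: measurable_cell2.
  suff : mrestr mu mB D <= mrestr nu mB D by rewrite /mrestr setIidl.
  apply: (measure_le_algebra (generated_cell_sets m) (cell_setsT m)
    (@cell_setsC m) (@cell_setsI m)) => //.
  - by rewrite /= /mrestr setTI (le_lt_trans (le _ _ _ kl))//; exact: fin.
  - by rewrite /= /mrestr setTI; exact: fin.
  move=> _ [n [S [mn ->]]].
  have mS := measurable_cell2 n S.
  rewrite /= /mrestr.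
  apply: (measure_le_partition (g := cell2 n)); first by move=> i; exact: measurable_cell2.
    exact: measurableI.
  move=> [k' l']; set V := _ `&` _.
  have [->|/set0P[p [[Sp Bp] pkl]]] := eqVneq V set0; first by rewrite !measure0.
  rewrite (_ : V = cell2 n @^-1` [set (k', l')]); last first.
    apply/seteqP; split => [q []//|q qkl].
    have qp : cell2 n q = cell2 n p by rewrite [LHS]qkl [RHS]pkl.
    split => //; split; first by rewrite /preimage/= qp.
    by rewrite /B /preimage/= (cell2_coarser mn qp).
  apply: le; apply: contra_neqN kl => /eqP k'l'.
  have : cell n p.1 = cell n p.2 by case: pkl => -> ->.
  by move=> /(cell_coarser mn); case: Bp => -> ->.
pose O m := [set p : T * T | cell m p.1 != cell m p.2].
have mO m : measurable (O m) by exact: (measurable_cell2 m [set k | k.1 != k.2]).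
have leO m : mu (C `&` O m) <= nu (C `&` O m).
  apply: (measure_le_partition (g := cell2 m)); first by move=> i; exact: measurable_cell2.
    exact: measurableI.
  move=> [k l]; have [kl|kl] := eqVneq k l.
    rewrite (_ : _ `&` _ = set0) ?measure0//.
    by rewrite -subset0 => p [[_ /eqP Op] [pk pl]]; apply: Op; rewrite pk pl.
  apply: (block m k l) => //.
  by apply: measurableI; [exact: measurableI|exact: measurable_cell2].
have CE : C = \bigcup_m (C `&` O m).
  rewrite -setI_bigcupr; apply/esym/setIidPl => p /offC/= /cell_separated[n np].
  by exists n.
have ndO : nondecreasing_seq (fun m => C `&` O m).
  move=> m n mn; apply/subsetPset; apply: setIS => p /=.
  by apply: contra_neq => /(cell_coarser mn).
have mCO m : measurable (C `&` O m) by exact: measurableI.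
have cvgO (la : {measure set (T * T) -> \bar R}) : la (C `&` O m) @[m --> \oo] --> la C.
  rewrite [in X in _ --> X]CE; apply: nondecreasing_cvg_mu => //.
  exact: bigcupT_measurable.
rewrite -(cvg_lim _ (cvgO mu))// -(cvg_lim _ (cvgO nu))//.
apply: lee_lim; [by apply/cvg_ex; eexists; exact: cvgO|by apply/cvg_ex; eexists; exact: cvgO|].
exact: nearW.
Qed.

End cell_pairs.

(** * Densities of dominated measures *)

Section densities.
Context d (T : measurableType d) (R : realType).
Local Open Scope ereal_scope.

(** Radon-Nikodym on the pieces of a disjoint sigma-finite partition, where [mu] is finite by
    domination. At each point only one glued density is nonzero, so the result is finite everywhere
    and can be real-valued. *)
Lemma dominated_density (mu : {measure set T -> \bar R})
    (nu : {sigma_finite_measure set T -> \bar R}) (c : R) : (0 <= c)%R ->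
  (forall A, measurable A -> mu A <= c%:E * nu A) ->
  exists f : T -> R, [/\ measurable_fun setT f, forall x, (0 <= f x)%R &
    forall A, measurable A -> mu A = \int[nu]_(x in A) (f x)%:E].
Proof.
move=> c0 dom; have [F TF /all_and2[mF Foo]] := sigma_finiteT nu.
pose E := seqDU F.
have mE k : measurable (E k) by exact: seqDU_measurable.
have nuE k : nu (E k) < +oo.
  by rewrite (le_lt_trans _ (Foo k))// le_measure ?inE//; exact: subset_seqDU.
have muE k : mu (E k) < +oo.
  by rewrite (le_lt_trans (dom _ (mE k)))// lte_mul_pinfty// ?lee_fin.
pose mu_ k : {finite_measure set T -> \bar R} := mfrestr (mE k) (muE k).
have ac k : mu_ k `<< nu.
  apply/null_content_dominatesP => A mA nuA.
  have nuAE : nu (A `&` E k) = 0.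
    apply/eqP; rewrite -measure_le0 -nuA; apply: le_measure; rewrite ?inE//.
    exact: measurableI.
  apply/eqP; rewrite /mu_/= /mfrestr /mrestr -measure_le0.
  by rewrite (le_trans (dom _ _))//; [exact: measurableI|rewrite nuAE mule0].
have [g /all_and4[g0 gfin gint gE]] := choice (fun k => radon_nikodym_sigma_finite (ac k)).
have mg k : measurable_fun setT ((g k) \_ (E k)).
  have /integrableP[mgk _] := gint k.
  by apply/(measurable_restrictT _ (mE k)); exact: measurable_funTS.
have gE0 k x : 0 <= ((g k) \_ (E k)) x by exact: erestrict_ge0.
pose h x := \sum_(k <oo) ((g k) \_ (E k)) x.
have hE k x : E k x -> h x = g k x.
  move=> Ekx; rewrite /h (@nneseriesD1 _ _ k)//.
  rewrite patchE mem_set// eseries0 ?adde0// => j _ /= jk.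
  rewrite patchE memNset// => Ejx; have := trivIset_seqDU F => /trivIsetP/(_ _ _ I I jk).
  by rewrite -subset0 => /(_ x); apply.
have TE x : exists k, E k x.
  have : (\bigcup_k E k) x by rewrite -seqDU_bigcup_eq -TF.
  by move=> [k _ ?]; exists k.
have hfin x : (fine (h x))%:E = h x.
  by have [k /hE ->] := TE x; rewrite fineK.
exists (fun x => fine (h x)); split.
- apply: (measurableT_comp (f := fine)) => //.
  exact: ge0_emeasurable_sum.
- by move=> x; rewrite fine_ge0//; exact: nneseries_ge0.
move=> A mA; under eq_integral do rewrite hfin.
rewrite integral_nneseries//; last by move=> k; exact: measurable_funTS.
transitivity (\sum_(k <oo) mu (A `&` E k)); last first.
  apply: eq_eseriesr => k _; rewrite -integral_mkcondr -gE; last exact: measurableI.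
  by rewrite /mu_/= /mfrestr /mrestr -setIA setIid.
have -> : mu A = mu (\bigcup_k (A `&` E k)).
  by rewrite -setI_bigcupr -seqDU_bigcup_eq -TF setIT.
apply: measure_semi_bigcup.
- by move=> k; exact: measurableI.
- by apply: trivIset_setIl; exact: trivIset_seqDU.
- by apply: bigcupT_measurable => k; exact: measurableI.
Qed.

Section density_measure.
Variables (nu : {measure set T -> \bar R}) (f : T -> R).
Hypotheses (mf : measurable_fun setT f) (f0 : forall x, (0 <= f x)%R).

(** The two proofs are arguments so that the measure structure can be attached to the function. *)
Definition density_measure of measurable_fun setT f & (forall x, (0 <= f x)%R) :=
  fun A : set T => \int[nu]_(x in A) (f x)%:E.

Local Notation dm := (density_measure mf f0).

Let dm0 : dm set0 = 0. Proof. by rewrite /density_measure integral_set0. Qed.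

Let dm_ge0 A : 0 <= dm A.
Proof. by apply: integral_ge0 => x _; rewrite lee_fin. Qed.

Let dm_sigma_additive : semi_sigma_additive dm.
Proof.
move=> F mF tF mUF; rewrite /density_measure ge0_integral_bigcup//=.
- by apply: is_cvg_nneseries => n _ _; apply: integral_ge0 => x _; rewrite lee_fin.
- by apply: measurable_funTS; exact/measurable_EFinP.
- by move=> x _; rewrite lee_fin.
Qed.

HB.instance Definition _ := isMeasure.Build _ _ _ dm dm0 dm_ge0 dm_sigma_additive.

End density_measure.

(** The positive function [u - v] has integral at most 0 on [C]; finiteness of the integral of [v]
    permits the cancellation. *)
Lemma integral_null_gt (nu : {measure set T -> \bar R}) (C : set T) (u v : T -> R) :
  measurable C -> measurable_fun setT u -> measurable_fun setT v ->
  (forall x, C x -> (0 <= v x < u x)%R) ->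
  \int[nu]_(x in C) (v x)%:E < +oo ->
  \int[nu]_(x in C) (u x)%:E <= \int[nu]_(x in C) (v x)%:E -> nu C = 0.
Proof.
move=> mC mu mv uv vfin le.
have muv : measurable_fun C (fun x => (u x - v x)%:E).
  by apply/measurable_EFinP; apply: measurable_funTS; exact: measurable_funB.
have mvC : measurable_fun C (EFin \o v) by apply: measurable_funTS; exact/measurable_EFinP.
have uE : \int[nu]_(x in C) (u x)%:E =
    \int[nu]_(x in C) (u x - v x)%:E + \int[nu]_(x in C) (v x)%:E.
  rewrite -ge0_integralD//.
  - by apply: eq_integral => x _; rewrite -EFinD subrK.
  - by move=> x /uv/andP[v0 vu]; rewrite lee_fin subr_ge0 ltW.
  - by move=> x /uv/andP[v0 vu]; rewrite lee_fin.
have d0 : 0 <= \int[nu]_(x in C) (u x - v x)%:E.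
  by apply: integral_ge0 => x /uv/andP[v0 vu]; rewrite lee_fin subr_ge0 ltW.
have v0 : 0 <= \int[nu]_(x in C) (v x)%:E.
  by apply: integral_ge0 => x /uv/andP[v0 vu]; rewrite lee_fin.
have : \int[nu]_(x in C) (u x - v x)%:E = 0.
  apply/eqP; rewrite eq_le d0 andbT.
  have vf : \int[nu]_(x in C) (v x)%:E \is a fin_num by rewrite ge0_fin_numE.
  by move: le; rewrite uE -[leRHS]add0e leeD2rE.
have : \int[nu]_(x in C) `|(u x - v x)%:E| = \int[nu]_(x in C) (u x - v x)%:E.
  apply: eq_integral => x; rewrite inE => /uv/andP[_ vu].
  by rewrite gee0_abs// lee_fin subr_ge0 ltW.
move=> absE dE0.
have /(ae_eq_integral_abs nu mC muv)[N [mN N0 CN]] :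
  \int[nu]_(x in C) `|(u x - v x)%:E| = 0 by rewrite absE.
apply/eqP; rewrite -measure_le0 -N0; apply: le_measure; rewrite ?inE// => x Cx.
apply: CN => /= /(_ Cx)/eqP; rewrite /cst eqe subr_eq0 => /eqP uvx.
by have := uv _ Cx; rewrite uvx ltxx andbF.
Qed.

End densities.

Section iterated_integral.
Context d1 d2 (T1 : measurableType d1) (T2 : measurableType d2) (R : realType).
Variables (m1 : {sigma_finite_measure set T1 -> \bar R})
  (m2 : {sigma_finite_measure set T2 -> \bar R}).
Local Open Scope ereal_scope.

Lemma iterated_integral (A : set T1) (B : set T2) (f : T1 * T2 -> R) :
  measurable A -> measurable B -> (m1 \x m2).-integrable (A `*` B) (EFin \o f) ->
  \int[m1]_(x in A) \int[m2]_(y in B) (f (x, y))%:E =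
  \int[m1 \x m2]_(p in A `*` B) (f p)%:E.
Proof.
move=> mA mB fint; have mAB : measurable (A `*` B) by exact: measurableX.
rewrite [RHS]integral_mkcond -integral12_prod_meas1; last by have /(integrable_mkcond _ mAB) := fint.
rewrite integral_mkcond; apply: eq_integral => x _; rewrite /fubini_F patchE.
case: ifPn => [|/negP]; rewrite inE => Ax.
  rewrite [LHS]integral_mkcond; apply: eq_integral => y _; rewrite !patchE.
  congr (if _ then _ else _); apply/idP/idP; rewrite !inE; first by split.
  by case.
rewrite integral0_eq// => y _; rewrite patchE memNset// => -[].
by move=> /=.
Qed.

Lemma null_graph (f : T1 -> T2) (D : set (T1 * T2)) : measurable D ->
  (forall p, D p -> p.2 = f p.1) -> (forall y, m2 [set y] = 0) ->
  (forall y : T2, measurable [set y]) -> (m1 \x m2) D = 0.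
Proof.
move=> mD Df m20 m1set; rewrite /product_measure1 integral0_eq// => x _ /=.
apply/eqP; rewrite -measure_le0 -(m20 (f x)); apply: le_measure; rewrite ?inE//.
  exact: measurable_xsection.
by move=> y; rewrite /xsection/= inE => /Df.
Qed.

End iterated_integral.

Section lebesgue_tuple_null.
Context {R : realType}.

Lemma lebesgue_tuple_set1 d (x : d.-tuple R) : (0 < d)%N -> lebesgue_tuple d [set x] = 0%E.
Proof.
case: d x => // d x _; rewrite /= /lebesgue_cons /pushforward.
apply/eqP; rewrite -measure_le0.
(* The point lies in a hyperplane, of measure [0 * +oo = 0] or smaller. *)
apply: (@le_trans _ _ ((@lebesgue_measure R \x lebesgue_tuple d)%E ([set thead x] `*` setT))).
  apply: le_measure; rewrite ?inE//.
  - exact: (measurable_preimage (@measurable_tuple_cons R d) (measurable_tuple1 x)).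
  - apply: measurableX => //; exact: measurable_set1.
  - by move=> [a t] /= <-; split => //; rewrite theadE.
rewrite product_measure1E//.
by rewrite [X in (X * _)%E](_ : _ = 0%E) ?mul0e//; exact: lebesgue_measure_set1.
Qed.

Lemma lebesgue_diagonal d : (0 < d)%N ->
  ((@lebesgue_tuple R d) \x (lebesgue_tuple d))%E [set p | p.1 = p.2] = 0%E.
Proof.
move=> d0; apply: (@null_graph _ _ _ _ R _ _ id) => //.
- rewrite (_ : [set p | _] = ~` \bigcup_n (cell2 n @^-1` [set k | k.1 != k.2])).
    apply: measurableC; apply: bigcupT_measurable => n; exact: measurable_cell2.
  apply/seteqP; split => [p /= pp [n _]|p /= np].
    by rewrite /preimage/= pp eqxx.
  apply: contrapT => /eqP/cell_separated[n pn]; apply: np; exists n => //.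
- by move=> y; exact: lebesgue_tuple_set1.
- exact: measurable_tuple1.
Qed.

End lebesgue_tuple_null.

(** * Moment measures *)

Section point_measure.
Context {R : realType} {d : nat}.
Local Notation S := (marked R d).
Local Notation Om := (config R d).
Local Notation T := (d.-tuple R).
Local Open Scope ereal_scope.

(** The configuration as a measure on centres; points with equal centres and different marks are
    counted separately. *)
Definition point_measure (w : Om) : set T -> \bar R := fun A => npts (cyl A) w.

Section fixed_config.
Variable w : Om.

Let pm0 : point_measure w set0 = 0.
Proof. by apply/npts_eq0; rewrite /cyl set0X setI0. Qed.

Let pm_ge0 A : 0 <= point_measure w A.
Proof. exact: npts_ge0. Qed.

Let pm_sigma_additive : semi_sigma_additive (point_measure w).
Proof.
pose m := measure_function_pushforward__canonical__measure_function_Measure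
  (mrestr (counting : {measure set S -> \bar R}) (measurable_pts w))
  (@measurable_fst _ _ T (mark R)).
suff -> : point_measure w = m by exact: measure_semi_sigma_additive.
apply/funext => A; rewrite /m /= /pushforward /mrestr /point_measure /npts.
by congr counting; rewrite setIC; congr (_ `&` _); apply/seteqP; split => X //= [].
Qed.

HB.instance Definition _ := isMeasure.Build _ _ _ (point_measure w)
  pm0 pm_ge0 pm_sigma_additive.

Lemma locally_bounded_cyl (A : set T) : bounded_pts A -> locally_bounded (cyl A).
Proof.
by move=> /bounded_sub_box[n An]; exists n => X [AX _]; split => //; exact: An.
Qed.

Let pm_sigma_finite : sigma_finite setT (point_measure w).
Proof.
exists (@box R d).
  by apply/seteqP; split => // x _; have [n xn] := box_cover x; exists n.
move=> n; split; first exact: measurable_box.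
rewrite /point_measure nptsE ?ltry//.
by apply: locally_bounded_cyl; exact: bounded_box.
Qed.

HB.instance Definition _ := Measure_isSigmaFinite.Build _ _ _ (point_measure w)
  pm_sigma_finite.

End fixed_config.

Definition pair_count (C : set (T * T)) (w : Om) : \bar R :=
  (point_measure w \x point_measure w) C.

Lemma pair_countX A B w : measurable A -> measurable B ->
  pair_count (A `*` B) w = npts (cyl A) w * npts (cyl B) w.
Proof. by move=> mA mB; rewrite /pair_count product_measure1E. Qed.

(** Dynkin induction from rectangles, where the count is a product. It is run inside a box, since
    the complement step subtracts counts that must be finite; general sets follow by monotone
    limits. *)
Lemma measurable_pair_count C : measurable C -> measurable_fun setT (pair_count C).
Proof.
move=> mC; pose bb n : set (T * T) := box n `*` box n.
have mbox n : measurable (box n : set T) by exact: measurable_box.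
have mbb n : measurable (bb n) by exact: measurableX.
have bbfin n w : pair_count (bb n) w < +oo.
  rewrite pair_countX// nptsE ?ltry//.
  by apply: locally_bounded_cyl; exact: bounded_box.
have mX A B : measurable A -> measurable B -> measurable_fun setT (pair_count (A `*` B)).
  move=> mA mB; rewrite (_ : pair_count _ = (fun w => npts (cyl A) w * npts (cyl B) w)).
    by apply: emeasurable_funM; apply: measurable_npts; exact: measurable_cyl.
  by apply/funext => w; rewrite pair_countX.
suff h n D : measurable D -> measurable_fun setT (pair_count (D `&` bb n)).
  apply: (emeasurable_fun_cvg (fun n => pair_count (C `&` bb n))) => [n|w _].
    exact: h.
  have CE : C = \bigcup_n (C `&` bb n).
    rewrite -setI_bigcupr; apply/esym/setIidPl => p _.
    have [m pm] := box_cover p.1; have [k pk] := box_cover p.2.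
    exists (maxn m k) => //.
    by split; [exact: (box_nd (leq_maxl m k))|exact: (box_nd (leq_maxr m k))].
  rewrite [in X in _ --> X]CE; apply: nondecreasing_cvg_mu.
  - by move=> k; exact: measurableI.
  - by rewrite -CE.
  - move=> m k mk; apply/subsetPset; apply: setIS => p [? ?].
    by split; exact: (box_nd mk).
move=> mD; move: (mD); rewrite measurable_prod_measurableType.
move: D {mD}; apply: (@dynkin_induction _ _ _
  (fun D => measurable_fun setT (pair_count (D `&` bb n)))).
- exact: measurable_prod_measurableType.
- move=> _ _ [A mA [B mB <-]] [A' mA' [B' mB' <-]].
  by exists (A `&` A'); [exact: measurableI|exists (B `&` B'); [exact: measurableI|rewrite setXI]].
- by rewrite setTI; exact: mX.
- by move=> _ [A mA [B mB <-]]; rewrite /bb -setXI; apply: mX; exact: measurableI.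
- move=> D mD PD; rewrite (_ : pair_count _ =
    (fun w => pair_count (bb n) w - pair_count (D `&` bb n) w)).
    by apply: emeasurable_funB; [exact: mX|exact: PD].
  apply/funext => w; rewrite /pair_count (_ : ~` D `&` bb n = bb n `\` D).
    by rewrite measureD; [rewrite [bb n `&` D]setIC|exact: mbb|exact: mD|exact: bbfin].
  by rewrite setDE setIC.
- move=> F mF tF PF; rewrite (_ : pair_count _ =
    (fun w => \sum_(k <oo) pair_count (F k `&` bb n) w)).
    by apply: ge0_emeasurable_sum => // k w _ _; exact: measure_ge0.
  apply/funext => w; rewrite /pair_count setI_bigcupl measure_semi_bigcup//.
  - by move=> k; exact: measurableI.
  - exact: trivIset_setIr.
  - by apply: bigcupT_measurable => k; exact: measurableI.
Qed.

Definition offdiag : set (T * T) := [set p | p.1 != p.2].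

Lemma measurable_offdiag : measurable offdiag.
Proof.
rewrite (_ : offdiag = \bigcup_n (cell2 n @^-1` [set k | k.1 != k.2])).
  apply: bigcupT_measurable => n; exact: measurable_cell2.
apply/seteqP; split => [p /= /cell_separated[n pn]|p [n _] /=]; first by exists n.
by apply: contra_neq => ->.
Qed.

Section moment_measures.
Variable P : probability Om R.

Definition mean_measure (A : set T) : \bar R := \int[P]_w npts (cyl A) w.

Let mm0 : mean_measure set0 = 0.
Proof.
rewrite /mean_measure integral0_eq// => w _.
by apply/npts_eq0; rewrite /cyl set0X setI0.
Qed.

Let mm_ge0 A : 0 <= mean_measure A.
Proof. by apply: integral_ge0 => w _; exact: npts_ge0. Qed.

Let mm_sigma_additive : semi_sigma_additive mean_measure.
Proof.
move=> F mF tF mUF.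
have -> : mean_measure (\bigcup_n F n) = \sum_(n <oo) mean_measure (F n).
  rewrite /mean_measure -integral_nneseries//; last first.
    by move=> n; apply: measurable_npts; exact: measurable_cyl.
  apply: eq_integral => w _.
  exact: (@measure_semi_bigcup _ _ _ (point_measure w)).
by apply: is_cvg_nneseries => n _ _; exact: mm_ge0.
Qed.

HB.instance Definition _ := isMeasure.Build _ _ _ mean_measure
  mm0 mm_ge0 mm_sigma_additive.

(** The second factorial moment measure, restricted to pairs with distinct centres. Without this
    restriction a point paired with itself would charge the diagonal and rule out a density. *)
Definition pair_measure (C : set (T * T)) : \bar R :=
  \int[P]_w pair_count (C `&` offdiag) w.

Let pm0 : pair_measure set0 = 0.
Proof.
by rewrite /pair_measure integral0_eq// => w _; rewrite /pair_count set0I measure0.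
Qed.

Let pm_ge0 C : 0 <= pair_measure C.
Proof. by apply: integral_ge0 => w _; exact: measure_ge0. Qed.

Let pm_sigma_additive : semi_sigma_additive pair_measure.
Proof.
move=> F mF tF mUF; have mO := measurable_offdiag.
have mFO n : measurable (F n `&` offdiag) by exact: measurableI.
have -> : pair_measure (\bigcup_n F n) = \sum_(n <oo) pair_measure (F n).
  rewrite /pair_measure -integral_nneseries//; last first.
    by move=> n; exact: measurable_pair_count.
  apply: eq_integral => w _; rewrite /pair_count setI_bigcupl measure_semi_bigcup//.
  - exact: trivIset_setIr.
  - exact: bigcupT_measurable.
by apply: is_cvg_nneseries => n _ _; exact: pm_ge0.
Qed.

HB.instance Definition _ := isMeasure.Build _ _ _ pair_measure
  pm0 pm_ge0 pm_sigma_additive.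

Lemma pair_measureX A B : measurable A -> measurable B -> A `&` B = set0 ->
  pair_measure (A `*` B) = \int[P]_w (npts (cyl A) w * npts (cyl B) w).
Proof.
move=> mA mB AB; rewrite /pair_measure setIidl.
  by apply: eq_integral => w _; rewrite pair_countX.
move=> [x y] [/= Ax By]; apply/eqP => /= xy.
by rewrite -[False]/(set0 x) -AB; split => //; rewrite xy.
Qed.

Lemma pair_measure_offdiag C : pair_measure C = pair_measure (C `&` offdiag).
Proof. by rewrite /pair_measure -setIA setIid. Qed.

End moment_measures.

End point_measure.

Section moment_bounds.
Context {R : realType} {d : nat}.
Local Notation S := (marked R d).
Local Notation Om := (config R d).
Local Notation T := (d.-tuple R).
Implicit Types (A B : set T) (U : set Om).
Local Open Scope ereal_scope.

Lemma nneseries_mul (a b : nat -> \bar R) : (forall n, 0 <= a n) -> (forall n, a n \is a fin_num) ->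
  (forall n, 0 <= b n) -> \sum_(n <oo) b n \is a fin_num ->
  \sum_(n <oo) \sum_(m <oo) (a n * b m) = (\sum_(n <oo) a n) * (\sum_(m <oo) b m).
Proof.
move=> a0 afin b0 bfin.
rewrite muleC -(fineK bfin) -nneseriesZl//; apply: eq_eseriesr => n _.
by rewrite fineK// muleC -(fineK (afin n)) -nneseriesZl.
Qed.

Variables (alpha : R) (Q : probability (mark R) R) (Pbar : probability Om R).
Hypotheses (alpha0 : (0 < alpha)%R) (PP : is_poisson (intensity alpha Q) Pbar).
Variable P : probability Om R.
Hypothesis dom : forall D U, Sbp D -> measurable U ->
  (forall w w', U w -> pts w `<=` pts w' -> U w') ->
  P (restr D @^-1` U) <= Pbar (restr D @^-1` U).

Lemma card_pts_increasing (D : set S) (w w' : Om) : locally_bounded D -> pts w `<=` pts w' ->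
  (card_pts D w <= card_pts D w')%N.
Proof.
move=> bD ww'; apply: fsubset_leq_card.
by rewrite -fset_set_sub; [apply: setSI|exact: finite_pts|exact: finite_pts].
Qed.

Lemma le_poisson_local N U : measurable U ->
  (forall w w', U w -> pts w `<=` pts w' -> U w') ->
  restr (cyl (box N)) @^-1` U = U -> P U <= Pbar U.
Proof.
move=> mU Uinc NU; rewrite -NU; apply: dom => //; split.
  by apply: measurable_cyl; exact: measurable_box.
rewrite (_ : fst @` cyl (box N) = box N); last first.
  by apply/seteqP; split => [_ [X [NX _] <-]//|x Nx]; exists (x, mark0 R).
by split; [exact: measurable_box|exact: bounded_box].
Qed.

Lemma bounded_borel_cyl A : bounded_borel A -> measurable (cyl A) /\ locally_bounded (cyl A).
Proof.
by move=> [mA bA]; split; [exact: measurable_cyl|exact: locally_bounded_cyl].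
Qed.

Lemma count_gt_le2 A B n m : bounded_borel A -> bounded_borel B ->
  P (count_gt (cyl A) n `&` count_gt (cyl B) m) <=
  Pbar (count_gt (cyl A) n `&` count_gt (cyl B) m).
Proof.
move=> bA bB; have [mcA lcA] := bounded_borel_cyl bA; have [mcB lcB] := bounded_borel_cyl bB.
have [N1 AN1] := lcA; have [N2 BN2] := lcB; pose N := maxn N1 N2.
have AN : cyl A `<=` cyl (box N).
  by move=> X /AN1[X1 _]; split => //; exact: (box_nd (leq_maxl N1 N2)).
have BN : cyl B `<=` cyl (box N).
  by move=> X /BN2[X1 _]; split => //; exact: (box_nd (leq_maxr N1 N2)).
have cE D (w : Om) : D `<=` cyl (box N) -> card_pts D (restr (cyl (box N)) w) = card_pts D w.
  by move=> DN; rewrite /card_pts /= -setIA (setIidr DN).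
apply: (@le_poisson_local N).
- by apply: measurableI; exact: measurable_count_gt.
- move=> w w' [An Bm] ww'; split.
    by rewrite /count_gt/= (leq_trans An)// card_pts_increasing.
  by rewrite /count_gt/= (leq_trans Bm)// card_pts_increasing.
- by apply/seteqP; split => w; rewrite /preimage /count_gt /= !cE.
Qed.

Lemma count_gt_le A n : bounded_borel A ->
  P (count_gt (cyl A) n) <= Pbar (count_gt (cyl A) n).
Proof. by move=> bA; rewrite -(setIid (count_gt _ _)); exact: count_gt_le2. Qed.

Lemma poisson_mean A : bounded_borel A ->
  \sum_(n <oo) Pbar (count_gt (cyl A) n) = alpha%:E * lebesgue_tuple d A.
Proof.
move=> bA; have [mcA lcA] := bounded_borel_cyl bA.
rewrite -first_moment// (poisson_first_moment alpha0 PP mcA lcA) intensity_cyl//.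
by case: bA.
Qed.

Lemma lebesgue_tuple_bounded A : bounded_borel A -> lebesgue_tuple d A \is a fin_num.
Proof.
move=> [mA /bounded_sub_box[n An]]; rewrite ge0_fin_numE//.
rewrite (le_lt_trans _ (lebesgue_tuple_box_lty d n))// le_measure ?inE//.
exact: measurable_box.
Qed.

Lemma poisson_mean_fin A : bounded_borel A ->
  \sum_(n <oo) Pbar (count_gt (cyl A) n) \is a fin_num.
Proof. by move=> bA; rewrite poisson_mean// fin_numM// lebesgue_tuple_bounded. Qed.

(** Domination by the Poisson process concerns bounded regions; a countable partition into unit
    cells extends it to all measurable sets. *)
Lemma mean_measure_le A : measurable A ->
  mean_measure P A <= alpha%:E * lebesgue_tuple d A.
Proof.
pose la : {measure set T -> \bar R} := mscale (NngNum (ltW alpha0)) (lebesgue_tuple d).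
move=> mA; have : mean_measure P A <= la A; last by [].
apply: (measure_le_partition (g := cell 0)) => // [k|k].
  exact: measurable_cell.
have bAk : bounded_borel (A `&` cell 0 @^-1` [set k]).
  split; first by apply: measurableI => //; exact: measurable_cell.
  exists (Num.sqrt d%:R) => x y [_ xk] [_ yk]; apply: (@cell_eucl _ _ 0).
  by rewrite [LHS]xk [RHS]yk.
have [mc lc] := bounded_borel_cyl bAk.
rewrite /la /= /mscale/= -poisson_mean// /mean_measure first_moment//.
by apply: lee_nneseries => // n _; exact: count_gt_le.
Qed.

Lemma poisson_pair_count A B n m : bounded_borel A -> bounded_borel B -> A `&` B = set0 ->
  Pbar (count_gt (cyl A) n `&` count_gt (cyl B) m) =
  Pbar (count_gt (cyl A) n) * Pbar (count_gt (cyl B) m).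
Proof.
move=> bA bB AB; have [mcA lcA] := bounded_borel_cyl bA; have [mcB lcB] := bounded_borel_cyl bB.
have rE (D : set S) k : restr D @^-1` count_gt D k = count_gt D k.
  by apply/funext => w; rewrite /preimage /count_gt /= /card_pts /= -setIA setIid.
rewrite -[in LHS](rE (cyl A)) -[in LHS](rE (cyl B)) (poisson_indep alpha0 PP) ?rE//.
- by rewrite -subset0 => X [[AX _] [BX _]]; rewrite -[set0 X]/(set0 X.1) -AB.
- exact: measurable_count_gt.
- exact: measurable_count_gt.
Qed.

Lemma poisson_second_moment A B : bounded_borel A -> bounded_borel B -> A `&` B = set0 ->
  \sum_(n <oo) \sum_(m <oo) (Pbar (count_gt (cyl A) n) * Pbar (count_gt (cyl B) m)) =
  (alpha ^+ 2)%:E * (lebesgue_tuple d A * lebesgue_tuple d B).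
Proof.
move=> bA bB AB; have [mcA lcA] := bounded_borel_cyl bA.
rewrite nneseries_mul//; last 2 first.
- by move=> n; rewrite fin_num_measure//; exact: measurable_count_gt.
- exact: poisson_mean_fin.
rewrite !poisson_mean// -(fineK (lebesgue_tuple_bounded bA)) -(fineK (lebesgue_tuple_bounded bB)).
by rewrite -!EFinM; congr EFin; ring.
Qed.

Lemma pair_measureX_le A B : bounded_borel A -> bounded_borel B -> A `&` B = set0 ->
  pair_measure P (A `*` B) <= (alpha ^+ 2)%:E * (lebesgue_tuple d A * lebesgue_tuple d B).
Proof.
move=> bA bB AB; have [mcA lcA] := bounded_borel_cyl bA; have [mcB lcB] := bounded_borel_cyl bB.
rewrite pair_measureX//; [|by case: bA|by case: bB].
rewrite second_moment// -poisson_second_moment//.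
apply: lee_nneseries => [n _ _|n _]; first exact: nneseries_ge0.
apply: lee_nneseries => // m _; rewrite -poisson_pair_count//; exact: count_gt_le2.
Qed.

Lemma bounded_borel_cell n k : bounded_borel (cell n @^-1` [set k] : set T).
Proof.
split; first exact: measurable_cell.
exists (Num.sqrt d%:R) => x y xk yk; apply: (@cell_eucl _ _ n).
by rewrite [LHS]xk [RHS]yk.
Qed.

Lemma cell2E n k l : cell2 n @^-1` [set (k, l)] =
  (cell n @^-1` [set k]) `*` (cell n @^-1` [set l]) :> set (T * T).
Proof.
apply/seteqP; split => p; first by move=> [pk pl].
by move=> [/= pk pl]; rewrite /preimage/= /cell2 pk pl.
Qed.

Lemma cell_disjoint n k l : k != l ->
  (cell n @^-1` [set k]) `&` (cell n @^-1` [set l]) = set0 :> set T.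
Proof. by move=> /eqP kl; rewrite -subset0 => x [/= xk xl]; apply: kl; rewrite -xk. Qed.

(** On pairs of distinct cells this is domination of tail events and Poisson independence. Since
    [pair_measure] ignores the diagonal, the off-diagonal comparison suffices. *)
Lemma pair_measure_le C : measurable C ->
  pair_measure P C <= (alpha ^+ 2)%:E * (lebesgue_tuple d \x lebesgue_tuple d) C.
Proof.
move=> mC; pose la : {measure set (T * T) -> \bar R} :=
  mscale (NngNum (sqr_ge0 alpha)) (lebesgue_tuple d \x lebesgue_tuple d).
have mO := @measurable_offdiag R d.
rewrite pair_measure_offdiag; apply: (@le_trans _ _ (la (C `&` offdiag))); last first.
  rewrite /la /= /mscale/=; apply: lee_wpmul2l; first by rewrite lee_fin sqr_ge0.
  by apply: le_measure; rewrite ?inE//; exact: measurableI.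
apply: measure_le_offdiag.
- move=> n k l kl; rewrite /la /= /mscale/= cell2E product_measure1E//; try exact: measurable_cell.
  by apply: pair_measureX_le; [exact: bounded_borel_cell..|exact: cell_disjoint].
- move=> n k l _; rewrite /la /= /mscale/= cell2E product_measure1E//; try exact: measurable_cell.
  by rewrite ltey_eq !fin_numM// lebesgue_tuple_bounded//; exact: bounded_borel_cell.
- exact: measurableI.
- by move=> p [].
Qed.

End moment_bounds.

(** * The pair correlation function *)

Section pair_bound.
Context {R : realType} {d : nat}.
Local Notation S := (marked R d).
Local Notation Om := (config R d).
Local Notation T := (d.-tuple R).
Implicit Types (w g : Om) (A B L : set T) (D : set S) (E J U F : set Om).

Variables (Pl : probability Om R) (H : set S -> Om -> Om -> \bar R).
Variables (alpha : R) (Q : probability (mark R) R) (Pbar : probability Om R).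
Hypotheses (alpha0 : 0 < alpha) (PP : is_poisson (intensity alpha Q) Pbar).
Variables (r0 : R) (Qr0 : Q [set r | mark_val r <= r0] = 1%E).
Variables (Pdc : set S -> Om -> Om -> probability (Om * Om * Om)%type R).
Hypothesis hPdc : disagreement_coupling H Pl Pbar Pdc.
Variables (kappa : R) (kappa0 : 0 < kappa) (K : R) (K0 : 0 < K).
Hypothesis decay : forall A B, measurable A -> measurable B -> in_unit_cube A ->
  (prob_connected Pbar A B <= K%:E * expeR (- (kappa%:E * dist_sets A B)))%E.

Lemma restr_count_gt (D : set S) n : restr D @^-1` count_gt D n = count_gt D n.
Proof.
by apply/funext => w; rewrite /preimage /count_gt /= card_pts_restr.
Qed.

(** [E] may serve as its own [J] because it is increasing, which yields the factor summable in [n].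
    The factor summable in [m] comes from replacing [P F] by the larger [Pbar F]. *)
Lemma gibbs_count_covariance : exists2 C0 : R, 0 < C0 &
  forall P, gibbs_state H Pl P -> forall A B n m,
    bounded_borel A -> bounded_borel B -> in_unit_cube A -> A `&` B = set0 -> B !=set0 ->
  (P (count_gt (cyl A) n `&` count_gt (cyl B) m) <=
   P (count_gt (cyl A) n) * P (count_gt (cyl B) m) +
   C0%:E * expeR (- (kappa%:E * dist_sets A B)) *
   (Pbar (count_gt (cyl A) n) * Pbar (count_gt (cyl B) m)))%E.
Proof.
have [C0 C00 est] := gibbs_state_estimates alpha0 PP Qr0 hPdc kappa0 K0 decay ler01.
exists (2 * C0) => [|P GP A B n m bA bB [a Aa] AB B0]; first by rewrite mulr_gt0.
have [L [bL AL BL dL]] := separating_region bA bB AB B0.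
have [mcA lcA] := bounded_borel_cyl bA; have [mcB lcB] := bounded_borel_cyl bB.
have cAL : cyl A `<=` cyl L by move=> X [? _]; split => //; exact: AL.
have cBL : cyl B `<=` ~` cyl L by move=> X [/BL nL _] [].
set E := count_gt (cyl A) n; set F := count_gt (cyl B) m.
have mE : measurable E by exact: measurable_count_gt.
have mF : measurable F by exact: measurable_count_gt.
have AE : restr (cyl A) @^-1` E = E by exact: restr_count_gt.
have BF : restr (cyl B) @^-1` F = F by exact: restr_count_gt.
have EJ w1 w2 w3 : pts w1 `|` pts w2 `<=` pts w3 -> E w1 -> ~ E w2 ->
    E w3 /\ restr (cyl A) w1 <> restr (cyl A) w2.
  move=> w123 E1 E2; split.
    rewrite /E /count_gt/= (leq_trans E1)// card_pts_increasing// => X ?.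
    by apply: w123; left.
  by move=> w12; apply: E2; exact: (restr_invariantP AE w12 E1).
have [_ /(_ F mF (restr_invariant_sub cBL BF))] := est a A L E E bA bL Aa AL mE mE
  (restr_invariant_sub cAL AE) AE EJ P GP.
have PFle : (P F <= Pbar F)%E.
  by apply: count_gt_le => // D U SD mU Uinc; exact: (gibbs_state_le_poisson hPdc GP).
have eL : (expeR (- (kappa%:E * dist_sets A (~` L))) <= expeR (- (kappa%:E * dist_sets A B)))%E.
  have := expeR_dist_le kappa0 (dist_sets_ge0 A B) (_ : (_ <= dist_sets A (~` L) + 0%:E)%E).
  by rewrite mulr0 expR0 mul1e adde0; apply.
move: eL; have [e1 -> /andP[e10 _]] := expeR_dist_fin kappa0 A (~` L).
have [e2 -> /andP[e20 _]] := expeR_dist_fin kappa0 A B.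
move: PFle.
have : P (E `&` F) \is a fin_num by rewrite fin_num_measure//; exact: measurableI.
have : P E \is a fin_num by rewrite fin_num_measure.
have : P F \is a fin_num by rewrite fin_num_measure.
have : Pbar E \is a fin_num by rewrite fin_num_measure.
have : Pbar F \is a fin_num by rewrite fin_num_measure.
have : (0 <= P F)%E by exact: measure_ge0.
have : (0 <= Pbar E)%E by exact: measure_ge0.
move: (P (E `&` F)) (P E) (P F) (Pbar E) (Pbar F)
  => [x| |] [y| |] [z| |] [u| |] [v| |]// u0 z0 _ _ _ _ _.
rewrite -?EFinM -?EFinD ?lee_fin in u0 z0 * => zv e12 h.
have {h} : `|x - y * z| <= 2 * (u * (C0 * e1)) * z by exact: h.
rewrite ler_norml => /andP[_ h].
have : 2 * (u * (C0 * e1)) * z <= 2 * (u * (C0 * e2)) * v.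
  apply: ler_pM => //; rewrite ?mulr_ge0 ?(ltW C00)//.
  by rewrite ler_pM2l// ler_wpM2l// ler_pM2l.
have -> : 2 * (u * (C0 * e2)) * v = 2 * C0 * e2 * (u * v) by ring.
by move: h; lra.
Qed.

Lemma gibbs_pair_bound : exists2 C0 : R, 0 < C0 &
  forall P, gibbs_state H Pl P -> forall A B,
    bounded_borel A -> bounded_borel B -> in_unit_cube A -> A `&` B = set0 ->
  (pair_measure P (A `*` B) <= mean_measure P A * mean_measure P B +
   C0%:E * expeR (- (kappa%:E * dist_sets A B)) *
   (lebesgue_tuple d A * lebesgue_tuple d B))%E.
Proof.
have [C0 C00 cov] := gibbs_count_covariance.
(* Summing the two Poisson tail factors gives [alpha * leb A] and [alpha * leb B]. *)
exists (C0 * alpha ^+ 2) => [|P GP A B bA bB uA AB]; first by rewrite mulr_gt0// exprn_gt0.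
have [mcA lcA] := bounded_borel_cyl bA; have [mcB lcB] := bounded_borel_cyl bB.
have [mA _] := bA; have [mB _] := bB.
have e0 : (0 <= expeR (- (kappa%:E * dist_sets A B)))%E by exact: expeR_ge0.
have r_ge0 : (0 <= mean_measure P A * mean_measure P B +
    (C0 * alpha ^+ 2)%:E * expeR (- (kappa%:E * dist_sets A B)) *
    (lebesgue_tuple d A * lebesgue_tuple d B))%E.
  rewrite adde_ge0 ?mule_ge0 ?measure_ge0// lee_fin.
  by rewrite mulr_ge0 ?sqr_ge0// ltW.
have [B0|B0] := pselect (B = set0); first by rewrite B0 setX0 measure0 -B0.
have {}B0 : B !=set0 by apply/set0P/eqP.
have dom D U : Sbp D -> measurable U -> (forall w w', U w -> pts w `<=` pts w' -> U w') ->
    (P (restr D @^-1` U) <= Pbar (restr D @^-1` U))%E.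
  by move=> SD mU Uinc; exact: (gibbs_state_le_poisson hPdc GP).
have mfin C : bounded_borel C -> mean_measure P C \is a fin_num.
  move=> bC; rewrite ge0_fin_numE// (le_lt_trans (mean_measure_le alpha0 PP dom bC.1))//.
  by rewrite ltey_eq fin_numM// lebesgue_tuple_bounded.
rewrite pair_measureX// second_moment//.
apply: (@le_trans _ _ (\sum_(n <oo) \sum_(m <oo)
  (P (count_gt (cyl A) n) * P (count_gt (cyl B) m) +
   C0%:E * expeR (- (kappa%:E * dist_sets A B)) *
   (Pbar (count_gt (cyl A) n) * Pbar (count_gt (cyl B) m))))%E).
  apply: lee_nneseries => [n _ _|n _]; first exact: nneseries_ge0.
  by apply: lee_nneseries => // m _; exact: cov.
have [e -> /andP[e00 _]] := expeR_dist_fin kappa0 A B.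
have Ce0 : (0 <= C0%:E * e%:E)%E by rewrite lee_fin mulr_ge0// ltW.
have P0 n m : (0 <= P (count_gt (cyl A) n) * P (count_gt (cyl B) m))%E by exact: mule_ge0.
have Pb0 n m : (0 <= Pbar (count_gt (cyl A) n) * Pbar (count_gt (cyl B) m))%E by exact: mule_ge0.
rewrite (eq_eseriesr (g := fun n =>
  (\sum_(m <oo) P (count_gt (cyl A) n) * P (count_gt (cyl B) m) +
   \sum_(m <oo) (C0 * e)%:E * (Pbar (count_gt (cyl A) n) * Pbar (count_gt (cyl B) m)))%E)); last first.
  move=> n _; rewrite nneseriesD// => m _ _.
  by rewrite mule_ge0.
rewrite nneseriesD; last 2 first.
- by move=> n _ _; exact: nneseries_ge0.
- by move=> n _ _; apply: nneseries_ge0 => m _ _; rewrite mule_ge0.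
apply: leeD.
  rewrite nneseries_mul//; last 2 first.
  - by move=> n; rewrite fin_num_measure//; exact: measurable_count_gt.
  - by rewrite -first_moment//; exact: mfin.
  by rewrite /mean_measure !first_moment.
under eq_eseriesr do rewrite nneseriesZl//.
rewrite nneseriesZl; last by move=> n _; exact: nneseries_ge0.
rewrite (poisson_second_moment alpha0 PP)//.
by rewrite muleA -!EFinM mulrAC.
Qed.

End pair_bound.

Section pair_correlation_bound.
Context {R : realType} {d : nat}.
Local Notation Om := (config R d).
Local Notation T := (d.-tuple R).
Local Notation leb := (lebesgue_tuple d).
Local Notation leb2 := (lebesgue_tuple d \x lebesgue_tuple d)%E.
Implicit Types (A B : set T).

Lemma measurable_eucl : measurable_fun setT (fun p : T * T => eucl p.1 p.2).
Proof.
rewrite /eucl; apply: (@measurableT_comp _ _ _ _ _ _ (@Num.sqrt R)).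
  by apply: continuous_measurable_fun; exact: sqrt_continuous.
apply: measurable_sum => i; apply: measurable_funX; apply: measurable_funB.
  by apply: (measurableT_comp (@measurable_tnth _ R d i)).
by apply: (measurableT_comp (@measurable_tnth _ R d i)).
Qed.

Lemma in_unit_cube_cell n k : in_unit_cube (cell n @^-1` [set k] : set T).
Proof.
exists [tuple (tnth k i)%:~R / 2 ^+ n | i < d] => x <- i.
have n0 : 0 < 2 ^+ n :> R by rewrite exprn_gt0.
have n1 : 1 <= 2 ^+ n :> R by rewrite exprn_ege1// ler1n.
rewrite tnth_mktuple tnth_cell ler_pdivrMr// (mulrC (tnth x i)).
have /andP[-> h] := floor_itv (2 ^+ n * tnth x i).
rewrite -(ler_pM2l n0) mulrDr mulrCA divff ?gt_eqF// !mulr1.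
by rewrite (le_trans (ltW h))// intrD lerD2l.
Qed.

Definition exp_bound (kappa C : R) (p : T * T) : R :=
  C * expR (- (kappa * eucl p.1 p.2)).

Lemma measurable_exp_bound kappa C : measurable_fun setT (exp_bound kappa C).
Proof.
apply: measurable_funM => //; apply: measurableT_comp => //.
apply: measurableT_comp => //; apply: measurable_funM => //; exact: measurable_eucl.
Qed.

Lemma exp_bound_ge0 kappa C p : 0 <= C -> 0 <= exp_bound kappa C p.
Proof. by move=> C0; rewrite mulr_ge0// expR_ge0. Qed.

Variables (kappa : R) (kappa0 : 0 < kappa) (C0 : R) (C00 : 0 < C0).
Variable P : probability Om R.
Hypothesis cov : forall A B, bounded_borel A -> bounded_borel B -> in_unit_cube A ->
  A `&` B = set0 ->
  (pair_measure P (A `*` B) <= mean_measure P A * mean_measure P B +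
   C0%:E * expeR (- (kappa%:E * dist_sets A B)) * (leb A * leb B))%E.
Hypothesis meanfin : forall A, bounded_borel A -> mean_measure P A \is a fin_num.

(** Replacing the distance between two cells by that between two of their points costs two cell
    diameters, each at most [Num.sqrt d%:R] at every level. *)
Let C3 := C0 * expR (kappa * (2 * Num.sqrt d%:R)).

Let C30 : 0 < C3. Proof. by rewrite mulr_gt0// expR_gt0. Qed.

Lemma block_bound n k l :
  (C0%:E * expeR (- (kappa%:E * dist_sets (cell n @^-1` [set k] : set T) (cell n @^-1` [set l])))
    * (leb (cell n @^-1` [set k]) * leb (cell n @^-1` [set l])) <=
  \int[leb2]_(p in cell2 n @^-1` [set (k, l)]) (exp_bound kappa C3 p)%:E)%E.
Proof.
set A := _ @^-1` [set k]; set B := _ @^-1` [set l].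
have mA : measurable A by exact: measurable_cell.
have mB : measurable B by exact: measurable_cell.
have [e ee /andP[e0 _]] := expeR_dist_fin kappa0 A B; rewrite ee.
have -> : (leb A * leb B = leb2 (cell2 n @^-1` [set (k, l)]))%E.
  by rewrite cell2E product_measure1E.
have mAB := measurable_cell2 (R := R) (d := d) n [set (k, l)].
rewrite -EFinM -integral_cst//.
apply: ge0_le_integral => //.
- by move=> p _; rewrite lee_fin mulr_ge0// ltW.
- by apply: measurable_funTS; apply/measurable_EFinP; exact: measurable_exp_bound.
move=> p [pk pl]; rewrite lee_fin /exp_bound /C3 -mulrA ler_pM2l// -expRD.
have [pA pB] : A p.1 /\ B p.2 by [].
rewrite -lee_fin -ee.
have dAB : ((eucl p.1 p.2)%:E <= dist_sets A B + (2 * Num.sqrt d%:R)%:E)%E.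
  have <- : dist_sets [set p.1] [set p.2] = (eucl p.1 p.2)%:E.
    rewrite /dist_sets (_ : [set _ | _ in _] = [set (eucl p.1 p.2)%:E]) ?ereal_inf1//.
    apply/seteqP; split => [_ [[a b] [/= -> ->] <-]//|_ ->].
    by exists p.
  apply: dist_sets_le_shift => a b Aa Bb; exists p.1, p.2; split => //.
  have h1 : eucl p.1 a <= Num.sqrt d%:R by apply: (@cell_eucl _ _ n); rewrite [LHS]pA [RHS]Aa.
  have h2 : eucl b p.2 <= Num.sqrt d%:R by apply: (@cell_eucl _ _ n); rewrite [LHS]Bb [RHS]pB.
  have := eucl_triangle p.1 a p.2; have := eucl_triangle a b p.2; lra.
have p0 : (0 <= (eucl p.1 p.2)%:E)%E by rewrite lee_fin eucl_ge0.
by have := expeR_dist_le kappa0 p0 dAB; rewrite -EFinM/= -expRD.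
Qed.

Lemma leb2_bounded A B : bounded_borel A -> bounded_borel B -> (leb2 (A `*` B) < +oo)%E.
Proof.
move=> bA bB; rewrite product_measure1E//; [|by case: bA|by case: bB].
by rewrite ltey_eq fin_numM// lebesgue_tuple_bounded.
Qed.

Lemma exp_bound_integrable C A B : 0 <= C -> bounded_borel A -> bounded_borel B ->
  leb2.-integrable (A `*` B) (EFin \o exp_bound kappa C).
Proof.
move=> C'0 bA bB; have mAB : measurable (A `*` B) by apply: measurableX; [case: bA|case: bB].
apply: (@le_integrable _ _ _ leb2 (A `*` B) mAB _ (cst C%:E)).
- by apply: measurable_funTS; apply/measurable_EFinP; exact: measurable_exp_bound.
- move=> p _; rewrite /= lee_fin !ger0_norm ?exp_bound_ge0//.
  rewrite /exp_bound ler_piMr// -expR0 ler_expR oppr_le0 mulr_ge0 ?eucl_ge0//.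
  exact: ltW.
- apply/integrableP; split => //.
  by rewrite integral_cst//= lte_mul_pinfty//; exact: leb2_bounded.
Qed.

Lemma pair_correlation_block rho n k l : pair_correlation P rho -> k != l ->
  (\int[leb2]_(p in cell2 n @^-1` [set (k, l)]) (rho p)%:E <=
   \int[leb2]_(p in cell2 n @^-1` [set (k, l)]) (exp_bound kappa C3 p)%:E)%E.
Proof.
move=> [mrho corr] kl.
have bk := @bounded_borel_cell R d n k; have bl := @bounded_borel_cell R d n l.
have dkl := @cell_disjoint R d n k l kl.
have [rint rE] := corr _ _ bk bl dkl.
apply: le_trans (block_bound n k l).
rewrite cell2E -iterated_integral//; [|by case: bk|by case: bl].
rewrite -rE -pair_measureX//; [|by case: bk|by case: bl].
rewrite leeBlDl ?fin_numM ?meanfin//.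
by apply: cov => //; exact: in_unit_cube_cell.
Qed.

(** With [u] the positive part of [rho] and [v] its negative part plus the exponential, the block
    inequality becomes one between two measures. Where [rho] exceeds the bound, [u = rho] and [v] is
    the bound, so that set is null within each block. The diagonal is null because [d] is
    positive. *)
Lemma pair_correlation_le rho C : (0 < d)%N -> C3 <= C -> pair_correlation P rho ->
  {ae leb2, forall p, rho p <= exp_bound kappa C p}.
Proof.
move=> d0 C3C corr; have [mrho corrE] := corr.
pose u p := Num.max (rho p) 0; pose v0 p := Num.max (- rho p) 0.
pose v p := v0 p + exp_bound kappa C3 p.
have mu : measurable_fun setT u by apply: measurable_maxr.
have mv0 : measurable_fun setT v0 by apply: measurable_maxr => //; exact: measurableT_comp.
have mv : measurable_fun setT v by apply: measurable_funD => //; exact: measurable_exp_bound.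
have u0 p : 0 <= u p by rewrite le_max lexx orbT.
have v00 p : 0 <= v0 p by rewrite le_max lexx orbT.
have v_ge0 p : 0 <= v p by rewrite addr_ge0// exp_bound_ge0// ltW.
pose Bl n k l : set (T * T) := cell2 n @^-1` [set (k, l)].
have mBl n k l : measurable (Bl n k l) by exact: measurable_cell2.
have rint n k l : k != l -> leb2.-integrable (Bl n k l) (EFin \o rho).
  move=> kl; rewrite /Bl cell2E.
  have [] // := corrE _ _ (@bounded_borel_cell R d n k) (@bounded_borel_cell R d n l)
    (@cell_disjoint R d n k l kl).
have v0int n k l : k != l -> leb2.-integrable (Bl n k l) (EFin \o v0).
  move=> kl; apply: le_integrable (rint n k l kl) => //.
    by apply: measurable_funTS; exact/measurable_EFinP.
  move=> p _; rewrite /= lee_fin [leLHS]ger0_norm// /v0 ge_max normr_ge0 andbT.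
  by rewrite -normrN ler_norm.
have eint n k l : leb2.-integrable (Bl n k l) (EFin \o exp_bound kappa C3).
  rewrite /Bl cell2E; apply: exp_bound_integrable; [exact: ltW|exact: bounded_borel_cell..].
have uv n k l : k != l -> (\int[leb2]_(p in Bl n k l) (u p)%:E <=
    \int[leb2]_(p in Bl n k l) (v p)%:E)%E.
  move=> kl.
  have -> : (\int[leb2]_(p in Bl n k l) (u p)%:E =
     \int[leb2]_(p in Bl n k l) (rho p)%:E + \int[leb2]_(p in Bl n k l) (v0 p)%:E)%E.
    rewrite -integralD//; [|exact: rint|exact: v0int].
    apply: eq_integral => p _; rewrite -EFinD; congr EFin.
    by rewrite /u /v0 !maxEle; case: ifP; case: ifP => ? ?; lra.
  have -> : (\int[leb2]_(p in Bl n k l) (v p)%:E = \int[leb2]_(p in Bl n k l) (exp_bound kappa C3 p)%:E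
     + \int[leb2]_(p in Bl n k l) (v0 p)%:E)%E.
    rewrite -integralD//; [|exact: v0int].
    by apply: eq_integral => p _; rewrite -EFinD addrC.
  by rewrite leeD2r// pair_correlation_block.
have vfin n k l : k != l -> (\int[leb2]_(p in Bl n k l) (v p)%:E < +oo)%E.
  move=> kl; have := integrable_lty (mBl n k l) (integrableD (mBl n k l) (v0int n k l kl) (eint n k l)).
  by under eq_integral do rewrite /= -EFinD.
(* As measures with densities [u] and [v], the block inequalities extend to every measurable set off
   the diagonal, in particular to a block cut with [Z]. *)
pose mu1 : {measure set (T * T) -> \bar R} := density_measure leb2 mu u0.
pose mu2 : {measure set (T * T) -> \bar R} := density_measure leb2 mv v_ge0.
have le12 D : measurable D -> D `<=` [set p | p.1 != p.2] -> (mu1 D <= mu2 D)%E.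
  by move=> mD Doff; apply: (measure_le_offdiag (mu := mu1) (nu := mu2)).
pose Z : set (T * T) := [set p | exp_bound kappa C3 p < rho p].
have mZ : measurable Z.
  rewrite (_ : Z = (fun p => exp_bound kappa C3 p < rho p) @^-1` [set true]).
    rewrite -[_ @^-1` _]setTI; apply: measurable_fun_ltr => //; exact: measurable_exp_bound.
  by apply/seteqP; split => p.
have Z0 n k l : k != l -> leb2 (Bl n k l `&` Z) = 0%E.
  move=> kl; have mC : measurable (Bl n k l `&` Z) by exact: measurableI.
  have CE p : (Bl n k l `&` Z) p -> u p = rho p /\ v p = exp_bound kappa C3 p.
    move=> [_ Zp]; have e0 := @exp_bound_ge0 kappa C3 p (ltW C30).
    rewrite /Z/= in Zp; rewrite /v /u /v0; split; first by rewrite max_l// ltW// (le_lt_trans e0).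
    by rewrite max_r ?add0r// oppr_le0 ltW// (le_lt_trans e0).
  apply: (@integral_null_gt _ _ _ leb2 _ u v) => //.
  - by move=> p Cp; have [-> ->] := CE p Cp; rewrite exp_bound_ge0 ?(ltW C30)//; case: Cp.
  - apply: le_lt_trans (vfin n k l kl); apply: ge0_subset_integral => //.
      by apply: measurable_funTS; exact/measurable_EFinP.
    by move=> p _; rewrite lee_fin.
  - apply: le12 => // p [[pk pl] _] /=; apply: contra_neq kl => pp.
    by rewrite -[k]pk -[l]pl pp.
pose D : set (T * T) := [set p | p.1 = p.2].
have mD : measurable D.
  rewrite (_ : D = ~` [set p | p.1 != p.2]); first by apply: measurableC; exact: measurable_offdiag.
  by apply/seteqP; split => p /=; [move=> ->; rewrite eqxx|move=> /negP; rewrite negbK => /eqP].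
have dia0 : leb2.-negligible D.
  by exists D; split => //; exact: lebesgue_diagonal.
have off0 : leb2.-negligible (Z `&` [set p | p.1 != p.2]).
  have mO : measurable ([set p | p.1 != p.2] : set (T * T)) by exact: measurable_offdiag.
  have mZO : measurable (Z `&` [set p | p.1 != p.2]) by exact: measurableI.
  (* The null blocks are glued by the same comparison, with Lebesgue measure on [Z] against the zero
     measure. *)
  pose leb2Z : {measure set (T * T) -> \bar R} := mrestr leb2 mZ.
  pose zero : {measure set (T * T) -> \bar R} := mzero.
  have leb2Z0 n k l : k != l -> (leb2Z (Bl n k l) <= zero (Bl n k l))%E.
    by move=> kl; rewrite /leb2Z /mrestr/= /mrestr Z0.
  have zerofin n k l : k != l -> (zero (Bl n k l) < +oo)%E by move=> _; exact: ltry.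
  have := measure_le_offdiag leb2Z0 zerofin mZO (@subIsetr _ _ _).
  rewrite /leb2Z/= /mrestr setIAC setIid => h.
  by exists (Z `&` [set p | p.1 != p.2]); split => //; apply/eqP; rewrite -measure_le0.
apply: negligibleS (negligibleU dia0 off0) => p /= /negP; rewrite -ltNge => h.
have [|pp] := eqVneq p.1 p.2; [by left|right; split => //].
by apply: le_lt_trans h; rewrite /exp_bound ler_wpM2r// expR_ge0.
Qed.

End pair_correlation_bound.

Section tonelli_product.
Context d1 d2 (T1 : measurableType d1) (T2 : measurableType d2) (R : realType).
Variables (m1 : {sigma_finite_measure set T1 -> \bar R})
  (m2 : {sigma_finite_measure set T2 -> \bar R}).
Local Open Scope ereal_scope.

Lemma integral_product (A : set T1) (B : set T2) (f : T1 -> R) (g : T2 -> R) :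
  measurable A -> measurable B -> measurable_fun setT f -> measurable_fun setT g ->
  (forall x, (0 <= f x)%R) -> (forall y, (0 <= g y)%R) ->
  \int[m1 \x m2]_(p in A `*` B) (f p.1 * g p.2)%:E =
  \int[m1]_(x in A) (f x)%:E * \int[m2]_(y in B) (g y)%:E.
Proof.
move=> mA mB mf mg f0 g0; have mAB : measurable (A `*` B) by exact: measurableX.
have mfg : measurable_fun setT (fun p : T1 * T2 => (f p.1 * g p.2)%:E).
  apply/measurable_EFinP; apply: measurable_funM; exact: measurableT_comp.
have fg0 p : 0 <= (f p.1 * g p.2)%:E by rewrite lee_fin mulr_ge0.
rewrite integral_mkcond fubini_tonelli1; last 2 first.
- by apply/(measurable_restrictT _ mAB); exact: measurable_funTS.
- by move=> p; exact: erestrict_ge0.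
have mg' : measurable_fun B (EFin \o g) by apply: measurable_funTS; exact/measurable_EFinP.
have mf' : measurable_fun A (EFin \o f) by apply: measurable_funTS; exact/measurable_EFinP.
rewrite -ge0_integralZr//; last 2 first.
- by move=> x _; rewrite lee_fin.
- by apply: integral_ge0 => y _; rewrite lee_fin.
rewrite [RHS]integral_mkcond; apply: eq_integral => x _; rewrite /fubini_F patchE.
case: ifPn => [|/negP]; rewrite inE => Ax.
  rewrite -ge0_integralZl//; [|by move=> y _; rewrite lee_fin|by rewrite lee_fin].
  rewrite [RHS]integral_mkcond; apply: eq_integral => y _; rewrite !patchE.
  have -> : ((x, y) \in A `*` B) = (y \in B).
    by apply/idP/idP; rewrite !inE; [case|split].
  by rewrite EFinM.
by rewrite integral0_eq// => y _; rewrite patchE memNset// => -[].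
Qed.

End tonelli_product.

Section product_sigma_finite.
Context d1 d2 (T1 : measurableType d1) (T2 : measurableType d2) (R : realType).
Variables (m1 : {sigma_finite_measure set T1 -> \bar R})
  (m2 : {sigma_finite_measure set T2 -> \bar R}).

(* The canonical instances of [m1 \x m2] in the library are those of products
   of sub-probabilities, hence this alias. *)
Definition sigma_finite_product : set (T1 * T2) -> \bar R := (m1 \x m2)%E.

HB.instance Definition _ := Measure.copy sigma_finite_product (m1 \x m2)%E.

Let sfp : sigma_finite setT sigma_finite_product.
Proof.
have /sigma_finiteP[F [TF ndF /all_and2[mF Foo]]] := sigma_finiteT m1.
have /sigma_finiteP[G [TG ndG /all_and2[mG Goo]]] := sigma_finiteT m2.
exists (fun n => F n `*` G n) => [|n].
  apply/esym; rewrite -subTset => -[x y] _.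
  have [n _ Fx] : (\bigcup_n F n) x by rewrite -TF.
  have [m _ Gy] : (\bigcup_n G n) y by rewrite -TG.
  exists (maxn n m) => //; split => /=.
    by move: x Fx; apply/subsetPset/ndF; rewrite leq_maxl.
  by move: y Gy; apply/subsetPset/ndG; rewrite leq_maxr.
split; first exact: measurableX.
rewrite /sigma_finite_product product_measure1E//.
by apply: lte_mul_pinfty; [|rewrite ge0_fin_numE//; exact: Foo|exact: Goo].
Qed.

HB.instance Definition _ := Measure_isSigmaFinite.Build _ _ _ sigma_finite_product sfp.

End product_sigma_finite.

(** * Existence of the correlation function and its versions *)

Section pair_correlation_existence.
Context {R : realType} {d : nat}.
Local Notation Om := (config R d).
Local Notation T := (d.-tuple R).
Local Notation leb := (lebesgue_tuple d).
Local Notation leb2 := (lebesgue_tuple d \x lebesgue_tuple d)%E.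
Local Open Scope ereal_scope.
Implicit Types (A B : set T) (rho : T * T -> R).
Variable P : probability Om R.

Lemma pair_correlation_ae rho rho' : pair_correlation P rho -> measurable_fun setT rho' ->
  {ae leb2, forall p, rho p = rho' p} -> pair_correlation P rho'.
Proof.
move=> [mrho corr] mrho' ae; split => // A B bA bB AB.
have [mA _] := bA; have [mB _] := bB; have mAB : measurable (A `*` B) by exact: measurableX.
have [rint rE] := corr A B bA bB AB.
have mr : measurable_fun (A `*` B) (EFin \o rho).
  by apply: measurable_funTS; exact/measurable_EFinP.
have mr' : measurable_fun (A `*` B) (EFin \o rho').
  by apply: measurable_funTS; exact/measurable_EFinP.
have aeE : ae_eq leb2 (A `*` B) (EFin \o rho) (EFin \o rho').
  by apply: filterS ae => p /= -> _.
have r'int : leb2.-integrable (A `*` B) (EFin \o rho').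
  apply/integrableP; split => //.
  rewrite (ae_eq_integral (abse \o (EFin \o rho)))//; first by have /integrableP[] := rint.
  - exact: measurableT_comp.
  - exact: measurableT_comp.
  - by apply: filterS ae => p /= -> _.
split => //; rewrite rE !iterated_integral//.
exact: ae_eq_integral.
Qed.

Variables (alpha : R) (alpha0 : (0 <= alpha)%R).
Hypothesis mean_dom : forall A, measurable A -> mean_measure P A <= alpha%:E * leb A.
Hypothesis pair_dom : forall C, measurable C ->
  pair_measure P C <= (alpha ^+ 2)%:E * leb2 C.

(** With [f] a density of the second factorial moment measure and [h] one of the mean measure,
    [f (x, y) - h x * h y] works: disjoint rectangles avoid the diagonal, where [pair_measure] is
    the mixed moment. *)
Lemma pair_correlation_exists : exists rho, pair_correlation P rho.
Proof.
have [h [mh h0 hE]] := dominated_density alpha0 mean_dom.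
have [f [mf f0 fE]] := @dominated_density _ _ R (pair_measure P)
  (sigma_finite_product (lebesgue_tuple d) (lebesgue_tuple d)) _ (sqr_ge0 alpha) pair_dom.
have mhh : measurable_fun setT (fun p : T * T => h p.1 * h p.2)%R.
  by apply: measurable_funM; exact: measurableT_comp.
exists (fun p => f p - h p.1 * h p.2)%R; split; first exact: measurable_funB.
move=> A B bA bB AB.
have [mA _] := bA; have [mB _] := bB; have mAB : measurable (A `*` B) by exact: measurableX.
have mfin C : bounded_borel C -> mean_measure P C \is a fin_num.
  move=> bC; rewrite ge0_fin_numE// (le_lt_trans (mean_dom bC.1))//.
  by rewrite ltey_eq fin_numM// lebesgue_tuple_bounded.
have fint : leb2.-integrable (A `*` B) (EFin \o f).
  apply/integrableP; split; first by apply: measurable_funTS; exact/measurable_EFinP.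
  rewrite (eq_integral (EFin \o f)) => [|p _]; last by rewrite /= ger0_norm.
  rewrite -fE// (le_lt_trans (pair_dom mAB))// product_measure1E//.
  by rewrite ltey_eq !fin_numM// lebesgue_tuple_bounded.
have hhE : \int[leb2]_(p in A `*` B) (h p.1 * h p.2)%:E = mean_measure P A * mean_measure P B.
  by rewrite integral_product// !hE.
have hhint : leb2.-integrable (A `*` B) (EFin \o (fun p : T * T => h p.1 * h p.2)%R).
  apply/integrableP; split; first by apply: measurable_funTS; exact/measurable_EFinP.
  rewrite (eq_integral (EFin \o (fun p : T * T => h p.1 * h p.2)%R)) => [|p _]; last first.
    by rewrite /= ger0_norm// mulr_ge0.
  by rewrite [X in X < _]hhE ltey_eq fin_numM// mfin.
have rint : leb2.-integrable (A `*` B) (EFin \o (fun p => f p - h p.1 * h p.2)%R).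
  have -> : EFin \o (fun p => f p - h p.1 * h p.2)%R =
      (EFin \o f) \- (EFin \o (fun p : T * T => h p.1 * h p.2)%R).
    by apply/funext => p /=; rewrite EFinB.
  exact: integrableB.
split; first exact: rint.
rewrite (iterated_integral mA mB rint).
transitivity (\int[leb2]_(p in A `*` B) (f p)%:E - \int[leb2]_(p in A `*` B) (h p.1 * h p.2)%:E).
  by rewrite hhE -pair_measureX// fE.
exact/esym/(integralB mAB fint hhint).
Qed.

End pair_correlation_existence.

Theorem theorem3p4 (R : realType) (d : nat) (hd : (0 < d)%N)
  (Ppoi : R -> probability (mark R) R -> probability (config R d) R)
  (hPpoi : forall (alpha : R) (Q : probability (mark R) R), 0 < alpha ->
    is_poisson (intensity alpha Q) (Ppoi alpha Q))
  (lambda : R) (hlambda : 0 < lambda) (Q : probability (mark R) R)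
  (H : set (marked R d) -> config R d -> config R d -> \bar R)
  (hH : is_hamiltonian H)
  (hG : gibbs_state H (Ppoi lambda Q) !=set0)
  (abar : R) (habar : 0 < abar) (Qbar : probability (mark R) R)
  (r0 : R) (hr0 : Qbar [set r | mark_val r <= r0] = 1%E)
  (alphac : \bar R)
  (halphac : percolation_threshold (fun alpha => Ppoi alpha Qbar) alphac)
  (hsub : (abar%:E < alphac)%E)
  (Pdc : set (marked R d) -> config R d -> config R d ->
    probability (config R d * config R d * config R d)%type R)
  (hPdc : disagreement_coupling H (Ppoi lambda Q) (Ppoi abar Qbar) Pdc)
  (kappa : R) (hkappa : 0 < kappa)
  (hdecay : exists2 K : R, 0 < K &
    forall L1 L2 : set (d.-tuple R), measurable L1 -> measurable L2 ->
      in_unit_cube L1 ->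
      (prob_connected (Ppoi abar Qbar) L1 L2 <=
       K%:E * expeR (- (kappa%:E * dist_sets L1 L2)))%E) :
  exists P : probability (config R d) R,
  [/\ gibbs_state H (Ppoi lambda Q) P,
      forall P' : probability (config R d) R,
        gibbs_state H (Ppoi lambda Q) P' ->
        forall E, measurable E -> P' E = P E &
      exists2 K' : R, 0 < K' &
      [/\ forall (L1 L2 : set (d.-tuple R)) (g : config R d)
            (E : set (config R d)),
            bounded_borel L1 -> bounded_borel L2 -> L1 `<=` L2 ->
            in_unit_cube L1 ->
            Omega (~` cyl L2) g -> (forall X, pts g X -> mark_val X.2 <= r0) ->
            F_ (cyl L1) E ->
            (`| gibbs H (Ppoi lambda Q) (cyl L2) g (restr (cyl L1) @^-1` E) -
                P (restr (cyl L1) @^-1` E) | <=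
             K'%:E * expeR (- (kappa%:E * dist_sets L1 (~` L2))))%E,
          forall (L1 L2 : set (d.-tuple R)) (E F : set (config R d)),
            bounded_borel L1 -> bounded_borel L2 -> in_unit_cube L1 ->
            F_ (cyl L1) E -> F_ (cyl L2) F ->
            (`| P (E `&` F) - P E * P F | <=
             K'%:E * expeR (- (kappa%:E * dist_sets L1 L2)))%E,
          exists2 rho : d.-tuple R * d.-tuple R -> R, pair_correlation P rho &
            forall x y, rho (x, y) <= K' * expR (- (kappa * eucl x y)) &
          forall rho : d.-tuple R * d.-tuple R -> R, pair_correlation P rho ->
            {ae (lebesgue_tuple d \x lebesgue_tuple d)%E, forall p,
              rho p <= K' * expR (- (kappa * eucl p.1 p.2))}]].
Proof.
have [K K0 decay] := hdecay; have PP := hPpoi abar Qbar habar.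
have [P GP] := hG.
have [C0 C00 local] := local_event_estimates habar PP hr0 hPdc hkappa K0 decay ler01.
have [C1 C10 mixing] := gibbs_state_mixing habar PP hr0 hPdc hkappa K0 decay.
have [C2 C20 pair] := gibbs_pair_bound habar PP hr0 hPdc hkappa K0 decay.
pose C3 := C2 * expR (kappa * (2 * Num.sqrt d%:R)).
have C30 : 0 < C3 by rewrite mulr_gt0// expR_gt0.
have dom D U : Sbp D -> measurable U ->
    (forall w w', U w -> pts w `<=` pts w' -> U w') ->
    (P (restr D @^-1` U) <= Ppoi abar Qbar (restr D @^-1` U))%E.
  by move=> SD mU Uinc; exact: (gibbs_state_le_poisson hPdc GP).
have mean_dom A := mean_measure_le habar PP dom (A := A).
have pair_dom C := pair_measure_le habar PP dom (C := C).
have meanfin A : bounded_borel A -> mean_measure P A \is a fin_num.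
  move=> bA; rewrite ge0_fin_numE// (le_lt_trans (mean_dom A bA.1))//.
  by rewrite ltey_eq fin_numM// lebesgue_tuple_bounded.
exists P; split => // [P' GP'|]; first exact: (gibbs_state_unique habar PP hr0 hPdc hkappa K0 decay).
have K'0 : 0 < C0 + C1 + C3 by rewrite !addr_gt0.
have mono C A B : C <= C0 + C1 + C3 -> (C%:E * expeR (- (kappa%:E * dist_sets A B)) <=
    (C0 + C1 + C3)%:E * expeR (- (kappa%:E * dist_sets A B)) :> \bar R)%E.
  by move=> CK; apply: lee_wpmul2r; [exact: expeR_ge0|rewrite lee_fin].
have rho_le rho : pair_correlation P rho ->
    {ae (lebesgue_tuple d \x lebesgue_tuple d)%E,
      forall p, rho p <= exp_bound kappa (C0 + C1 + C3) p}.
  apply: (pair_correlation_le hkappa C20 (pair P GP) meanfin hd).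
  by rewrite lerDr addr_ge0// ltW.
(* One constant for all parts: [C0] for (i), [C1] for (ii) and [C3] for (iii). *)
exists (C0 + C1 + C3) => //; split.
- move=> L1 L2 g E bL1 bL2 L12 [a La] g2 gr0 FE.
  have [mE EE] := F_restr (measurable_cyl bL1.1) FE; rewrite EE.
  have [/(_ g g2 gr0)/le_trans + _] := local a L1 L2 E bL1 bL2 La L12 mE EE P GP.
  by apply; apply: mono; rewrite -addrA lerDl addr_ge0// ltW.
- move=> L1 L2 E F bL1 bL2 uL1 FE FF.
  apply: (le_trans (mixing P GP L1 L2 E F bL1 bL2 uL1 FE FF)).
  by apply: mono; rewrite addrAC lerDr addr_ge0// ltW.
- have [rho corr] := pair_correlation_exists (ltW habar) mean_dom pair_dom.
  have mb := measurable_exp_bound kappa (C0 + C1 + C3).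
  (* Truncating at the bound changes [rho] only on a null set, and the truncated version satisfies
     the bound at every pair of points. *)
  exists (fun p => Num.min (rho p) (exp_bound kappa (C0 + C1 + C3) p)).
    have [mrho _] := corr; apply: (pair_correlation_ae corr).
      by apply: measurable_minr; [exact: mrho|exact: mb].
    by apply: filterS (rho_le rho corr) => p h; rewrite min_l.
  by move=> x y; rewrite ge_min lexx orbT.
- exact: rho_le.
Qed.
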